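(* Let $r\geq 2$ be an integer and let $(\Lambda W,d)=(\Lambda(x_1,\dots, x_n,u_1,\dots ,u_n,y),d)$ be a minimal Sullivan model (of a simply-connected space), where the $x_i$ have even degrees and $u_1,\dots,u_n,y$ have odd degrees, such that $dx_i=0$, $du_i=x_i^2$ for $i=1,\dots,n$, and $dy\in \Lambda^2(x_1,\dots, x_n)$. Then $$\mathrm{TC}_r(\Lambda W)=r\cdot \mathrm{cat}(\Lambda W)+\chi_{\pi}(\Lambda W)=r\cdot (n+1)-1.$$
   Context: All spaces are simply-connected CW-complexes of finite type, so Sullivan models $(\Lambda W,d)$ are over $\mathbb{Q}$ with $W=W^{\geq 2}$ of finite type. $\Lambda^2(x_1,\dots,x_n)$ is the space of homogeneous quadratic polynomials in $x_1,\dots,x_n$. The homotopy characteristic is $\chi_\pi(\Lambda W)=\dim W^{even}-\dim W^{odd}$. $\mathrm{cat}(\Lambda W)$ is the rational Lusternik–Schnirelmann category $\mathrm{cat}(Z_0)$ (normalized so that a point has category $0$), where $Z_0$ is the rational space with minimal model $(\Lambda W,d)$; equivalently (Félix–Halperin) the least $k$ such that the projection $\Lambda W\to \Lambda W/\Lambda^{>k}W$ admits a homotopy retraction. For a space $Z$, $\mathrm{TC}_r(Z)$ is the least $k$ such that $Z^r$ is covered by $k+1$ open sets on each of which the evaluation map $Z^{[0,1]}\to Z^r$, $\gamma\mapsto(\gamma(0),\gamma(\tfrac1{r-1}),\dots,\gamma(\tfrac{r-2}{r-1}),\gamma(1))$ has a continuous local section. One writes $\mathrm{TC}_r(\Lambda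 W)=\mathrm{TC}_r(Z_0)$. By a theorem of Carrasquel, $\mathrm{TC}_r(\Lambda W)$ is equivalently the least $k$ such that the projection $\rho^r_k:(\Lambda W)^{\otimes r}\to (\Lambda W)^{\otimes r}/(\ker \mu^r_{\Lambda W})^{k+1}$ admits a homotopy retraction, where $\mu^r_{\Lambda W}:(\Lambda W)^{\otimes r}\to\Lambda W$ is the multiplication. A morphism $\rho:A\to B$ of commutative differential graded algebras (cdga's) admits a homotopy retraction if, for a relative Sullivan model $A\xrightarrow{i} A\otimes\Lambda T\xrightarrow{\simeq}B$ of $\rho$, there is a cdga morphism $\tau:A\otimes\Lambda T\to A$ with $\tau\circ i=\mathrm{id}_A$. *)

(* Defs.v *)
From HB Require Import structures.
From mathcomp Require Import all_boot all_order all_algebra.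

Set Implicit Arguments.
Unset Strict Implicit.
Unset Printing Implicit Defensive.

Import Order.TTheory GRing.Theory Num.Theory.
Local Open Scope ring_scope.

Definition lin_span (V : lmodType rat) (S : V -> Prop) (v : V) : Prop :=
  exists2 s : seq (rat * V),
    (forall p, p \in s -> S p.2) & v = \sum_(p <- s) p.1 *: p.2.

Definition subalg_gen (A : algType rat) (S : A -> Prop) : A -> Prop :=
  lin_span (fun b => exists2 s : seq A,
    (forall a, a \in s -> S a) & b = \prod_(a <- s) a).

(* For an ideal I and m >= 1 this is the ideal I^m. *)
Definition ideal_pow (A : algType rat) (I : A -> Prop) (m : nat) : A -> Prop :=
  lin_span (fun b => exists s : seq A,
    [/\ size s = m, (forall a, a \in s -> I a) & b = \prod_(a <- s) a]).

(* Graded-commutative algebras A = (+)_(k >= 0) A^k over the rationals: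
   [homog k] is the subspace A^k of the total space.  Over rat, the sign rule
   already forces a ^+ 2 = 0 for a of odd degree. *)
Record gca := Gca {
  gca_alg :> algType rat;
  homog : nat -> gca_alg -> Prop;
  homog0 : forall k, homog k 0;
  homogP : forall k (c : rat) a b,
    homog k a -> homog k b -> homog k (c *: a + b);
  homog1 : homog 0 1;
  homogM : forall p q a b, homog p a -> homog q b -> homog (p + q) (a * b);
  homog_sum : forall a, exists N (f : nat -> gca_alg),
    (forall k, homog k (f k)) /\ a = \sum_(k < N) f k;
  homog_direct : forall N (f : nat -> gca_alg), (forall k, homog k (f k)) ->
    \sum_(k < N) f k = 0 -> forall k, (k < N)%N -> f k = 0;
  gca_comm : forall p q a b, homog p a -> homog q b ->
    a * b = (-1) ^+ (p * q) * (b * a)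
}.

Record gca_hom (A B : gca) := GcaHom {
  gca_fun :> {lrmorphism A -> B};
  gca_hom_homog : forall k (a : A), homog k a -> homog k (gca_fun a)
}.

Record cdga := Cdga {
  cdga_gca :> gca;
  diff : {linear cdga_gca -> cdga_gca};
  diff_homog : forall k a, homog k a -> homog k.+1 (diff a);
  diff_Leibniz : forall p a b, homog p a ->
    diff (a * b) = diff a * b + (-1) ^+ p * (a * diff b);
  diff_diff : forall a, diff (diff a) = 0
}.
Arguments diff {c}.

Record cdga_hom (A B : cdga) := CdgaHom {
  cdga_fun :> gca_hom A B;
  cdga_hom_diff : forall a : A, cdga_fun (diff a) = diff (cdga_fun a)
}.

(* H(f) is bijective on H = ker d / im d. *)
Definition quasi_iso (A B : cdga) (f : cdga_hom A B) : Prop :=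
  (forall a : A, diff a = 0 -> (exists b : B, f a = diff b) ->
     exists a' : A, a = diff a') /\
  (forall b : B, diff b = 0 ->
     exists a : A, diff a = 0 /\ exists b' : B, b = f a + diff b').

(* A = Lambda W, where W has the homogeneous basis (w j)_j, |w j| = deg j:
   the universal property of the free graded-commutative algebra. *)
Definition is_free_gca (A : gca) (J : Type) (deg : J -> nat) (w : J -> A) :
    Prop :=
  (forall j, homog (deg j) (w j)) /\
  forall (B : gca) (v : J -> B), (forall j, homog (deg j) (v j)) ->
    (exists h : gca_hom A B, forall j, h (w j) = v j) /\
    (forall h h' : gca_hom A B,
       (forall j, h (w j) = v j) -> (forall j, h' (w j) = v j) -> h =1 h').

(* C = A (x) Lambda T, where T has the homogeneous basis (t j)_j and i is the
   inclusion of A. *)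
Definition is_free_over (A C : gca) (i : gca_hom A C) (J : Type)
    (deg : J -> nat) (t : J -> C) : Prop :=
  (forall j, homog (deg j) (t j)) /\
  forall (B : gca) (f : gca_hom A B) (v : J -> B),
    (forall j, homog (deg j) (v j)) ->
    let extends (h : gca_hom C B) :=
      (forall a, h (i a) = f a) /\ (forall j, h (t j) = v j) in
    (exists h, extends h) /\
    (forall h h', extends h -> extends h' -> h =1 h').

(* Lambda^{>k} W *)
Definition wordlength_gt (A : algType rat) (J : Type) (w : J -> A) (k : nat) :
    A -> Prop :=
  lin_span (fun b => exists2 s : seq J,
    (k < size s)%N & b = \prod_(j <- s) w j).

(* Minimal Sullivan algebra (Lambda W, d) with W = W^{>= 2}.  The sets
   {j | stage j < m} index bases of the usual exhaustive filtration of W;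
   asking for it on the given basis is harmless, because by minimality and
   W = W^{>= 2} one may always take stage := deg. *)
Definition minimal_sullivan (A : cdga) (J : Type) (deg : J -> nat)
    (w : J -> A) : Prop :=
  [/\ forall j, (2 <= deg j)%N,
      is_free_gca deg w,
      exists stage : J -> nat, forall j,
        subalg_gen (fun b => exists2 j', (stage j' < stage j)%N & b = w j')
          (diff (w j))
    & forall j, wordlength_gt w 1 (diff (w j))].

(* i : A -> A (x) Lambda T is a relative Sullivan algebra: T = T^{>= 1} is the
   union of T(0) <= T(1) <= ... with d T(0) in A and
   d T(m+1) in A (x) Lambda T(m); (t j)_j is a basis of T adapted to this
   filtration. *)
Definition relative_sullivan (A C : cdga) (i : cdga_hom A C) : Prop :=
  exists (J : Type) (deg : J -> nat) (t : J -> C) (stage : J -> nat),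
    [/\ forall j, (1 <= deg j)%N,
        is_free_over i deg t
      & forall j,
        subalg_gen (fun b => (exists a, b = i a) \/
            (exists2 j', (stage j' < stage j)%N & b = t j'))
          (diff (t j))].

Definition homotopy_retraction (A B : cdga) (rho : cdga_hom A B) : Prop :=
  exists (C : cdga) (i : cdga_hom A C) (q : cdga_hom C B)
         (tau : cdga_hom C A),
    [/\ relative_sullivan i, quasi_iso q, forall a, q (i a) = rho a
      & forall a, tau (i a) = a].

(* rho : A -> B is (up to isomorphism) the projection A -> A/I. *)
Definition is_quotient (A B : cdga) (rho : cdga_hom A B) (I : A -> Prop) :
    Prop :=
  (forall b, exists a, rho a = b) /\ (forall a, rho a = 0 <-> I a).

Definition is_multilinear (r : nat) (A V : lmodType rat)
    (phi : {ffun 'I_r -> A} -> V) : Prop :=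
  forall (k : 'I_r) (c : rat) (a a' b : {ffun 'I_r -> A}),
    (forall l, l != k -> a l = b l /\ a' l = b l) ->
    b k = c *: a k + a' k -> phi b = c *: phi a + phi a'.

(* T is the tensor power A^{(x) r}, with inj k a = 1 (x)..(x) a (x)..(x) 1 in
   position k, hence a_0 (x)..(x) a_(r-1) = \prod_k inj k (a_k): this product
   is the universal r-linear map.  The sign rules for the product and the
   differential of T are forced by T being a cdga and the inj k cdga
   morphisms. *)
Definition is_tensor_power (r : nat) (A T : cdga)
    (inj : 'I_r -> cdga_hom A T) : Prop :=
  forall (V : lmodType rat) (phi : {ffun 'I_r -> A} -> V), is_multilinear phi ->
    let factors (h : {linear T -> V}) :=
      forall a : {ffun 'I_r -> A}, h (\prod_(k < r) inj k (a k)) = phi a in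
    (exists h, factors h) /\ (forall h h', factors h -> factors h' -> h =1 h').

Definition is_least (P : nat -> Prop) (m : nat) : Prop :=
  P m /\ forall k, P k -> (m <= k)%N.

(* cat(Lambda W) in the form of Felix and Halperin; w is the basis of W. *)
Definition cat_le (A : cdga) (J : Type) (w : J -> A) (k : nat) : Prop :=
  exists (B : cdga) (rho : cdga_hom A B),
    is_quotient rho (wordlength_gt w k) /\ homotopy_retraction rho.

Definition is_cat (A : cdga) (J : Type) (w : J -> A) : nat -> Prop :=
  is_least (cat_le w).

(* TC_r(Lambda W) in the form of Carrasquel.  The multiplication mu^r is the
   unique cdga morphism restricting to the identity on each tensor factor. *)
Definition TC_le (r : nat) (A : cdga) (k : nat) : Prop :=
  exists (T : cdga) (inj : 'I_r -> cdga_hom A T) (mu : cdga_hom T A)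
         (B : cdga) (rho : cdga_hom T B),
    [/\ is_tensor_power inj,
        forall l a, mu (inj l a) = a,
        is_quotient rho (ideal_pow (fun z : T => mu z = 0) k.+1)
      & homotopy_retraction rho].

Definition is_TC (r : nat) (A : cdga) : nat -> Prop := is_least (TC_le r A).

(* dim W^even - dim W^odd, for W with a homogeneous basis of degrees deg. *)
Definition chi_pi (J : finType) (deg : J -> nat) : int :=
  #|[set j | ~~ odd (deg j)]|%:Z - #|[set j | odd (deg j)]|%:Z.

(* Index set of the basis x_1, .., x_n, u_1, .., u_n, y of W. *)
Definition gens (n : nat) : finType := ('I_n + 'I_n + unit)%type.
Definition gx n (i : 'I_n) : gens n := inl (inl i).
Definition gu n (i : 'I_n) : gens n := inl (inr i).
Definition gy n : gens n := inr tt.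

(* Main.v *)
Require Import Defs.
From HB Require Import structures.
From mathcomp Require Import all_boot all_order all_algebra.
From mathcomp Require Import boolp zify.

(** Write N = n + 1.  The proof shows cat = N and TC_r = r N - 1; since there
    are n even and n + 1 odd generators, chi_pi = -1, and both equalities
    follow.

    Upper bounds.  The ideal K of A generated by the u_i and the x_i^2 is
    acyclic: for one pair x, u with du = x^2, the quotient by (u, x^2) has the
    basis 1, x and computes the cohomology, and this argument is iterated over
    the generators.  Let I be a differential ideal contained in K.  Then
    A -> A/I admits a homotopy retraction ([model_retract]): build a relative
    Sullivan model of A -> A/I by adjoining, again and again, a generator t
    that kills a cocycle z of lowest degree in the kernel; as the retraction
    maps z into K, it extends to t by a primitive taken inside K.  In A a word
    of length greater than N repeats an x_i or y, or contains a u_i, so that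
    it lies in K.  In the tensor power A^r the analogous acyclic ideal
    contains u_i and x_i^2 in every position.  Modulo it, the ideal ker mu is
    generated by differences of copies of the x_i, which are combinations of
    r n elements of square zero, and by r - 1 differences of copies of y,
    also of square zero; so a product of r n + r elements of ker mu lies in
    the acyclic ideal ([long_word], [cat_upper], [TC_upper]).

    Lower bounds.  If A -> A/I has a homotopy retraction, every cocycle in I
    is a coboundary ([retraction_exact]), so it suffices to exhibit a cocycle
    deep in I that is not a coboundary.  Correcting x_1 .. x_n y by terms
    containing some u_i gives a cocycle kappa of word length N
    ([kappa_exists]).  A linear form lam on A that vanishes on coboundaries
    and on K, but not on x_1 .. x_n y, shows that kappa is not exact; hence
    cat >= N.  In A^r, put s = x' + x and t = x' - x for the copies x of x_i in
    position 0 and x' in position k.  Then the differences a of the copies of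
    u_i and eta of the copies of y satisfy da = s t and d eta = sum B_j s_j
    with B_j linear in the t_i, so the same construction yields a cocycle in
    (ker mu)^N, equal to prod t_i eta modulo the u's.  For one pair of
    positions more is true: with b = 2 (u + u'), db = s^2 + t^2, and eps
    twice the sum of the copies of y, a cocycle equal to (prod t_i eta) (prod t_i eps)
    modulo the u's exists in (ker mu)^(2n+1) ([zeta_exists]).  The product
    z of this zeta for the positions 0, 1 and of the kappas for the positions
    2, .., r - 1 lies in the power 2n + 1 + (r - 2) N = r N - 1.  Modulo u_i and
    x_i^2 it is a nonzero multiple of the product of all copies of x_1 .. x_n y,
    which is detected by lam tensored with itself r times; so z is not exact
    and TC_r >= r N - 1 ([TC_lower]).

    Since A is only known through the universal property of its generators,
    [tower_iso] first identifies it with an explicit iterated extension of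
    the rationals by one generator at a time.  All inductions (for K, for lam
    and for the tensor powers) run along this tower. *)

Set Implicit Arguments.
Unset Strict Implicit.
Unset Printing Implicit Defensive.

Import Order.TTheory GRing.Theory Num.Theory.
Local Open Scope ring_scope.

(** * Graded-commutative algebras *)

Lemma linear_exists (U V : lmodType rat) (f : U -> V) :
  (forall c a b, f (c *: a + b) = c *: f a + f b) ->
  exists h : {linear U -> V}, h =1 f.
Proof.
move=> H.
pose h : {linear U -> V} := HB.pack f (GRing.isLinear.Build rat U V *:%R f H).
by exists h.
Qed.

Lemma lrmorphism_exists (A B : algType rat) (f : A -> B) :
  (forall c a b, f (c *: a + b) = c *: f a + f b) -> f 1 = 1 ->
  (forall a b, f (a * b) = f a * f b) ->
  exists h : {lrmorphism A -> B}, h =1 f.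
Proof.
move=> H H1 HM.
pose h : {lrmorphism A -> B} := HB.pack f (GRing.isLinear.Build rat A B *:%R f H)
  (GRing.isMonoidMorphism.Build A B f (conj H1 HM)).
by exists h.
Qed.

Lemma sum_truncate (V : nmodType) N M (f : nat -> V) : (N <= M)%N ->
  \sum_(k < M) (if (k < N)%N then f k else 0) = \sum_(k < N) f k.
Proof.
move=> le_NM; rewrite -(big_mkord xpredT (fun k => if (k < N)%N then f k else 0)).
rewrite -(big_mkord xpredT f) (big_cat_nat (n := N)) //=.
rewrite [X in _ + X]big1_seq ?addr0; last first.
  by move=> i /andP [_]; rewrite mem_index_iota => /andP [h _]; rewrite ltnNge h.
by apply: eq_big_nat => i /andP [_ ->].
Qed.

Lemma signZ (A : algType rat) (e : nat) (a : A) : (-1) ^+ e * a = (-1) ^+ e *: a.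
Proof. by rewrite -signr_odd -[in RHS]signr_odd; case: odd; rewrite ?mulN1r ?scaleN1r ?mul1r ?scale1r. Qed.

Section GcaTheory.
Variable A : gca.
Implicit Types (a b : A) (k p q : nat).

Lemma homogZ k (c : rat) a : homog k a -> homog k (c *: a).
Proof. by move=> ha; rewrite -[_ *: _]addr0; apply: homogP => //; apply: homog0. Qed.

Lemma homogD k a b : homog k a -> homog k b -> homog k (a + b).
Proof. by move=> ha hb; rewrite -[a]scale1r; apply: homogP. Qed.

Lemma homogN k a : homog k a -> homog k (- a).
Proof. by move=> ha; rewrite -scaleN1r; apply: homogZ. Qed.

Lemma homogB k a b : homog k a -> homog k b -> homog k (a - b).
Proof. by move=> ha hb; apply: homogD => //; apply: homogN. Qed.

Lemma homog_bigsum k (I : Type) (r : seq I) (P : pred I) (F : I -> A) :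
  (forall i, P i -> homog k (F i)) -> homog k (\sum_(i <- r | P i) F i).
Proof.
move=> H; elim/big_ind: _ => //; first exact: homog0.
by move=> x y; apply: homogD.
Qed.

Lemma homog_sign k e a : homog k a -> homog k ((-1) ^+ e * a).
Proof. by rewrite signZ; apply: homogZ. Qed.

Lemma homogX k e a : homog k a -> homog (k * e) (a ^+ e).
Proof.
move=> ha; elim: e => [|e IH]; first by rewrite muln0 expr0; apply: homog1.
by rewrite exprS mulnS; apply: homogM.
Qed.

(** Homogeneous elements generate additively, so identities that are additive
    in a variable need only be checked on homogeneous elements. *)
Lemma homog_ind (P : A -> Prop) :
  (forall a b, P a -> P b -> P (a + b)) ->
  (forall k a, homog k a -> P a) -> forall a, P a.
Proof.
move=> HD Hh a; have [N [f [hf ->]]] := homog_sum a.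
by elim/big_ind: _ => // [|i _]; [apply: (Hh 0); apply: homog0 | apply: Hh (hf i)].
Qed.

Definition hdec a : {p : nat * (nat -> A) |
  (forall k, homog k (p.2 k)) /\ a = \sum_(k < p.1) p.2 k}.
Proof. by apply: cid; have [N [f H]] := homog_sum a; exists (N, f). Qed.

(** The decomposition supplied by [homog_sum] is chosen once and for all; by
    [homog_direct] the components below do not depend on it. *)
Definition hsize a := (sval (hdec a)).1.
Definition comp k a : A := if (k < hsize a)%N then (sval (hdec a)).2 k else 0.

Lemma comp_homog k a : homog k (comp k a).
Proof.
rewrite /comp; case: ifP => _; last exact: homog0.
by case: (hdec a) => p [/= H _]; apply: H.
Qed.

Lemma comp_sum M a : (hsize a <= M)%N -> a = \sum_(k < M) comp k a.
Proof.
move=> leM; rewrite sum_truncate //.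
by rewrite /hsize; case: (hdec a) => p [].
Qed.

Lemma homog_sum_inj M (f g : nat -> A) : (forall k, homog k (f k)) ->
  (forall k, homog k (g k)) -> \sum_(k < M) f k = \sum_(k < M) g k ->
  forall k, (k < M)%N -> f k = g k.
Proof.
move=> hf hg E k lk; apply/eqP; rewrite -subr_eq0; apply/eqP.
apply: (homog_direct (N := M) (f := fun k => f k - g k)) => //.
  by move=> j; apply: homogB.
by rewrite sumrB E subrr.
Qed.

Lemma comp_uniq N (f : nat -> A) a k : (forall k, homog k (f k)) ->
  a = \sum_(k < N) f k -> comp k a = if (k < N)%N then f k else 0.
Proof.
move=> hf E.
pose M := maxn (maxn N (hsize a)) k.+1.
have := @homog_sum_inj M (fun k => comp k a) (fun k => if (k < N)%N then f k else 0).
apply.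
- by move=> j; apply: comp_homog.
- by move=> j; case: ifP => // _; apply: homog0.
- rewrite -comp_sum; last by rewrite /M; rewrite !leq_max leqnn orbT.
  by rewrite sum_truncate // /M !leq_max leqnn.
- by rewrite /M leq_max leqnn orbT.
Qed.

Lemma comp_is_linear k (c : rat) a b : comp k (c *: a + b) = c *: comp k a + comp k b.
Proof.
pose M := maxn (maxn (hsize a) (hsize b)) k.+1.
rewrite (@comp_uniq M (fun k => c *: comp k a + comp k b)).
- by rewrite /M leq_max leqnn orbT.
- by move=> j; apply: homogP; apply: comp_homog.
rewrite big_split /= -scaler_sumr -!comp_sum //.
  by rewrite /M !leq_max leqnn orbT.
by rewrite /M !leq_max leqnn.
Qed.

Lemma comp0 k : comp k 0 = 0.
Proof.
by have := comp_is_linear k (-1) 0 0; rewrite scaler0 addr0 scaleN1r addNr.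
Qed.

Lemma compD k a b : comp k (a + b) = comp k a + comp k b.
Proof. by rewrite -[a]scale1r comp_is_linear !scale1r. Qed.

Lemma comp_id p k a : homog p a -> comp k a = if k == p then a else 0.
Proof.
move=> ha; rewrite (@comp_uniq p.+1 (fun j => if j == p then a else 0)).
- rewrite ltnS; case: ltngtP => //.
- by move=> j; case: eqP => [->|_] //; apply: homog0.
rewrite (bigD1 ord_max) //= eqxx big1 ?addr0 // => i.
by rewrite -val_eqE /= => /negbTE ->.
Qed.

Lemma homog_unique p q a : homog p a -> homog q a -> a <> 0 -> p = q.
Proof.
move=> hp hq; have := comp_id q hp; rewrite (comp_id _ hq) eqxx.
by case: eqP => // _ ->.
Qed.

(** The involution a |-> (-1)^k a in degree k.  With it the graded Leibniz and
    commutation rules hold for all elements, homogeneous or not. *)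
Definition sgnf a : A := \sum_(k < hsize a) (-1) ^+ k * comp k a.

Lemma sgnfE M a : (hsize a <= M)%N -> sgnf a = \sum_(k < M) (-1) ^+ k * comp k a.
Proof.
move=> le_aM; rewrite /sgnf -(sum_truncate (fun k => (-1) ^+ k * comp k a) le_aM).
apply: eq_bigr => k _; case: ifP => // Hk.
by rewrite /comp Hk mulr0.
Qed.

Lemma sgnf_linear (c : rat) a b : sgnf (c *: a + b) = c *: sgnf a + sgnf b.
Proof.
pose M := maxn (hsize (c *: a + b)) (maxn (hsize a) (hsize b)).
rewrite !(@sgnfE M) /M ?leq_max ?leqnn ?orbT //.
rewrite scaler_sumr -big_split /=; apply: eq_bigr => k _.
by rewrite comp_is_linear mulrDr scalerAr.
Qed.

Lemma sgnf_homog p a : homog p a -> sgnf a = (-1) ^+ p * a.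
Proof.
move=> ha; have E := sgnfE (leq_maxl (hsize a) p.+1).
rewrite E; have Hp : (p < maxn (hsize a) p.+1)%N by rewrite leq_max leqnn orbT.
rewrite (bigD1 (Ordinal Hp)) //= (comp_id _ ha) eqxx big1 ?addr0 // => i.
by rewrite -val_eqE /= (comp_id _ ha) => /negbTE ->; rewrite mulr0.
Qed.

Lemma sgnfD a b : sgnf (a + b) = sgnf a + sgnf b.
Proof. by rewrite -[a]scale1r sgnf_linear !scale1r. Qed.

Lemma signC (e : nat) a : (-1) ^+ e * a = a * (-1) ^+ e.
Proof. by rewrite -signr_odd; case: odd; rewrite ?mulN1r ?mulrN1 ?mul1r ?mulr1. Qed.

Lemma signAC (e : nat) a b : a * ((-1) ^+ e * b) = (-1) ^+ e * (a * b).
Proof. by rewrite mulrA -signC mulrA. Qed.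

Lemma signMM (e : nat) a : (-1) ^+ e * ((-1) ^+ e * a) = a.
Proof. by rewrite mulrA -expr2 sqrr_sign mul1r. Qed.

Lemma sgnfM a b : sgnf (a * b) = sgnf a * sgnf b.
Proof.
elim/homog_ind: a => [a a' Ha Ha'|p a ha]; first by rewrite mulrDl !sgnfD Ha Ha' mulrDl.
elim/homog_ind: b => [b b' Hb Hb'|q b hb]; first by rewrite mulrDr !sgnfD Hb Hb' mulrDr.
rewrite (sgnf_homog (homogM ha hb)) (sgnf_homog ha) (sgnf_homog hb).
by rewrite -!mulrA signAC exprD !mulrA.
Qed.

Lemma sgnf1 : sgnf 1 = 1.
Proof. by rewrite (sgnf_homog (homog1 A)) expr0 mul1r. Qed.

Definition sgn : {lrmorphism A -> A} :=
  sval (cid (lrmorphism_exists sgnf_linear sgnf1 sgnfM)).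

Lemma sgnE p a : homog p a -> sgn a = (-1) ^+ p * a.
Proof. by move=> ha; rewrite /sgn; case: cid => h /= ->; apply: sgnf_homog. Qed.

Lemma sgn_homog p a : homog p a -> homog p (sgn a).
Proof. by move=> ha; rewrite (sgnE ha); apply: homog_sign. Qed.

Lemma sgnK a : sgn (sgn a) = a.
Proof.
elim/homog_ind: a => [a b Ha Hb|k a ha]; first by rewrite !rmorphD /= Ha Hb.
by rewrite (sgnE (sgn_homog ha)) (sgnE ha) signMM.
Qed.

Lemma mul_odd p (z : A) a : odd p -> homog p z -> z * a = sgn a * z.
Proof.
move=> op hz; elim/homog_ind: a => [a b Ha Hb|k a ha].
  by rewrite linearD mulrDr mulrDl Ha Hb.
by rewrite (sgnE ha) (gca_comm hz ha) -signr_odd oddM op signr_odd mulrA.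
Qed.

Lemma mul_even p (z : A) a : ~~ odd p -> homog p z -> z * a = a * z.
Proof.
move=> op hz; elim/homog_ind: a => [a b Ha Hb|k a ha].
  by rewrite mulrDr mulrDl Ha Hb.
by rewrite (gca_comm hz ha) -signr_odd oddM (negbTE op) mul1r.
Qed.

Lemma twice_eq0 (V : lmodType rat) (x : V) : x = - x -> x = 0.
Proof.
move=> E; have /eqP : x *+ 2 = 0 by rewrite mulr2n {1}E addNr.
rewrite -scaler_nat scaler_eq0 => /orP [|/eqP] //.
Qed.

Lemma odd_sqr0 p (z : A) : odd p -> homog p z -> z * z = 0.
Proof.
by move=> op hz; apply: twice_eq0; rewrite {1}(mul_odd _ op hz) (sgnE hz) -signr_odd op mulN1r mulNr.
Qed.

End GcaTheory.
Arguments sgn {A}.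

Lemma gca_hom_sgn (A B : gca) (f : gca_hom A B) a : f (sgn a) = sgn (f a).
Proof.
elim/homog_ind: a => [a b Ha Hb|k a ha]; first by rewrite !rmorphD /= Ha Hb.
by rewrite (sgnE ha) (sgnE (gca_hom_homog f ha)) rmorphM rmorphXn rmorphN1.
Qed.

Lemma gca_hom_comp (A B : gca) (f : gca_hom A B) k a : f (comp k a) = comp k (f a).
Proof.
elim/homog_ind: a => [a b Ha Hb|p a ha]; first by rewrite rmorphD !compD rmorphD /= Ha Hb.
rewrite (comp_id _ ha) (comp_id _ (gca_hom_homog f ha)).
by case: ifP => // _; rewrite rmorph0.
Qed.

Section CdgaTheory.
Variable A : cdga.
Implicit Types a b : A.

Lemma diffM a b : diff (a * b) = diff a * b + sgn a * diff b.
Proof.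
elim/homog_ind: a => [a a' Ha Ha'|p a ha].
  by rewrite !linearD !mulrDl linearD Ha Ha' /= addrACA.
by rewrite (diff_Leibniz _ ha) (sgnE ha) mulrA.
Qed.

Lemma diff_sgn a : diff (sgn a) = - sgn (diff a).
Proof.
elim/homog_ind: a => [a a' Ha Ha'|p a ha]; first by rewrite rmorphD [diff (a + a')]linearD [diff (_ + _)]linearD Ha Ha' /= rmorphD opprD.
rewrite (sgnE ha) (sgnE (diff_homog ha)) exprS mulN1r mulNr opprK -signr_odd.
by case: odd; rewrite ?mulN1r ?mul1r ?linearN.
Qed.

Lemma diff1 : diff (1 : A) = 0.
Proof.
have := diffM 1 1; rewrite !mulr1 rmorph1 mul1r => /eqP.
by rewrite -subr_eq subrr eq_sym => /eqP.
Qed.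

Lemma diff_comp k a : diff (comp k a) = comp k.+1 (diff a).
Proof.
elim/homog_ind: a => [a b Ha Hb|p a ha]; first by rewrite !(linearD, compD) Ha Hb.
rewrite (comp_id _ ha) (comp_id _ (diff_homog ha)) eqSS.
by case: ifP => // _; rewrite linear0.
Qed.

End CdgaTheory.

Lemma gca_hom_exists (A B : gca) (f : A -> B) :
  (forall c a b, f (c *: a + b) = c *: f a + f b) -> f 1 = 1 ->
  (forall a b, f (a * b) = f a * f b) ->
  (forall k a, homog k a -> homog k (f a)) ->
  exists h : gca_hom A B, h =1 f.
Proof.
move=> HL H1 HM Hh; have [g Hg] := lrmorphism_exists HL H1 HM.
have Hgh : forall k a, homog k a -> homog k (g a) by move=> k a; rewrite Hg; apply: Hh.
by exists (GcaHom Hgh).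
Qed.

Definition cdga_id (A : cdga) : cdga_hom A A :=
  @CdgaHom A A (@GcaHom A A idfun (fun _ _ H => H)) (fun _ => erefl).

Definition gca_compose (A B C : gca) (g : gca_hom B C) (f : gca_hom A B) : gca_hom A C :=
  @GcaHom A C (g \o f) (fun k a H => gca_hom_homog g (gca_hom_homog f H)).

Lemma cdga_compose_diff (A B C : cdga) (g : cdga_hom B C) (f : cdga_hom A B) a :
  gca_compose g f (diff a) = diff (gca_compose g f a).
Proof. by rewrite /= !cdga_hom_diff. Qed.

Definition cdga_compose (A B C : cdga) (g : cdga_hom B C) (f : cdga_hom A B) :
  cdga_hom A C := CdgaHom (cdga_compose_diff g f).

(** * Adjoining one generator *)

Section Decomposable.
Variables (V : lmodType rat) (H : nat -> V -> Prop).
Hypothesis H0 : forall k, H k 0.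
Hypothesis HD : forall k a b, H k a -> H k b -> H k (a + b).

Definition decomposable a := exists N (f : nat -> V),
  (forall k, H k (f k)) /\ a = \sum_(k < N) f k.

Lemma decD a b : decomposable a -> decomposable b -> decomposable (a + b).
Proof.
case=> N [f [hf ->]] [M [g [hg ->]]].
exists (maxn N M), (fun k => (if (k < N)%N then f k else 0) + (if (k < M)%N then g k else 0)).
split.
  by move=> k; apply: HD; case: ifP.
by rewrite big_split /= !sum_truncate // ?leq_maxl ?leq_maxr.
Qed.

Lemma dec_homog k a : H k a -> decomposable a.
Proof.
move=> ha; exists k.+1, (fun j => if j == k then a else 0); split.
  by move=> j; case: eqP => [->|].
rewrite (bigD1 ord_max) //= eqxx big1 ?addr0 // => j.
by rewrite -val_eqE /= => /negbTE ->.
Qed.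

Lemma dec_sum (I : Type) (r : seq I) (F : I -> V) :
  (forall i, decomposable (F i)) -> decomposable (\sum_(i <- r) F i).
Proof.
move=> hF; elim/big_rec: _ => [|i x _]; first exact: (@dec_homog 0).
by apply: decD.
Qed.

End Decomposable.

(** The condition on c for c w to have degree k, when w has degree d: in degrees below d only the
    coefficient 0 is possible, which truncated subtraction would miss. *)
Definition hshift (C : gca) (k d : nat) (c : C) : Prop :=
  if (d <= k)%N then homog (k - d) c else c = 0.

Section HShift.
Variable C : gca.
Implicit Types (a b c : C).

Lemma hshift0 k d : hshift k d (0 : C).
Proof. by rewrite /hshift; case: ifP => // _; apply: homog0. Qed.

Lemma hshiftP k d (r : rat) a b : hshift k d a -> hshift k d b -> hshift k d (r *: a + b).
Proof.
rewrite /hshift; case: ifP => _; first exact: homogP.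
by move=> -> ->; rewrite scaler0 addr0.
Qed.

Lemma hshiftD k d a b : hshift k d a -> hshift k d b -> hshift k d (a + b).
Proof. by move=> ha hb; rewrite -[a]scale1r; apply: hshiftP. Qed.

Lemma hshift_sum k d (I : Type) (r : seq I) (F : I -> C) :
  (forall i, hshift k d (F i)) -> hshift k d (\sum_(i <- r) F i).
Proof. by move=> hF; elim/big_rec: _ => [|i x _]; [apply: hshift0 | apply: hshiftD]. Qed.

Lemma hshiftM k d k' d' a b : hshift k d a -> hshift k' d' b ->
  hshift (k + k') (d + d') (a * b).
Proof.
rewrite {1 2}/hshift; case: ifP => hd; last by move=> -> _; rewrite mul0r; apply: hshift0.
case: ifP => hd'; last by move=> _ ->; rewrite mulr0; apply: hshift0.
move=> ha hb; rewrite /hshift leq_add //.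
have -> : (k + k' - (d + d') = k - d + (k' - d'))%N by lia.
exact: homogM.
Qed.

Lemma hshift_comm k d k' d' a b : ~~ odd d -> ~~ odd d' ->
  hshift k d a -> hshift k' d' b -> a * b = (-1) ^+ (k * k') * (b * a).
Proof.
move=> od od'; rewrite {1 2}/hshift; case: ifP => hd; last by move=> -> _; rewrite mul0r !mulr0.
case: ifP => hd'; last by move=> _ ->; rewrite mul0r !mulr0.
move=> ha hb; rewrite (gca_comm ha hb) -signr_odd -[in RHS]signr_odd !oddM !oddB //.
by rewrite (negbTE od) (negbTE od') !addbF.
Qed.

Lemma hshift_homog p k d c : homog p c -> (p + d)%N = k -> hshift k d c.
Proof. by move=> hc <-; rewrite /hshift leq_addl addnK. Qed.

Lemma hshift_nat k c : hshift k 0 c <-> homog k c.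
Proof. by rewrite /hshift subn0. Qed.

Lemma hshift_sgn k d c : hshift k d c -> hshift k d (sgn c).
Proof. by rewrite /hshift; case: ifP => _; [apply: sgn_homog | move=> ->; rewrite rmorph0]. Qed.

Lemma hshift_sgnE k d c : hshift k d c -> sgn c = (-1) ^+ (k + d) * c.
Proof.
rewrite /hshift; case: ifP => hd; last by move=> ->; rewrite rmorph0 mulr0.
by move=> /sgnE ->; rewrite -signr_odd oddB // -oddD signr_odd.
Qed.

Lemma hshift_direct N d (g : nat -> C) : (forall k, hshift k d (g k)) ->
  \sum_(k < N) g k = 0 -> forall k, (k < N)%N -> g k = 0.
Proof.
move=> hg E k0 lk; have := hg k0; rewrite /hshift; case: ifP => // hd hk0.
have := congr1 (comp (k0 - d)) E; rewrite comp0.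
have -> : comp (k0 - d) (\sum_(k < N) g k) = \sum_(k < N) comp (k0 - d) (g k).
  by elim/big_rec2: _ => [|i x y _ <-]; rewrite ?comp0 ?compD.
rewrite (bigD1 (Ordinal lk)) //= (comp_id _ hk0) eqxx big1 ?addr0 // => j.
rewrite -val_eqE /= => jk; have := hg j; rewrite /hshift; case: ifP => hj.
  by move=> /comp_id ->; rewrite eqn_sub2rE // eq_sym (negbTE jk).
by move=> ->; rewrite comp0.
Qed.

End HShift.

Lemma hshift_diff (C : cdga) k d (c : C) : hshift k d c -> hshift k.+1 d (diff c).
Proof.
rewrite /hshift; case: ifP => hd; last by move=> ->; rewrite linear0; apply: hshift0.
by move=> /diff_homog; rewrite leqW // subSn.
Qed.

(** C' = C (x) Lambda(t) with |t| = e and dt = z: every element is uniquely a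
    sum of terms c t^j, where j < 2 when e is odd.  Uniqueness is stated as a
    universal property for linear maps, the form in which it is used. *)
Record is_adj (C C' : cdga) (i : cdga_hom C C') (e : nat) (t : C') (z : C) : Prop := IsAdj {
  adj_homog : homog e t;
  adj_diff : diff t = i z;
  adj_lin : forall (V : lmodType rat) (g : nat -> {linear C -> V}),
    exists h : {linear C' -> V},
      forall j c, (odd e -> (j < 2)%N) -> h (i c * t ^+ j) = g j c;
  adj_span : forall k y, homog k y -> exists N (c : nat -> C),
    [/\ forall j, hshift k (e * j) (c j),
        forall j, odd e -> (2 <= j)%N -> c j = 0,
        forall j, (N <= j)%N -> c j = 0
      & y = \sum_(j < N) i (c j) * t ^+ j]
}.

(** For e even, C' is the polynomial ring over C, with the rational scalars
    acting through C. *)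
Section PolyExt.
Variables (C : cdga) (e : nat) (z : C).
Hypothesis (he : ~~ odd e) (hz : homog e.+1 z) (dz : diff z = 0).

Definition polyext : Type := {poly C}.
HB.instance Definition _ := GRing.NzRing.copy polyext {poly C}.
Implicit Types p q : polyext.

Definition psc (r : rat) p : polyext := (r%:A : C) *: (p : {poly C}).

Fact psc_A a b p : psc a (psc b p) = psc (a * b) p.
Proof. by rewrite /psc scalerA -scalerAl mul1r scalerA. Qed.
Fact psc_1 : left_id 1 psc. Proof. by move=> p; rewrite /psc scale1r scale1r. Qed.
Fact psc_D : right_distributive psc +%R. Proof. by move=> r p q; rewrite /psc scalerDr. Qed.
Fact psc_Dl p : {morph psc^~ p : a b / a + b}.
Proof. by move=> a b; rewrite /psc !scalerDl. Qed.
HB.instance Definition _ := GRing.Zmodule_isLmodule.Build rat polyext psc_A psc_1 psc_D psc_Dl.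

Fact psc_coef (r : rat) p j : (r *: p : {poly C})`_j = r *: (p : {poly C})`_j.
Proof. by rewrite coefZ -scalerAl mul1r. Qed.

Fact psc_Al (r : rat) p q : r *: (p * q : polyext) = (r *: p : polyext) * q :> polyext.
Proof. by rewrite /GRing.scale /= /psc scalerAl. Qed.
HB.instance Definition _ := GRing.Lmodule_isLalgebra.Build rat polyext psc_Al.
Fact psc_Ar (r : rat) p q : r *: (p * q : polyext) = p * (r *: q : polyext) :> polyext.
Proof.
apply/polyP => j; rewrite psc_coef !coefM scaler_sumr; apply: eq_bigr => k _.
by rewrite psc_coef scalerAr.
Qed.
HB.instance Definition _ := GRing.Lalgebra_isAlgebra.Build rat polyext psc_Ar.

Definition phomog k p := forall j, hshift k (e * j) (p : {poly C})`_j.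

Fact phomog0 k : phomog k 0. Proof. by move=> j; rewrite coef0; apply: hshift0. Qed.
Fact phomogP k (r : rat) p q : phomog k p -> phomog k q -> phomog k (r *: p + q).
Proof. by move=> hp hq j; rewrite coefD psc_coef; apply: hshiftP. Qed.
Fact phomogD k p q : phomog k p -> phomog k q -> phomog k (p + q).
Proof. by move=> hp hq; rewrite -[p]scale1r; apply: phomogP. Qed.
Fact phomog1 : phomog 0 1.
Proof.
move=> j; rewrite coef1; case: eqP => [->|_]; last exact: hshift0.
by rewrite muln0; apply/hshift_nat/homog1.
Qed.
Fact phomogM k l p q : phomog k p -> phomog l q -> phomog (k + l) (p * q).
Proof.
move=> hp hq j; rewrite coefM; apply: hshift_sum => m.
have <- : (e * m + e * (j - m) = e * j)%N by rewrite -mulnDr subnKC // -ltnS.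
by apply: hshiftM.
Qed.
Fact phomog_mono k j (c : C) : homog k c -> phomog (k + e * j) ((c%:P * 'X^j : {poly C}) : polyext).
Proof.
move=> hc l; rewrite coefCM coefXn; case: eqP => [->|_]; last by rewrite mulr0; apply: hshift0.
by rewrite mulr1; apply: hshift_homog hc _.
Qed.
Fact poly_monos p : p = \sum_(j < size (p : {poly C})) (((p : {poly C})`_j)%:P * 'X^j : polyext).
Proof.
rewrite -[LHS](coefK (p : {poly C})) poly_def.
by apply: eq_bigr => j _; rewrite mul_polyC.
Qed.
Fact phomog_sum p : exists N (f : nat -> polyext),
    (forall k, phomog k (f k)) /\ p = \sum_(k < N) f k.
Proof.
rewrite -/(decomposable phomog p) (poly_monos p).
apply: (dec_sum phomog0 phomogD) => j.
elim/homog_ind: ((p : {poly C})`_j) => [a b Ha Hb|k a ha].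
  by rewrite polyCD mulrDl; refine (decD phomog0 phomogD Ha Hb).
exact: (dec_homog phomog0 (phomog_mono j ha)).
Qed.
Fact phomog_direct N (f : nat -> polyext) : (forall k, phomog k (f k)) ->
    \sum_(k < N) f k = 0 -> forall k, (k < N)%N -> f k = 0.
Proof.
move=> hf E k lk; apply/polyP => j; rewrite coef0.
apply: (@hshift_direct _ N (e * j) (fun k => (f k : {poly C})`_j)) lk.
  by move=> l; apply: hf.
by rewrite -coef_sum; rewrite E coef0.
Qed.
Fact coef_sign k (p : {poly C}) j : ((-1) ^+ k * p)`_j = (-1) ^+ k * p`_j.
Proof.
rewrite -signr_odd; have -> : ((-1) ^+ k : C) = (-1) ^+ odd k by rewrite signr_odd.
by case: (odd k); rewrite /= ?expr1 ?expr0 ?mulN1r ?mul1r ?coefN.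
Qed.
Fact phomog_comm k l p q : phomog k p -> phomog l q -> p * q = (-1) ^+ (k * l) * (q * p).
Proof.
move=> hp hq; apply/polyP => n.
rewrite (coef_sign (k * l) (q * p)) coefMr coefM mulr_sumr; apply: eq_bigr => j _.
by apply: hshift_comm (hp _) (hq _); rewrite oddM (negbTE he).
Qed.

Definition polygca : gca := @Gca polyext phomog phomog0 phomogP phomog1 phomogM
  phomog_sum phomog_direct phomog_comm.

Definition psgn p : polyext := map_poly sgn (p : {poly C}).
Definition pdif p : polyext := map_poly diff (p : {poly C}) + (psgn p : {poly C})^`() * z%:P.

Fact pdif_linear (r : rat) p q : pdif (r *: p + q) = r *: pdif p + pdif q.
Proof.
rewrite /pdif scalerDr addrACA; congr (_ + _).
  apply/polyP => j; rewrite coefD psc_coef !coef_map /= coefD psc_coef.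
  by rewrite linearP.
rewrite scalerAl -mulrDl; congr (_ * _).
apply/polyP => j; rewrite coefD psc_coef !coef_deriv /psgn !coef_map /= coefD psc_coef.
by rewrite rmorphD /= linearZ /= mulrnDl scalerMnr.
Qed.
Definition pdiff : {linear polygca -> polygca} := sval (cid (@linear_exists polygca polygca _ pdif_linear)).
Fact pdiffE p : pdiff p = pdif p. Proof. by rewrite /pdiff; case: cid. Qed.

Fact pdif_homog k p : phomog k p -> phomog k.+1 (pdif p).
Proof.
move=> hp j; rewrite /pdif coefD; apply: hshiftD.
  by rewrite coef_map /=; apply: hshift_diff.
rewrite coefMC coef_deriv coef_map /=; have := hshift_sgn (hp j.+1).
move: (sgn _) => c; rewrite -[c *+ _]scaler_nat -scalerAl.
rewrite -[_ *: _]addr0 => hc; apply: hshiftP; last exact: hshift0.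
move: hc; rewrite /hshift mulnS addnC; case: ifP => h1; last first.
  by move=> ->; rewrite mul0r; apply: hshift0.
have h2 : (e * j <= k.+1)%N by apply: leqW; apply: leq_trans h1; rewrite leq_addr.
move=> hc; rewrite h2.
have -> : (k.+1 - e * j = k - (e * j + e) + e.+1)%N by lia.
by apply: homogM.
Qed.
Fact psgn_homog k p : phomog k p -> psgn p = (-1) ^+ k * p.
Proof.
move=> hp; apply/polyP => j; rewrite coef_map /= (hshift_sgnE (hp j)).
by rewrite (coef_sign k p) -signr_odd oddD oddM (negbTE he) addbF signr_odd.
Qed.
Fact zC (p : {poly C}) : z%:P * p = map_poly sgn p * z%:P.
Proof.
by apply/polyP => j; rewrite coefCM coefMC coef_map /= (@mul_odd _ e.+1).
Qed.
Fact mapd_M (p q : {poly C}) : map_poly diff (p * q) =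
  map_poly diff p * q + map_poly sgn p * map_poly diff q.
Proof.
apply/polyP => j; rewrite coef_map /= coefD !coefM -big_split /= linear_sum.
by apply: eq_bigr => k _; rewrite !coef_map /= diffM.
Qed.
Fact pdif_Leibniz k p q : phomog k p ->
  pdif (p * q) = pdif p * q + (-1) ^+ k * (p * pdif q).
Proof.
move=> hp; rewrite mulrA -(psgn_homog hp) /pdif mapd_M /psgn rmorphM /= derivM.
by rewrite !mulrDl mulrDr -!mulrA zC -!addrA; congr (_ + _); rewrite addrCA.
Qed.

Fact pdif_diff p : pdif (pdif p) = 0.
Proof.
have dd : map_poly diff (map_poly diff (p : {poly C})) = 0.
  by apply/polyP => j; rewrite !coef_map /= coef0 diff_diff.
rewrite /pdif /psgn !raddfD /= dd add0r mulrDl.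
have -> : map_poly diff ((map_poly sgn (p : {poly C}))^`() * z%:P) =
   - ((map_poly sgn (map_poly diff (p : {poly C})))^`() * z%:P).
  apply/polyP => j; rewrite coefN coef_map /= !coefMC !coef_deriv !coef_map /=.
  by rewrite diffM dz mulr0 addr0 linearMn /= diff_sgn mulNrn mulNr.
rewrite addrA addNr add0r.
apply/polyP => j; rewrite coef0 coefMC coef_deriv coef_map /= coefMC.
have sz : sgn z = - z by rewrite (sgnE hz) -signr_odd /= he mulN1r.
by rewrite rmorphM /= sz mulrN mulrnAl mulNr -!mulrA (@odd_sqr0 _ e.+1) //= mulr0 oppr0 mul0rn.
Qed.

Fact pdiff_homog k (p : polygca) : homog k p -> homog k.+1 (pdiff p).
Proof. by rewrite pdiffE; apply: pdif_homog. Qed.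
Fact pdiff_Leibniz k (p q : polygca) : homog k p ->
  pdiff (p * q) = pdiff p * q + (-1) ^+ k * (p * pdiff q).
Proof. by rewrite !pdiffE; apply: pdif_Leibniz. Qed.
Fact pdiff_diff (p : polygca) : pdiff (pdiff p) = 0.
Proof. by rewrite !pdiffE pdif_diff. Qed.

Definition polycdga : cdga := Cdga pdiff_homog pdiff_Leibniz pdiff_diff.

Lemma poly_adj : exists (C' : cdga) (i : cdga_hom C C') (t : C'), is_adj i e t z.
Proof.
have [||||i Hi] := @gca_hom_exists C polycdga (fun c => (c%:P : {poly C})).
- by move=> r a b; apply/polyP => j; rewrite coefD psc_coef !coefC; case: eqP => _ //; rewrite ?scaler0 ?addr0.
- by [].
- by move=> a b; apply: polyCM.
- move=> k a ha; have := phomog_mono 0 ha; rewrite muln0 addn0.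
  by rewrite expr0 mulr1.
have Hd c : i (diff c) = diff (i c).
  rewrite !Hi /= pdiffE /pdif /psgn !map_polyC /= derivC mul0r addr0.
  by [].
exists polycdga, (CdgaHom Hd), ('X : {poly C}).
have iE c j : CdgaHom Hd c * ('X : polycdga) ^+ j = (c%:P * 'X^j : {poly C}) by rewrite -Hi.
split.
- by have := phomog_mono 1 (homog1 C); rewrite muln1 mul1r expr1.
- rewrite /= pdiffE /pdif /psgn Hi.
  apply/polyP => j; rewrite coefD coef_map /= coefMC coef_deriv coef_map /= !coefX coefC.
  by case: j => [|[|j]]; rewrite /= ?eqxx ?mulr0n ?mulr1n ?linear0 ?rmorph0 ?diff1 ?rmorph1 ?mul0r ?mul0rn ?mul0r ?mul1r ?add0r ?addr0.
- move=> V g.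
  pose f (p : polygca) := \sum_(j < size (p : {poly C})) g j (p : {poly C})`_j.
  have fE M p : (size (p : {poly C}) <= M)%N -> f p = \sum_(j < M) g j (p : {poly C})`_j.
    move=> le_pM; rewrite /f -(sum_truncate (fun j => g j (p : {poly C})`_j) le_pM).
    apply: eq_bigr => j _; case: ltnP => // h.
    by rewrite nth_default // linear0.
  have [|h Hh] := @linear_exists polygca V f.
    move=> r p q; pose M := maxn (size (r *: p + q : {poly C})) (maxn (size (p : {poly C})) (size (q : {poly C}))).
    rewrite !(fE M) ?leq_max ?leqnn ?orbT // scaler_sumr -big_split /=.
    by apply: eq_bigr => j _; rewrite coefD psc_coef linearP.
  exists h => j c _; rewrite iE Hh (fE (maxn j.+1 (size (c%:P * 'X^j)))) ?leq_maxr //.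
  have lj : (j < maxn j.+1 (size (c%:P * 'X^j)%R))%N by rewrite leq_max ltnSn.
  rewrite (bigD1 (Ordinal lj)) //= coefCM coefXn eqxx mulr1 big1 ?addr0 // => l.
  by rewrite -val_eqE /= coefCM coefXn => /negbTE ->; rewrite mulr0 linear0.
- move=> k p hp; exists (size (p : {poly C})), (fun j => (p : {poly C})`_j); split.
  + exact: hp.
  + by rewrite (negbTE he).
  + by move=> j; apply: nth_default.
  + by rewrite {1}[p]poly_monos; apply: eq_bigr => j _; rewrite iE.
Qed.

End PolyExt.

(** For e odd, C' consists of the pairs (a, b), standing for a + b t; moving t
    past an element of C produces the involution [sgn]. *)
Section PairExt.
Variables (C : cdga) (e : nat) (z : C).
Hypothesis (he : odd e) (hz : homog e.+1 z) (dz : diff z = 0).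

Definition pairext : Type := (C * C)%type.
HB.instance Definition _ := GRing.Lmodule.copy pairext (C * C)%type.
Implicit Types p q : pairext.

Definition pmul p q : pairext := (p.1 * q.1, p.1 * q.2 + p.2 * sgn q.1).
Definition pone : pairext := (1, 0).

Fact pmulA : associative pmul.
Proof.
move=> p q r; rewrite /pmul /= mulrA rmorphM /= mulrDr mulrDl !mulrA addrA.
by [].
Qed.
Fact pmul1l : left_id pone pmul.
Proof. by case=> a b; rewrite /pmul /= !mul1r mul0r addr0. Qed.
Fact pmul1r : right_id pone pmul.
Proof. by case=> a b; rewrite /pmul /= !mulr1 mulr0 add0r rmorph1 mulr1. Qed.
Fact pmulDl : left_distributive pmul +%R.
Proof. by move=> p q r; rewrite /pmul /=; congr (_, _); rewrite /= !mulrDl // addrACA. Qed.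
Fact pmulDr : right_distributive pmul +%R.
Proof.
by move=> p q r; rewrite /pmul /=; congr (_, _); rewrite /= ?rmorphD !mulrDr // addrACA.
Qed.
Fact pone_neq0 : pone != 0 :> pairext.
Proof. by apply/eqP => [[]] /eqP; rewrite oner_eq0. Qed.
HB.instance Definition _ := GRing.Zmodule_isNzRing.Build pairext
  pmulA pmul1l pmul1r pmulDl pmulDr pone_neq0.
Fact pair_Al (r : rat) p q : r *: (p * q : pairext) = (r *: p : pairext) * q :> pairext.
Proof.
have H : (r *: (p.1 * q.1), r *: (p.1 * q.2 + p.2 * sgn q.1)) =
  (r *: p.1 * q.1, r *: p.1 * q.2 + r *: p.2 * sgn q.1) by rewrite scalerDr !scalerAl.
exact: H.
Qed.
HB.instance Definition _ := GRing.Lmodule_isLalgebra.Build rat pairext pair_Al.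
Fact pair_Ar (r : rat) p q : r *: (p * q : pairext) = p * (r *: q : pairext) :> pairext.
Proof.
have H : (r *: (p.1 * q.1), r *: (p.1 * q.2 + p.2 * sgn q.1)) =
  (p.1 * (r *: q.1), p.1 * (r *: q.2) + p.2 * sgn (r *: q.1)).
  by rewrite scalerDr [sgn (_ *: _)]linearZ /= !scalerAr.
exact: H.
Qed.
HB.instance Definition _ := GRing.Lalgebra_isAlgebra.Build rat pairext pair_Ar.

Definition qhomog k p := homog k p.1 /\ hshift k e p.2.
Fact qhomog0 k : qhomog k 0. Proof. by split; [apply: homog0 | apply: hshift0]. Qed.
Fact qhomogP k (r : rat) p q : qhomog k p -> qhomog k q -> qhomog k (r *: p + q).
Proof. by case=> ? ? [? ?]; split; [apply: homogP | apply: hshiftP]. Qed.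
Fact qhomogD k p q : qhomog k p -> qhomog k q -> qhomog k (p + q).
Proof. by move=> hp hq; rewrite -[p]scale1r; apply: qhomogP. Qed.
Fact qhomog1 : qhomog 0 1.
Proof. by split; [apply: homog1 | apply: hshift0]. Qed.
Fact qhomogM k l p q : qhomog k p -> qhomog l q -> qhomog (k + l) (p * q).
Proof.
case=> h1 h2 [h3 h4]; split; first exact: homogM.
apply: hshiftD.
  by rewrite -[e]add0n; apply: hshiftM => //; apply/hshift_nat.
by rewrite -[e]addn0; apply: hshiftM => //; apply/hshift_nat/sgn_homog.
Qed.
Fact qhomog_sum p : exists N (f : nat -> pairext),
    (forall k, qhomog k (f k)) /\ p = \sum_(k < N) f k.
Proof.
rewrite -/(decomposable qhomog p).
have -> : p = ((p.1, 0) : pairext) + ((0, p.2) : pairext).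
  by case: p => a b; congr (_, _); rewrite /= ?addr0 ?add0r.
apply: (decD qhomog0 qhomogD).
  elim/homog_ind: (p.1) => [a b Ha Hb|k a ha].
    have -> : ((a + b, 0) : pairext) = ((a, 0) : pairext) + ((b, 0) : pairext).
      by congr (_, _); rewrite /= addr0.
    exact: (decD qhomog0 qhomogD Ha Hb).
  by apply: (dec_homog qhomog0 (k := k)); split=> //; apply: hshift0.
elim/homog_ind: (p.2) => [a b Ha Hb|k a ha].
  have -> : ((0, a + b) : pairext) = ((0, a) : pairext) + ((0, b) : pairext).
    by congr (_, _); rewrite /= addr0.
  exact: (decD qhomog0 qhomogD Ha Hb).
apply: (dec_homog qhomog0 (k := (k + e)%N)); split; first exact: homog0.
exact: hshift_homog ha _.
Qed.
Fact pair_sum N (f : nat -> pairext) :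
  \sum_(k < N) f k = (\sum_(k < N) (f k).1, \sum_(k < N) (f k).2).
Proof. by elim: N => [|N IH]; rewrite ?big_ord0 // !big_ord_recr /= IH. Qed.
Fact qhomog_direct N (f : nat -> pairext) : (forall k, qhomog k (f k)) ->
    \sum_(k < N) f k = 0 -> forall k, (k < N)%N -> f k = 0.
Proof.
move=> hf; rewrite pair_sum => -[E1 E2] k lk.
rewrite [f k]surjective_pairing; congr (_, _).
  by apply: (homog_direct (f := fun k => (f k).1)) lk => // l; case: (hf l).
by apply: (@hshift_direct _ N e (fun k => (f k).2)) lk => // l; case: (hf l).
Qed.
Fact pair_sign k p : (-1) ^+ k * p = ((-1) ^+ k * p.1, (-1) ^+ k * p.2).
Proof.
rewrite -signr_odd; have -> : ((-1) ^+ k : C) = (-1) ^+ odd k by rewrite signr_odd.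
case: p => a b; case: (odd k); rewrite /= ?expr1 ?expr0 ?mulN1r ?mul1r //.
Qed.
Fact qhomog_comm k l p q : qhomog k p -> qhomog l q -> p * q = (-1) ^+ (k * l) * (q * p).
Proof.
case: p q => [a b] [a' b'] [/= ha hb] [/= ha' hb']; rewrite pair_sign /=; congr (_, _).
  exact: gca_comm.
rewrite /= (sgnE ha) (sgnE ha') addrC mulrDr; congr (_ + _).
  move: hb; rewrite /hshift; case: ifP => h; last by move=> ->; rewrite mulr0 !mul0r mulr0.
  move=> hb; rewrite signAC (gca_comm hb ha') mulrA -exprD; congr (_ * _).
  rewrite -signr_odd -[in RHS]signr_odd; congr (_ ^+ nat_of_bool _).
  by rewrite oddD !oddM oddB // he; case: odd; case: odd.
move: hb'; rewrite /hshift; case: ifP => h; last by move=> ->; rewrite mulr0 mul0r mulr0.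
move=> hb'; rewrite signAC (gca_comm ha hb') mulrA -exprD; congr (_ * _).
rewrite -signr_odd -[in RHS]signr_odd; congr (_ ^+ nat_of_bool _).
by rewrite oddD !oddM oddB // he; case: odd; case: odd.
Qed.

Definition pairgca : gca := @Gca pairext qhomog qhomog0 qhomogP qhomog1 qhomogM
  qhomog_sum qhomog_direct qhomog_comm.

Definition qdif p : pairext := (diff p.1 + sgn p.2 * z, diff p.2).
Fact qdif_linear (r : rat) p q : qdif (r *: p + q) = r *: qdif p + qdif q.
Proof.
congr (_, _); last by rewrite /= linearP.
by rewrite /= scalerDr addrACA linearP linearP mulrDl scalerAl.
Qed.
Definition qdiff : {linear pairgca -> pairgca} := sval (cid (@linear_exists pairgca pairgca _ qdif_linear)).
Fact qdiffE p : qdiff p = qdif p. Proof. by rewrite /qdiff; case: cid. Qed.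

Fact zevenC a : z * a = a * z. Proof. by apply: (@mul_even _ e.+1); rewrite //= he. Qed.

Fact qdiff_homog k (p : pairgca) : homog k p -> homog k.+1 (qdiff p).
Proof.
rewrite qdiffE; case: p => a b [/= ha hb]; split; last exact: hshift_diff.
apply: homogD; first exact: diff_homog.
have := hshift_sgn hb; rewrite /hshift; case: ifP => h; last by move=> ->; rewrite mul0r; apply: homog0.
move=> h'; have -> : (k.+1 = k - e + e.+1)%N by lia.
exact: homogM.
Qed.
Fact qdiff_Leibniz k (p q : pairgca) : homog k p ->
  qdiff (p * q) = qdiff p * q + (-1) ^+ k * (p * qdiff q).
Proof.
rewrite !qdiffE; case: p q => [a b] [a' b'] [/= ha hb].
rewrite mulrA pair_sign /= -(sgnE ha).
have -> : (-1) ^+ k * b = - sgn b.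
  by rewrite (hshift_sgnE hb) exprD -[(-1) ^+ e]signr_odd he expr1 mulrN1 mulNr opprK.
congr (_, _) => /=.
  rewrite diffM rmorphD !rmorphM /= sgnK !mulrDl mulrDr -!mulrA zevenC addrA -!addrA.
  by congr (_ + _); rewrite addrA addrC.
rewrite linearD /= !diffM diff_sgn mulrN rmorphD rmorphM /= sgnK !mulrDl !mulNr mulrDr.
rewrite -!mulrA zevenC.
have AC (V : zmodType) (P Q R S U : V) : P + Q + (R - S) = P + U + R + (Q - (S + U)).
  rewrite -!addrA; congr (_ + _); rewrite [U + _]addrC -!addrA opprD -!addrA addNr addr0.
  exact: addrCA.
have -> : sgn z = z by rewrite (sgnE hz) -signr_odd /= he mul1r.
exact: AC.
Qed.
Fact qdiff_diff (p : pairgca) : qdiff (qdiff p) = 0.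
Proof.
rewrite !qdiffE; case: p => a b; congr (_, _) => /=; last exact: diff_diff.
by rewrite linearD /= diff_diff add0r diffM dz mulr0 addr0 diff_sgn mulNr addNr.
Qed.

Definition paircdga : cdga := Cdga qdiff_homog qdiff_Leibniz qdiff_diff.

Lemma pair_adj : exists (C' : cdga) (i : cdga_hom C C') (t : C'), is_adj i e t z.
Proof.
have [||||i Hi] := @gca_hom_exists C paircdga (fun c => ((c, 0) : pairext)).
- by move=> r a b; congr (_, _); rewrite /= scaler0 addr0.
- by [].
- by move=> a b; congr (_, _); rewrite /= mulr0 mul0r addr0.
- by move=> k a ha; split=> //; apply: hshift0.
have Hd c : i (diff c) = diff (i c).
  by rewrite !Hi /= qdiffE; congr (_, _); rewrite /= ?linear0 // mul0r addr0.
exists paircdga, (CdgaHom Hd), ((0, 1) : pairext).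
have i0 c : CdgaHom Hd c * (((0, 1) : pairext) : paircdga) ^+ 0 = ((c, 0) : pairext).
  by rewrite expr0 mulr1 /= Hi.
have i1 c : CdgaHom Hd c * (((0, 1) : pairext) : paircdga) ^+ 1 = ((0, c) : pairext).
  by rewrite expr1 /= Hi; congr (_, _); rewrite /= ?mulr0 // mulr1 mul0r addr0.
split.
- by split; [apply: homog0 | apply: hshift_homog (homog1 C) _].
- rewrite /= qdiffE Hi; congr (_, _) => /=; last exact: diff1.
  by rewrite linear0 rmorph1 mul1r add0r.
- move=> V g; have [|h Hh] := @linear_exists pairgca V (fun p => g 0%N p.1 + g 1%N p.2).
    by move=> r p q; rewrite /= !linearP scalerDr addrACA.
  exists h => j c /(_ he); case: j => [|[|//]] _; rewrite ?i0 ?i1 Hh /=.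
    by rewrite linear0 addr0.
  by rewrite linear0 add0r.
- move=> k p [hp hq]; exists 2%N, (fun j => if j == 0%N then p.1 else if j == 1%N then p.2 else 0); split.
  + case=> [|[|j]] /=; rewrite ?muln0 ?muln1 //; first exact/hshift_nat.
    exact: hshift0.
  + by move=> [|[|j]].
  + by move=> [|[|j]].
  + have s2 (F : nat -> paircdga) : \sum_(j < 2) F j = F 0%N + F 1%N.
      by rewrite !big_ord_recr big_ord0 /= add0r.
    rewrite (s2 (fun j => CdgaHom Hd (if j == 0%N then p.1 else if j == 1%N then p.2 else 0) *
      ((0, 1) : pairext) ^+ j)) i0 i1 /=.
    by case: p {hp hq} => a b; congr (_, _); rewrite /= ?addr0 ?add0r.
Qed.

End PairExt.

Lemma adj_exists (C : cdga) e (z : C) : homog e.+1 z -> diff z = 0 ->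
  exists (C' : cdga) (i : cdga_hom C C') (t : C'), is_adj i e t z.
Proof.
by move=> hz dz; case: (boolP (odd e)) => he; [apply: pair_adj | apply: poly_adj].
Qed.

(** * Spans and generated subalgebras *)

Section LinSpan.
Variables (V : lmodType rat).
Implicit Types (S : V -> Prop) (v : V).

Lemma lin_span_gen S v : S v -> lin_span S v.
Proof.
move=> Sv; exists [:: (1, v)]; last by rewrite big_seq1 scale1r.
by move=> p; rewrite inE => /eqP ->.
Qed.

Lemma lin_span0 S : lin_span S 0.
Proof. by exists [::]; rewrite ?big_nil. Qed.

Lemma lin_spanD S u v : lin_span S u -> lin_span S v -> lin_span S (u + v).
Proof.
case=> s hs -> [r hr ->]; exists (s ++ r); last by rewrite big_cat.
by move=> p; rewrite mem_cat => /orP [/hs|/hr].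
Qed.

Lemma lin_spanZ S c v : lin_span S v -> lin_span S (c *: v).
Proof.
case=> s hs ->; exists [seq (c * p.1, p.2) | p <- s].
  by move=> p /mapP [q /hs Sq ->].
by rewrite big_map scaler_sumr; apply: eq_bigr => p _; rewrite scalerA.
Qed.

Lemma lin_spanN S v : lin_span S v -> lin_span S (- v).
Proof. by rewrite -scaleN1r; apply: lin_spanZ. Qed.

Lemma lin_span_sum S (I : Type) (r : seq I) (F : I -> V) :
  (forall i, lin_span S (F i)) -> lin_span S (\sum_(i <- r) F i).
Proof. by move=> h; elim/big_rec: _ => [|i x _]; [apply: lin_span0 | apply: lin_spanD]. Qed.

Lemma lin_span_ind S (P : V -> Prop) : P 0 ->
  (forall c a b, S a -> P b -> P (c *: a + b)) -> forall v, lin_span S v -> P v.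
Proof.
move=> P0 PD v [s hs ->]; elim: s hs => [|p s IH] hs; first by rewrite big_nil.
rewrite big_cons; apply: PD; first by apply: hs; rewrite mem_head.
by apply: IH => q hq; apply: hs; rewrite inE hq orbT.
Qed.

Lemma lin_span_sub S S' v : (forall a, S a -> S' a) -> lin_span S v -> lin_span S' v.
Proof. by move=> h [s hs ->]; exists s => // p /hs /h. Qed.

End LinSpan.

Lemma lin_span_map (U V : lmodType rat) (f : {linear U -> V}) (S : U -> Prop) (S' : V -> Prop) u :
  (forall a, S a -> lin_span S' (f a)) -> lin_span S u -> lin_span S' (f u).
Proof.
move=> h; apply: (lin_span_ind (P := fun u => lin_span S' (f u))).
  by rewrite linear0; apply: lin_span0.
move=> c a b Sa hb; rewrite linearP; apply: lin_spanD => //.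
by apply: lin_spanZ; apply: h.
Qed.

(** Multiplication is bilinear, so generators suffice; this gives at once the
    multiplicativity of subalgebras, powers of ideals and word length. *)
Lemma lin_span_mul (A : algType rat) (S1 S2 S : A -> Prop) a b :
  (forall x y, S1 x -> S2 y -> lin_span S (x * y)) ->
  lin_span S1 a -> lin_span S2 b -> lin_span S (a * b).
Proof.
move=> h ha hb; move: a ha; apply: lin_span_ind; first by rewrite mul0r; apply: lin_span0.
move=> r a a' Sa ha; rewrite mulrDl -scalerAl; apply: lin_spanD => //; apply: lin_spanZ.
move: b hb {ha}; apply: lin_span_ind; first by rewrite mulr0; apply: lin_span0.
move=> q b b' Sb hb; rewrite mulrDr -scalerAr; apply: lin_spanD => //; apply: lin_spanZ.
exact: h.
Qed.

Section SubalgGen.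
Variables (A : algType rat) (S : A -> Prop).

Lemma subalg_in a : S a -> subalg_gen S a.
Proof.
move=> Sa; apply: lin_span_gen; exists [:: a]; last by rewrite big_seq1.
by move=> b; rewrite inE => /eqP ->.
Qed.
Lemma subalg1 : subalg_gen S 1.
Proof. by apply: lin_span_gen; exists [::]; rewrite ?big_nil. Qed.
Lemma subalgM a b : subalg_gen S a -> subalg_gen S b -> subalg_gen S (a * b).
Proof.
move=> ha hb; apply: (lin_span_mul _ ha hb) => _ _ [s hs ->] [s' hs' ->].
apply: lin_span_gen; exists (s ++ s'); last by rewrite big_cat.
by move=> c; rewrite mem_cat => /orP [/hs|/hs'].
Qed.
Lemma subalgX a n : subalg_gen S a -> subalg_gen S (a ^+ n).
Proof.
move=> ha; elim: n => [|n IH]; first by rewrite expr0; apply: subalg1.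
by rewrite exprS; apply: subalgM.
Qed.
End SubalgGen.

Lemma subalg_sub (A : algType rat) (S S' : A -> Prop) a :
  (forall a, S a -> S' a) -> subalg_gen S a -> subalg_gen S' a.
Proof.
move=> h; apply: lin_span_sub => b [s hs ->].
by exists s => // c /hs /h.
Qed.

Lemma subalg_ind (A : algType rat) (S P : A -> Prop) :
  (forall a b, P a -> P b -> P (a + b)) -> (forall (r : rat) a, P a -> P (r *: a)) ->
  (forall a b, P a -> P b -> P (a * b)) -> P 1 -> (forall a, S a -> P a) ->
  forall y, subalg_gen S y -> P y.
Proof.
move=> PD PZ PM P1 PS; apply: lin_span_ind; first by have := PZ 0 1 P1; rewrite scale0r.
move=> c a b [s hs ->] Pb; apply: PD => //; apply: PZ.
by rewrite big_seq; apply: big_ind => // x /hs; apply: PS.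
Qed.

Lemma subalg_map (A B : algType rat) (f : {lrmorphism A -> B}) (S : A -> Prop) (S' : B -> Prop) y :
  (forall a, S a -> subalg_gen S' (f a)) -> subalg_gen S y -> subalg_gen S' (f y).
Proof.
move=> h; apply: (subalg_ind (P := fun y => subalg_gen S' (f y))) => //.
- by move=> a b ha hb; rewrite rmorphD; apply: lin_spanD.
- by move=> r a ha; rewrite linearZ; apply: lin_spanZ.
- by move=> a b ha hb; rewrite rmorphM; apply: subalgM.
- by rewrite rmorph1; apply: subalg1.
Qed.

(** * Coordinates with respect to an adjoined generator *)

Lemma hshift_mul (B : gca) k d (c w : B) : hshift k d c -> homog d w -> homog k (c * w).
Proof.
rewrite /hshift; case: ifP => h; last by move=> -> _; rewrite mul0r; apply: homog0.
by move=> hc hw; rewrite -(subnK h); apply: homogM.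
Qed.

Lemma hshift_map (A B : gca) (f : gca_hom A B) k d c : hshift k d c -> hshift k d (f c).
Proof.
by rewrite /hshift; case: ifP => _; [apply: gca_hom_homog | move=> ->; rewrite rmorph0].
Qed.

Lemma odd_expr0 (B : gca) e (v : B) j : odd e -> homog e v -> (2 <= j)%N -> v ^+ j = 0.
Proof.
by move=> oe hv; case: j => [|[|j]] // _; rewrite !exprS mulrA (odd_sqr0 oe hv) mul0r.
Qed.

Lemma swap_mul (B : gca) p q (a x b y : B) : homog p x -> homog q b ->
  a * x * (b * y) = (-1) ^+ (p * q) * (a * b * (x * y)).
Proof.
move=> hx hb; rewrite mulrA -[a * x * b]mulrA (gca_comm hx hb) signAC.
by rewrite -!mulrA.
Qed.

Lemma odd_cases e j : (odd e -> (j < 2)%N) \/ odd e /\ (2 <= j)%N.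
Proof. by case: (odd e); case: (ltnP j 2) => h; [left | right | left | left]. Qed.

Section AdjTheory.
Variables (C C' : cdga) (i : cdga_hom C C') (e : nat) (t : C') (z : C).
Hypothesis H : is_adj i e t z.

Let ht := adj_homog H.

Lemma adj_coefs : exists coef : nat -> {linear C' -> C},
  forall j l c, (odd e -> (l < 2)%N) -> coef j (i c * t ^+ l) = if l == j then c else 0.
Proof.
have h j : exists f : {linear C' -> C},
    forall l c, (odd e -> (l < 2)%N) -> f (i c * t ^+ l) = if l == j then c else 0.
  have [f hf] := adj_lin H (fun l => if l == j then idfun : {linear C -> C} else \0 : {linear C -> C}).
  by exists f => l c /hf ->; case: eqP.
by have [f hf] := choice h; exists f => j l c; apply: hf.
Qed.

(** The coefficient of t^j; it is 0 for j > 1 when e is odd. *)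
Definition acoef : nat -> {linear C' -> C} := sval (cid adj_coefs).

Lemma acoefE j l c : (odd e -> (l < 2)%N) -> acoef j (i c * t ^+ l) = if l == j then c else 0.
Proof. by rewrite /acoef; case: cid => /= f; apply. Qed.

Lemma acoef_sum N (c : nat -> C) j : (forall j, odd e -> (2 <= j)%N -> c j = 0) ->
  (forall j, (N <= j)%N -> c j = 0) ->
  acoef j (\sum_(l < N) i (c l) * t ^+ l) = c j.
Proof.
move=> h2 hN.
have hl l : acoef j (i (c l) * t ^+ l) = if l == j then c l else 0.
  have [ok|[oe l2]] := odd_cases e l; first exact: acoefE.
  by rewrite h2 // rmorph0 mul0r linear0; case: eqP.
rewrite linear_sum /=; have [lj|nj] := ltnP j N; last first.
  rewrite hN // big1 // => l _; rewrite hl ifN //.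
  by apply/eqP => E; move: (ltn_ord l); rewrite E ltnNge nj.
rewrite (bigD1 (Ordinal lj)) //= hl eqxx big1 ?addr0 // => l.
by rewrite -val_eqE /= hl => /negbTE ->.
Qed.

Lemma adj_ind (P : C' -> Prop) : (forall a b, P a -> P b -> P (a + b)) ->
  (forall k j c, homog k c -> P (i c * t ^+ j)) -> forall y, P y.
Proof.
move=> PD Pm; apply: homog_ind => // k y hy.
have [N [c [_ _ _ ->]]] := adj_span H hy.
elim/big_ind: _ => // [|l _].
  by have := Pm 0%N 0%N 0 (homog0 _ 0); rewrite rmorph0 mul0r.
elim/homog_ind: (c l) => [a b Ha Hb|q a ha]; first by rewrite rmorphD mulrDl; apply: PD.
exact: Pm ha.
Qed.

Lemma adj_ind' (P : C' -> Prop) : (forall a b, P a -> P b -> P (a + b)) ->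
  (forall j c, P (i c * t ^+ j)) -> forall y, P y.
Proof. by move=> PD Pm; apply: adj_ind => // k j c _. Qed.

Lemma acoef_odd j y : odd e -> (2 <= j)%N -> acoef j y = 0.
Proof.
move=> oe j2; elim/adj_ind': y => [a b Ha Hb|l c]; first by rewrite linearD Ha Hb addr0.
have [l2|l2] := ltnP l 2; last by rewrite (odd_expr0 oe ht l2) mulr0 linear0.
by rewrite acoefE // ifN // ltn_eqF // (leq_trans l2).
Qed.

Lemma acoef_homog k j y : homog k y -> hshift k (e * j) (acoef j y).
Proof. by move=> hy; have [N [c [h1 h2 h3 ->]]] := adj_span H hy; rewrite acoef_sum. Qed.

Lemma acoef_fin y : exists N, (forall j, (N <= j)%N -> acoef j y = 0) /\
  y = \sum_(j < N) i (acoef j y) * t ^+ j.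
Proof.
suff [N hN] : exists N, forall M, (N <= M)%N -> acoef M y = 0 /\
    y = \sum_(j < M) i (acoef j y) * t ^+ j.
  by exists N; split; [move=> j /hN [] | have [] := hN N (leqnn N)].
elim/homog_ind: y => [a b [N hN] [M hM]|k y hy].
  exists (maxn N M) => L; rewrite geq_max => /andP [/hN [a0 aE] /hM [b0 bE]].
  rewrite linearD a0 b0 addr0; split => //.
  rewrite {1}aE {1}bE -big_split /=; apply: eq_bigr => j _.
  by rewrite linearD rmorphD mulrDl.
have [N [c [h1 h2 h3 E]]] := adj_span H hy.
have cE j : acoef j y = c j by rewrite E acoef_sum.
exists N => M le_NM; rewrite cE h3 //; split => //.
rewrite [LHS]E -(sum_truncate (fun j => i (c j) * t ^+ j) le_NM).
apply: eq_bigr => j _; rewrite cE; case: ltnP => // /h3 ->.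
by rewrite rmorph0 mul0r.
Qed.

Lemma acoef_inj y y' : (forall j, acoef j y = acoef j y') -> y = y'.
Proof.
move=> E; apply/eqP; rewrite -subr_eq0; apply/eqP.
have [N [_ ->]] := acoef_fin (y - y').
by rewrite big1 // => j _; rewrite linearB /= E subrr rmorph0 mul0r.
Qed.

Lemma acoef_i j c : acoef j (i c) = if j == 0%N then c else 0.
Proof. by rewrite -[i c]mulr1 -[1](expr0 t) acoefE // eq_sym. Qed.

Lemma acoef_it j c : acoef j (i c * t) = if j == 1%N then c else 0.
Proof. by rewrite -[t]expr1 acoefE // eq_sym. Qed.

Lemma acoef_t j : acoef j t = if j == 1%N then 1 else 0.
Proof. by have := acoef_it j 1; rewrite rmorph1 mul1r. Qed.

Lemma adj_inj c c' : i c = i c' -> c = c'.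
Proof. by move=> E; have := acoef_i 0 c; rewrite E acoef_i. Qed.

(** Multiplicativity of the extension is the place where the sign rule enters:
    both sides of h(ab) = h(a)h(b) reorder t^j past a coefficient by the same
    sign. *)
Lemma adj_ext (B : gca) (f : gca_hom C B) (v : B) : homog e v ->
  exists h : gca_hom C' B, (forall c, h (i c) = f c) /\ h t = v.
Proof.
move=> hv.
have gj j : exists g : {linear C -> B}, forall c, g c = f c * v ^+ j.
  by apply: (linear_exists (f := fun c => f c * _)) => r a b; rewrite linearP mulrDl scalerAl.
have [g hg] := choice gj.
have [h0 hh0] := adj_lin H g.
have hh j c : h0 (i c * t ^+ j) = f c * v ^+ j.
  have [ok|[oe j2]] := odd_cases e j; first by rewrite -hg; apply: hh0.
  by rewrite (odd_expr0 oe ht j2) (odd_expr0 oe hv j2) !mulr0 linear0.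
have hi c : h0 (i c) = f c by have := hh 0%N c; rewrite !expr0 !mulr1.
have [||||h Hh] := @gca_hom_exists C' B h0.
- by move=> r a b; rewrite linearP.
- by rewrite -(rmorph1 i) hi rmorph1.
- move=> a b; elim/adj_ind: a => [a a' Ha Ha'|p j c hc]; first by rewrite mulrDl !linearD /= Ha Ha' mulrDl.
  elim/adj_ind: b => [b b' Hb Hb'|q k d hd]; first by rewrite mulrDr !linearD /= Hb Hb' mulrDr.
  rewrite (swap_mul _ _ (homogX j ht) (gca_hom_homog i hd)) !hh.
  rewrite (swap_mul _ _ (homogX j hv) (gca_hom_homog f hd)) -!rmorphM -!exprD.
  by rewrite !signZ linearZ /= hh.
- move=> k y hy; have [N [c [h1 _ _ ->]]] := adj_span H hy.
  rewrite linear_sum /=; apply: homog_bigsum => j _; rewrite hh.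
  apply: (@hshift_mul _ k (e * j)); last exact: homogX.
  exact: hshift_map.
exists h; split=> [c|]; rewrite Hh ?hi //.
by have := hh 1%N 1; rewrite !rmorph1 !mul1r !expr1.
Qed.

Lemma adj_ext_uniq (B : gca) (f g : C' -> B) :
  (forall a b, f (a + b) = f a + f b) -> (forall a b, g (a + b) = g a + g b) ->
  (forall c j, f (i c * t ^+ j) = g (i c * t ^+ j)) -> f =1 g.
Proof.
move=> fD gD E y; elim/adj_ind': y => [a b Ha Hb|j c]; last exact: E.
by rewrite fD gD Ha Hb.
Qed.

Lemma adj_hom_uniq (B : gca) (f g : gca_hom C' B) :
  (forall c, f (i c) = g (i c)) -> f t = g t -> f =1 g.
Proof.
move=> E Et; apply: adj_ext_uniq => [a b|a b|c j]; rewrite ?rmorphD //.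
by rewrite !rmorphM !rmorphXn /= E Et.
Qed.

Lemma adj_cdga_ext (B : cdga) (f : cdga_hom C B) (v : B) : homog e v -> diff v = f z ->
  exists h : cdga_hom C' B, (forall c, h (i c) = f c) /\ h t = v.
Proof.
move=> hv dv; have [h [hi hT]] := adj_ext f hv.
have dX j : h (diff (t ^+ j)) = diff (h (t ^+ j)).
  elim: j => [|j IH]; first by rewrite expr0 rmorph1 !diff1 rmorph0.
  by rewrite exprS diffM rmorphD !rmorphM /= (adj_diff H) hi gca_hom_sgn IH hT diffM dv.
have hd y : h (diff y) = diff (h y).
  elim/adj_ind': y => [a b Ha Hb|j c]; first by rewrite linearD !rmorphD linearD /= Ha Hb.
  rewrite diffM rmorphD !rmorphM /= gca_hom_sgn -cdga_hom_diff !hi dX.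
  by rewrite diffM cdga_hom_diff.
by exists (CdgaHom hd).
Qed.

(** In degrees below |t| only the coefficient of t^0 can be nonzero. *)
Lemma adj_low k y : homog k y -> (k < e)%N -> exists2 c, homog k c & y = i c.
Proof.
move=> hy ke; have [N [_ E]] := acoef_fin y.
exists (acoef 0 y); first by have := acoef_homog 0 hy; rewrite muln0 => /hshift_nat.
apply: acoef_inj => j; rewrite acoef_i; case: j => [//|j] /=.
have := acoef_homog j.+1 hy; rewrite /hshift ifN // -ltnNge mulnS.
by apply: (leq_trans ke); apply: leq_addr.
Qed.

End AdjTheory.

(** Simply connected of finite type, at the level of cochains.  Being of finite
    type is what makes each degree of the model construction terminate. *)
Record sc (C : gca) : Prop := Sc {
  sc0 : forall a : C, homog 0 a -> exists r : rat, a = r *: 1;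
  sc1 : forall a : C, homog 1 a -> a = 0;
  sc_fin : forall k, exists s : seq C, forall a : C, homog k a ->
    lin_span (fun b => b \in s) a
}.

Section AdjSc.
Variables (C C' : cdga) (i : cdga_hom C C') (e : nat) (t : C') (z : C).
Hypothesis (H : is_adj i e t z) (hC : sc C) (e2 : (2 <= e)%N).

Lemma adj_sc : sc C'.
Proof.
split.
- move=> y hy; have [c hc ->] := adj_low H hy (leq_trans (isT : 0 < 2)%N e2).
  by have [r ->] := sc0 hC hc; exists r; rewrite linearZ rmorph1.
- by move=> y hy; have [c hc ->] := adj_low H hy e2; rewrite (sc1 hC hc) rmorph0.
- move=> k; have [s hs] := choice (sc_fin hC).
  exists (flatten [seq [seq i b * t ^+ j | b <- s (k - e * j)%N] | j <- iota 0 k.+1]).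
  move=> y hy; have [N [hN ->]] := acoef_fin H y.
  apply: lin_span_sum => j.
  have := acoef_homog H j hy; rewrite /hshift; case: ifP => hj; last first.
    by move=> ->; rewrite rmorph0 mul0r; apply: lin_span0.
  move=> /hs; have [|f hf] := @linear_exists C C' (fun c => i c * t ^+ j).
    by move=> r a b; rewrite linearP mulrDl scalerAl.
  rewrite -[i _ * _]hf; apply: lin_span_map => a ha; rewrite hf.
  apply: lin_span_gen; apply/flattenP; exists [seq i b * t ^+ j | b <- s (k - e * j)%N].
    apply/mapP; exists (j : nat) => //; rewrite mem_iota /= add0n ltnS.
    by apply: leq_trans hj; apply: leq_pmull; apply: leq_trans e2.
  by apply/mapP; exists a.
Qed.

(** In degree e the new elements are the rational multiples of t, and in degree
    e + 1 there are none, because C^0 = Q and C^1 = 0. *)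
Lemma adj_at y : homog e y -> exists2 c, homog e c & exists r : rat, y = i c + r *: t.
Proof.
move=> hy; exists (acoef H 0 y); first by have := acoef_homog H 0 hy; rewrite muln0 => /hshift_nat.
have := acoef_homog H 1 hy; rewrite muln1 /hshift leqnn subnn => /(sc0 hC) [r hr].
exists r; apply: (acoef_inj (H := H)) => j; rewrite linearD /= acoef_i.
rewrite linearZ /= acoef_t.
case: j => [|[|j]] /=; rewrite ?scaler0 ?addr0 ?add0r //.
have := acoef_homog H j.+2 hy; rewrite /hshift ifN // -ltnNge; nia.
Qed.

Lemma adj_above y : homog e.+1 y -> exists2 c, homog e.+1 c & y = i c.
Proof.
move=> hy; exists (acoef H 0 y); first by have := acoef_homog H 0 hy; rewrite muln0 => /hshift_nat.
apply: (acoef_inj (H := H)) => j; rewrite acoef_i.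
case: j => [|[|j]] //=.
  have := acoef_homog H 1 hy; rewrite muln1 /hshift leqnSn subSn // subnn => /(sc1 hC) //.
have := acoef_homog H j.+2 hy; rewrite /hshift ifN // -ltnNge; nia.
Qed.

End AdjSc.

(** * Acyclic ideals and their extension along the generators *)

(** Closure under [sgn] is the part of gradedness that is stable under taking
    coordinates and enough to control the signs. *)
Record ideal (C : gca) (K : C -> Prop) : Prop := Ideal {
  id0 : K 0;
  idP : forall (r : rat) a b, K a -> K b -> K (r *: a + b);
  idMr : forall a b, K a -> K (a * b);
  idMl : forall a b, K b -> K (a * b);
  idsgn : forall a, K a -> K (sgn a)
}.

Section IdealTheory.
Variables (C : gca) (K : C -> Prop).
Hypothesis hK : ideal K.

Lemma idD a b : K a -> K b -> K (a + b).
Proof. by move=> ha hb; rewrite -[a]scale1r; apply: idP. Qed.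
Lemma idZ r a : K a -> K (r *: a).
Proof. by move=> ha; rewrite -[_ *: _]addr0; apply: idP => //; apply: id0. Qed.
Lemma idN a : K a -> K (- a).
Proof. by move=> ha; rewrite -scaleN1r; apply: idZ. Qed.
Lemma idB a b : K a -> K b -> K (a - b).
Proof. by move=> ha hb; apply: idD => //; apply: idN. Qed.
Lemma idsum (I : Type) (r : seq I) (F : I -> C) : (forall i, K (F i)) -> K (\sum_(i <- r) F i).
Proof. by move=> h; elim/big_rec: _ => [|i x _]; [apply: id0 | apply: idD]. Qed.
End IdealTheory.

Lemma ker_ideal (A B : gca) (f : gca_hom A B) : ideal (fun z => f z = 0).
Proof.
split=> [|c a b ha hb|a b ha|a b hb|a ha]; rewrite ?rmorph0 ?linearP ?rmorphM //=.
- by rewrite ha hb scaler0 addr0.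
- by rewrite ha mul0r.
- by rewrite hb mulr0.
- by rewrite gca_hom_sgn ha rmorph0.
Qed.

(** An ideal with vanishing cohomology.  The first degree in which it is nonzero
    is at least 3 (the u_i and x_i^2 have degree at least 3), so the generators
    adjoined in the model construction have degree at least 2 and preserve
    simple connectedness. *)
Record acyclic (C : cdga) (K : C -> Prop) : Prop := Acyclic {
  ac_ideal : ideal K;
  ac_low : forall k a, K a -> homog k a -> (k <= 2)%N -> a = 0;
  ac_exact : forall k a, K a -> homog k.+1 a -> diff a = 0 ->
    exists w, [/\ K w, homog k w & diff w = a]
}.

Lemma ac_shift (C : cdga) (K : C -> Prop) k d a : acyclic K -> K a ->
  hshift k.+1 d a -> diff a = 0 -> exists w, [/\ K w, hshift k d w & diff w = a].
Proof.
move=> hK Ka; rewrite {1}/hshift; case: ifP => hd ha da; last first.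
  exists 0; split; [exact: id0 (ac_ideal hK) | exact: hshift0 | by rewrite linear0 ha].
have [E|hd'] := leqP d k.
  move: ha; rewrite subSn // => ha; have [w [Kw hw dw]] := ac_exact hK Ka ha da.
  by exists w; split=> //; rewrite /hshift E.
have E : d = k.+1 by apply/eqP; rewrite eqn_leq hd.
rewrite E subnn in ha; exists 0; split; [exact: id0 (ac_ideal hK) | exact: hshift0 |].
by rewrite linear0 (ac_low hK Ka ha).
Qed.

(** The class of top survives in the cohomology of C/K, witnessed by a linear
    form. *)
Definition detects (C : cdga) (K : C -> Prop) (top : C) : Prop :=
  exists l : {linear C -> rat^o},
    [/\ forall a, l (diff a) = 0, forall a, K a -> l a = 0 & l top <> 0].

Section Kext.
Variables (C C' : cdga) (i : cdga_hom C C') (e : nat) (t : C') (z : C).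
Hypothesis H : is_adj i e t z.
Let ht := adj_homog H.

(** The elements whose first m coordinates lie in K.  For m = 2 this is the
    ideal generated by K when t is odd, and by K and t^2 when t is even; for
    m = 1 it is the ideal generated by K and t. *)
Definition Kext m (K : C -> Prop) (y : C') : Prop := forall j, (j < m)%N -> K (acoef H j y).

Lemma tX_comm j a : exists a', (a' = a \/ a' = sgn a) /\ t ^+ j * i a = i a' * t ^+ j.
Proof.
have h := homogX j ht; have [o|o] := boolP (odd (e * j)).
  by exists (sgn a); split; [right | rewrite (mul_odd _ o h) gca_hom_sgn].
by exists a; split; [left | rewrite (mul_even _ o h)].
Qed.

Lemma acoef_mono k n a : acoef H k (i a * t ^+ n) = a /\ n = k \/ acoef H k (i a * t ^+ n) = 0.
Proof.
have [ok|[oe n2]] := odd_cases e n; last by right; rewrite (odd_expr0 oe ht n2) mulr0 linear0.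
by rewrite acoefE //; case: eqP; [left | right].
Qed.

Lemma acoef_sgn j y : acoef H j (sgn y) = (-1) ^+ (e * j) * sgn (acoef H j y).
Proof.
elim/(adj_ind' H): y => [a b Ha Hb|l c].
  by rewrite rmorphD linearD /= Ha Hb linearD rmorphD mulrDr.
rewrite rmorphM /= -gca_hom_sgn (sgnE (homogX l ht)) signAC.
rewrite signZ linearZ /= -signZ.
have [ok|[oe n2]] := odd_cases e l; last first.
  by rewrite (odd_expr0 oe ht n2) !mulr0 !linear0 ?rmorph0 !mulr0.
by rewrite !(acoefE H) //; case: eqP => [->|_] //; rewrite rmorph0 !mulr0.
Qed.

Lemma Kext_ideal m K : ideal K -> ideal (Kext m K).
Proof.
move=> hK.
have K0 : Kext m K 0 by move=> j _; rewrite linear0; apply: id0.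
have KP r a b : Kext m K a -> Kext m K b -> Kext m K (r *: a + b).
  by move=> ha hb j jm; rewrite linearP; apply: idP; [|apply: ha|apply: hb].
have KD a b : Kext m K a -> Kext m K b -> Kext m K (a + b).
  by move=> ha hb; rewrite -[a]scale1r; apply: KP.
have Kmono a n : ((n < m)%N -> K a) -> Kext m K (i a * t ^+ n).
  move=> h k km; have [[-> E]|->] := acoef_mono k n a; last exact: id0.
  by apply: h; rewrite E.
have Ksum (I : Type) (r : seq I) F : (forall i, Kext m K (F i)) -> Kext m K (\sum_(i <- r) F i).
  by move=> h; elim/big_rec: _ => [|j x _] //; apply: KD.
split=> // [a b Ka|a b Kb|a Ka j jm].
- elim/(adj_ind' H): b => [b b' Hb Hb'|n c]; first by rewrite mulrDr; apply: KD.
  have [N [_ ->]] := acoef_fin H a; rewrite mulr_suml; apply: Ksum => l.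
  rewrite mulrA -[_ * t ^+ l * i c]mulrA; have [c' [_ ->]] := tX_comm l c.
  rewrite !mulrA -rmorphM -mulrA -exprD; apply: Kmono => h.
  by apply: (idMr hK); apply: Ka; apply: leq_ltn_trans h; apply: leq_addr.
- elim/(adj_ind' H): a => [a a' Ha Ha'|n c]; first by rewrite mulrDl; apply: KD.
  have [N [_ ->]] := acoef_fin H b; rewrite mulr_sumr; apply: Ksum => l.
  rewrite mulrA -[_ * t ^+ n * i _]mulrA; have [c' [hc' ->]] := tX_comm n (acoef H l b).
  rewrite !mulrA -rmorphM -mulrA -exprD; apply: Kmono => h.
  have Kl : K (acoef H l b) by apply: Kb; apply: leq_ltn_trans h; apply: leq_addl.
  by apply: (idMl hK); case: hc' => ->; [|apply: (idsgn hK)].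
- by rewrite acoef_sgn; apply: (idMl hK); apply: (idsgn hK); apply: Ka.
Qed.

Lemma Kext_i m K c : ideal K -> K c -> Kext m K (i c).
Proof. by move=> hK Kc j _; rewrite acoef_i; case: eqP => // _; apply: id0. Qed.

Lemma diff_even_coef j y : z = 0 -> acoef H j (diff y) = diff (acoef H j y).
Proof.
move=> z0; have dX l : diff (t ^+ l) = 0.
  elim: l => [|l IH]; first by rewrite expr0 diff1.
  by rewrite exprS diffM IH (adj_diff H) z0 rmorph0 mul0r mulr0 addr0.
elim/(adj_ind' H): y => [a b Ha Hb|l c].
  by rewrite linearD /= linearD /= Ha Hb linearD /= linearD.
rewrite diffM dX mulr0 addr0 -cdga_hom_diff.
have [ok|[oe n2]] := odd_cases e l; last by rewrite (odd_expr0 oe ht n2) !mulr0 !linear0.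
by rewrite !(acoefE H) //; case: eqP => _ //; rewrite linear0.
Qed.

Lemma odd_decomp y : odd e -> y = i (acoef H 0 y) + i (acoef H 1 y) * t.
Proof.
move=> oe; apply: (acoef_inj (H := H)) => j; rewrite linearD /= acoef_i acoef_it.
case: j => [|[|j]]; rewrite /= ?addr0 ?add0r //.
exact: (acoef_odd H).
Qed.

Lemma diff_odd_coef y : odd e ->
  acoef H 0 (diff y) = diff (acoef H 0 y) + sgn (acoef H 1 y) * z /\
  acoef H 1 (diff y) = diff (acoef H 1 y).
Proof.
move=> oe; set a := acoef H 0 y; set b := acoef H 1 y.
have -> : diff y = i (diff a + sgn b * z) + i (diff b) * t.
  rewrite {1}(odd_decomp y oe) -/a -/b linearD /= diffM (adj_diff H) -!cdga_hom_diff.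
  by rewrite rmorphD rmorphM /= gca_hom_sgn -addrA [X in _ + X]addrC.
by split; rewrite linearD /= acoef_i acoef_it /= ?addr0 ?add0r.
Qed.

End Kext.

Section StepY.
Variables (C C' : cdga) (i : cdga_hom C C') (e : nat) (t : C') (z : C).
Hypothesis (H : is_adj i e t z) (oe : odd e) (e3 : (3 <= e)%N).
Variables (K : C -> Prop).
Hypothesis hK : acyclic K.
Let iK := ac_ideal hK.

Lemma adj_src_homog : homog e.+1 z.
Proof.
have := acoef_homog H 0 (diff_homog (adj_homog H)).
by rewrite (adj_diff H) acoef_i muln0 => /hshift_nat.
Qed.

(** A cocycle a + b t with a, b in K: first b = d w1, then a corrected by w1 z is
    a cocycle of K, hence a coboundary. *)
Lemma stepy_acyclic : acyclic (Kext H 2 K).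
Proof.
split; first exact: Kext_ideal.
- move=> k a Ka ha k2; have [c hc E] := adj_low H ha (leq_ltn_trans k2 e3).
  have := Ka 0%N isT; rewrite E acoef_i /= => Kc.
  by rewrite (ac_low hK Kc hc k2) rmorph0.
- move=> k y Ky hy dy; set a := acoef H 0 y; set b := acoef H 1 y.
  have [E0 E1] := diff_odd_coef H y oe; rewrite -/a -/b dy !linear0 in E0 E1.
  have ha : homog k.+1 a by have := acoef_homog H 0 hy; rewrite muln0 => /hshift_nat.
  have hb : hshift k.+1 e b by have := acoef_homog H 1 hy; rewrite muln1.
  have [w1 [Kw1 hw1 dw1]] := ac_shift hK (Ky 1%N isT) hb (esym E1).
  have Kc : K (a - sgn w1 * z).
    by apply: idB => //; [apply: (Ky 0%N) | apply: (idMr iK); apply: (idsgn iK)].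
  have hc : homog k.+1 (a - sgn w1 * z).
    apply: homogB => //; have := hshift_sgn hw1; rewrite /hshift; case: ifP => h; last first.
      by move=> ->; rewrite mul0r; apply: homog0.
    move=> h1; have -> : (k.+1 = k - e + e.+1)%N by lia.
    by apply: homogM => //; apply: adj_src_homog.
  have dz : diff z = 0.
    by apply: (adj_inj H); rewrite cdga_hom_diff -(adj_diff H) diff_diff rmorph0.
  have dc : diff (a - sgn w1 * z) = 0.
    by rewrite linearB /= diffM dz mulr0 addr0 diff_sgn dw1 mulNr opprK -E0.
  have [w0 [Kw0 hw0 dw0]] := ac_exact hK Kc hc dc.
  exists (i w0 + i w1 * t); split.
  + move=> [|[|//]] _; rewrite linearD /= acoef_i acoef_it /= ?addr0 ?add0r //.
  + apply: homogD; first exact: gca_hom_homog.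
    exact: hshift_mul (hshift_map i hw1) (adj_homog H).
  + rewrite linearD /= diffM -!cdga_hom_diff dw0 dw1 (adj_diff H) -gca_hom_sgn -rmorphM.
    rewrite rmorphB /= [X in _ + X]addrC addrA subrK.
    by rewrite -(odd_decomp H y oe).
Qed.

(** Integration along t: the new linear form reads off the coefficient of t. *)
Lemma stepy_detects top : detects K top -> detects (Kext H 2 K) (i top * t).
Proof.
case=> l [ld lK lt].
have [|l' hl'] := @linear_exists C' rat^o (fun y => l (acoef H 1 y)).
  by move=> r a b; rewrite !linearP.
exists l'; split=> [y|y Ky|]; rewrite hl'.
- by have [_ ->] := diff_odd_coef H y oe.
- by apply: lK; apply: Ky.
- by rewrite acoef_it.
Qed.

End StepY.

Section StepXU.
Variables (C C' C'' : cdga) (i : cdga_hom C C') (i' : cdga_hom C' C'') (e : nat).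
Variables (x : C') (u : C'').
Hypothesis (H : is_adj i e x 0) (H' : is_adj i' (2 * e).-1 u (x ^+ 2)).
Hypothesis (ee : ~~ odd e) (e2 : (2 <= e)%N).
Variables (K : C -> Prop).
Hypothesis hK : acyclic K.
Let iK := ac_ideal hK.

Let o2e : odd (2 * e).-1. Proof. by lia. Qed.

(** The ideal of C'' generated by K, x^2 and u. *)
Definition Kxu := Kext H' 1 (Kext H 2 K).

Lemma Kxu_ideal : ideal Kxu.
Proof. by apply: Kext_ideal; apply: Kext_ideal. Qed.

(** Division with remainder by x^2. *)
Lemma even_quot p k : homog k p -> exists r, [/\ hshift k (2 * e) r,
   p = i (acoef H 0 p) + i (acoef H 1 p) * x + r * x ^+ 2 &
   forall j, acoef H j r = acoef H j.+2 p].
Proof.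
move=> hp; have [N [hN E]] := acoef_fin H p.
exists (\sum_(j < N) i (acoef H j.+2 p) * x ^+ j).
have cE j : acoef H j (\sum_(j < N) i (acoef H j.+2 p) * x ^+ j) = acoef H j.+2 p.
  apply: (acoef_sum H (c := fun j => acoef H j.+2 p)); first by rewrite (negbTE ee).
  by move=> l hl; apply: hN; rewrite 2?leqW.
split=> //.
  apply: hshift_sum => j; have := acoef_homog H j.+2 hp.
  have hx := homogX j (adj_homog H).
  rewrite {1}/hshift; case: ifP => h; last by move=> ->; rewrite rmorph0 mul0r; apply: hshift0.
  move=> h1; apply: (hshift_homog (homogM (gca_hom_homog i h1) hx)); nia.
apply: (acoef_inj (H := H)) => j; rewrite !linearD /= acoef_i acoef_it.
rewrite mulr_suml linear_sum /=.
have -> : \sum_(l < N) acoef H j (i (acoef H l.+2 p) * x ^+ l * x ^+ 2) =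
    \sum_(l < N) if l.+2 == j then acoef H l.+2 p else 0.
  apply: eq_bigr => l _; rewrite -mulrA -exprD addn2 acoefE //.
  by rewrite (negbTE ee).
case: j => [|[|j]] /=.
- by rewrite big1 ?addr0.
- by rewrite big1 ?addr0 ?add0r.
rewrite !add0r; have [lj|nj] := ltnP j N; last first.
  rewrite hN 2?leqW // big1 // => l _; case: eqP => // [[E']].
  by move: (ltn_ord l); rewrite E' ltnNge nj.
rewrite (bigD1 (Ordinal lj)) //= eqxx big1 ?addr0 // => l.
by rewrite -val_eqE /= !eqSS => /negbTE ->.
Qed.

Lemma acoef_x2 q j : acoef H j.+2 (q * x ^+ 2) = acoef H j q.
Proof.
elim/(adj_ind' H): q => [a b Ha Hb|l c]; first by rewrite mulrDl !linearD /= Ha Hb.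
by rewrite -mulrA -exprD addn2 !acoefE // (negbTE ee).
Qed.

Lemma acoef_x2_low q j : (j < 2)%N -> acoef H j (q * x ^+ 2) = 0.
Proof.
move=> j2; elim/(adj_ind' H): q => [a b Ha Hb|l c]; first by rewrite mulrDl !linearD /= Ha Hb addr0.
rewrite -mulrA -exprD addn2 !acoefE; last by rewrite (negbTE ee).
by case: j j2 => [|[|]].
Qed.

(** For a cocycle p + q u write p = p0 + p1 x + r x^2 with p0, p1 in K.  Comparing
    coefficients, dp0 = dp1 = 0 and dr = - sgn q, so r x^2 + q u is the
    differential of sgn r u, and p0, p1 bound in K. *)
Lemma stepxu_acyclic : acyclic Kxu.
Proof.
split; first exact: Kxu_ideal.
- move=> k a Ka ha k2; have kl : (k < (2 * e).-1)%N by lia.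
  have [p hp E] := adj_low H' ha kl; subst a.
  have := Ka 0%N isT; rewrite acoef_i /= => Kp.
  have -> : p = 0; last by rewrite rmorph0.
  apply: (acoef_inj (H := H)) => j; rewrite linear0.
  have := acoef_homog H j hp; rewrite /hshift; case: ifP => // h hj.
  case: j Kp h hj => [|[|j]] Kp h hj.
  + by apply: (ac_low hK _ hj); [apply: Kp | lia].
  + by apply: (ac_low hK _ hj); [apply: Kp | lia].
  + by exfalso; nia.
- move=> k y Ky hy dy; set p := acoef H' 0 y; set q := acoef H' 1 y.
  have [E0 E1] := diff_odd_coef H' y o2e; rewrite -/p -/q dy !linear0 in E0 E1.
  have hp : homog k.+1 p by have := acoef_homog H' 0 hy; rewrite muln0 => /hshift_nat.
  have [r [hr Er cr]] := even_quot hp.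
  have Kp : Kext H 2 K p by apply: Ky.
  have dpE j : diff (acoef H j p) = - acoef H j (sgn q * x ^+ 2).
    rewrite -diff_even_coef //; apply/eqP; rewrite -addr_eq0 -linearD /= -E0.
    by rewrite linear0.
  have dr : diff r = - sgn q.
    apply: (acoef_inj (H := H)) => j; rewrite linearN /= diff_even_coef // cr dpE.
    by rewrite acoef_x2.
  have dp j : (j < 2)%N -> diff (acoef H j p) = 0.
    by move=> j2; rewrite dpE acoef_x2_low // oppr0.
  have hp0 : homog k.+1 (acoef H 0 p) by have := acoef_homog H 0 hp; rewrite muln0 => /hshift_nat.
  have hp1 : hshift k.+1 e (acoef H 1 p) by have := acoef_homog H 1 hp; rewrite muln1.
  have [w0 [Kw0 hw0 dw0]] := ac_exact hK (Kp 0%N isT) hp0 (dp 0%N isT).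
  have [w1 [Kw1 hw1 dw1]] := ac_shift hK (Kp 1%N isT) hp1 (dp 1%N isT).
  exists (i' (i w0 + i w1 * x) + i' (sgn r) * u); split.
  + move=> [|//] _ j j2; rewrite linearD /= acoef_i acoef_it /= addr0 linearD /= acoef_i acoef_it.
    by case: j j2 => [|[|]] //= _; rewrite ?addr0 ?add0r.
  + apply: homogD.
      apply: gca_hom_homog; apply: homogD; first exact: gca_hom_homog.
      exact: hshift_mul (hshift_map i hw1) (adj_homog H).
    have := hshift_sgn hr; rewrite /hshift; case: ifP => h; last first.
      by move=> ->; rewrite rmorph0 mul0r; apply: homog0.
    move=> h1; have := homogM (gca_hom_homog i' h1) (adj_homog H').
    by congr (homog _ _); lia.
  + rewrite linearD /= diffM -!cdga_hom_diff (adj_diff H') linearD /= diffM.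
    rewrite -!cdga_hom_diff dw0 dw1 (adj_diff H) rmorph0 mulr0 addr0.
    have -> : diff (sgn r) = q by rewrite diff_sgn dr rmorphN /= opprK sgnK.
    rewrite -gca_hom_sgn sgnK [X in _ + X]addrC addrA -rmorphM -rmorphD /=.
    by rewrite -Er -(odd_decomp H' y o2e).
Qed.

(** The new linear form reads off the coefficient of x u^0.  It kills d(q u),
    because that contributes q x^2, which has no coefficient at x. *)
Lemma stepxu_detects top : detects K top -> detects Kxu (i' (i top * x)).
Proof.
case=> l [ld lK lt].
have [|l' hl'] := @linear_exists C'' rat^o (fun y => l (acoef H 1 (acoef H' 0 y))).
  by move=> r a b; rewrite !linearP.
exists l'; split=> [y|y Ky|]; rewrite hl'.
- have [-> _] := diff_odd_coef H' y o2e.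
  by rewrite linearD /= acoef_x2_low // addr0 diff_even_coef.
- by apply: lK; apply: Ky.
- by rewrite acoef_i acoef_it.
Qed.

Lemma Kxu_u : Kxu u.
Proof.
move=> [|//] _; rewrite acoef_t /=; exact: id0 (Kext_ideal H 2 iK).
Qed.

Lemma Kxu_x2 : Kxu (i' x ^+ 2).
Proof.
move=> [|//] _; rewrite -rmorphXn /= acoef_i /= => j j2.
by rewrite -[x ^+ 2]mul1r acoef_x2_low //; apply: id0.
Qed.

Lemma Kxu_i c : K c -> Kxu (i' (i c)).
Proof.
by move=> Kc; apply: Kext_i; [apply: Kext_ideal | apply: Kext_i].
Qed.

End StepXU.

(** * Tensor products and towers of generators *)

Section GroundField.

Definition qhom (k : nat) (a : rat^o) : Prop := (0 < k)%N -> a = 0.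

Fact qhom0 k : qhom k 0. Proof. by []. Qed.
Fact qhomP k (c : rat) (a b : rat^o) : qhom k a -> qhom k b -> qhom k (c *: a + b).
Proof. by move=> ha hb k0; rewrite ha // hb // scaler0 addr0. Qed.
Fact qhom1 : qhom 0 1. Proof. by []. Qed.
Fact qhomM p q (a b : rat^o) : qhom p a -> qhom q b -> qhom (p + q) (a * b).
Proof.
case: p => [|p] ha hb h; last by rewrite ha // mul0r.
by rewrite hb // mulr0.
Qed.
Fact qhom_sum (a : rat^o) : exists N (f : nat -> rat^o),
  (forall k, qhom k (f k)) /\ a = \sum_(k < N) f k.
Proof.
exists 1%N, (fun k => if k == 0%N then a else 0); split.
  by move=> [|k].
by rewrite big_ord_recl big_ord0 addr0.
Qed.
Fact qhom_direct N (f : nat -> rat^o) : (forall k, qhom k (f k)) ->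
  \sum_(k < N) f k = 0 -> forall k, (k < N)%N -> f k = 0.
Proof.
move=> hf E [|k] kN; last exact: hf.
case: N E kN => // N; rewrite big_ord_recl big1 ?addr0 // => j _.
exact: hf.
Qed.
Fact qhom_comm p q (a b : rat^o) : qhom p a -> qhom q b -> a * b = (-1) ^+ (p * q) * (b * a).
Proof.
case: p => [|p] ha; first by rewrite mul0n expr0 mul1r mulrC.
by rewrite ha // mul0r mulr0 mulr0.
Qed.
Definition Qgca : gca := @Gca rat^o qhom qhom0 qhomP qhom1 qhomM qhom_sum qhom_direct qhom_comm.

Fact zero_linear (c : rat) (a b : rat^o) : (0 : rat^o) = c *: (0 : rat^o) + 0.
Proof. by rewrite scaler0 addr0. Qed.
Definition qdiff0 : {linear Qgca -> Qgca} := sval (cid (@linear_exists Qgca Qgca (fun _ => 0) zero_linear)).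
Fact qdiff0E a : qdiff0 a = 0. Proof. by rewrite /qdiff0; case: cid. Qed.
Fact qdiff0_homog k (a : Qgca) : homog k a -> homog k.+1 (qdiff0 a).
Proof. by rewrite qdiff0E => _; apply: qhom0. Qed.
Fact qdiff0_Leibniz p (a b : Qgca) : homog p a ->
  qdiff0 (a * b) = qdiff0 a * b + (-1) ^+ p * (a * qdiff0 b).
Proof. by rewrite !qdiff0E mul0r !mulr0 addr0. Qed.
Fact qdiff0_diff (a : Qgca) : qdiff0 (qdiff0 a) = 0.
Proof. by rewrite qdiff0E. Qed.
Definition Qc : cdga := Cdga qdiff0_homog qdiff0_Leibniz qdiff0_diff.

Lemma Qc_scale (a : Qc) : a = (a : rat) *: 1.
Proof. by rewrite /GRing.scale /= mulr1. Qed.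

Lemma Qc_hom (B : cdga) : exists j : cdga_hom Qc B, forall a : Qc, j a = (a : rat) *: 1.
Proof.
have [||||j Hj] := @gca_hom_exists Qc B (fun a => (a : rat) *: 1).
- by move=> c a b; rewrite scalerDl /= [_ *: a]/GRing.scale /= scalerA.
- by rewrite scale1r.
- by move=> a b; rewrite -scalerAl mul1r scalerA.
- move=> [|k] a ha; first by apply: homogZ; apply: homog1.
  by rewrite ha // scale0r; apply: homog0.
have hd a : j (diff a) = diff (j a).
  by rewrite !Hj linearZ /= diff1 scaler0 qdiff0E scale0r.
by exists (CdgaHom hd).
Qed.

Lemma Qc_hom_uniq (B : gca) (f g : gca_hom Qc B) : f =1 g.
Proof. by move=> a; rewrite (Qc_scale a) !linearZ !rmorph1. Qed.

Lemma Qc_sc : sc Qc.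
Proof.
split.
- by move=> a _; exists (a : rat); apply: Qc_scale.
- by move=> a; apply.
- move=> k; exists [:: 1] => a _; rewrite (Qc_scale a).
  by apply: lin_spanZ; apply: lin_span_gen; rewrite inE.
Qed.

Lemma Qc_acyclic : @acyclic Qc (fun a => a = 0).
Proof.
split.
- split=> //.
  + by move=> r a b -> ->; rewrite scaler0 addr0.
  + by move=> a b ->; rewrite mul0r.
  + by move=> a b ->; rewrite mulr0.
  + by move=> a ->; rewrite rmorph0.
- by [].
- move=> k a -> _ _; exists 0; split; rewrite ?linear0 //; exact: homog0.
Qed.

Lemma Qc_detects : @detects Qc (fun a => a = 0) 1.
Proof.
exists idfun; split=> [a|//|]; first exact: qdiff0E.
by apply/eqP; rewrite oner_eq0.
Qed.

End GroundField.

(** E is the tensor product of C and D: the universal property for bilinear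
    maps, surjectivity, and the universal property for cdga morphisms. *)
Record tens (C D E : cdga) (i : cdga_hom C E) (j : cdga_hom D E) : Prop := Tens {
  tens_lin : forall (V : lmodType rat) (b : C -> D -> V),
    (forall d r c c', b (r *: c + c') d = r *: b c d + b c' d) ->
    (forall c r d d', b c (r *: d + d') = r *: b c d + b c d') ->
    exists h : {linear E -> V}, forall c d, h (i c * j d) = b c d;
  tens_span : forall y, exists s : seq (C * D), y = \sum_(p <- s) i p.1 * j p.2;
  tens_ext : forall (B : cdga) (f : cdga_hom C B) (g : cdga_hom D B),
    exists h : cdga_hom E B, (forall c, h (i c) = f c) /\ (forall d, h (j d) = g d)
}.

Lemma bilin0 (C D : cdga) (V : lmodType rat) (b : C -> D -> V) c :
  (forall c r d d', b c (r *: d + d') = r *: b c d + b c d') -> b c 0 = 0.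
Proof. by move=> h; have := h c (-1) 0 0; rewrite scaler0 addr0 scaleN1r addNr. Qed.

Lemma tens_base (C : cdga) : exists j : cdga_hom Qc C, tens (cdga_id C) j.
Proof.
have [j hj] := Qc_hom C; exists j; split.
- move=> V b bl br; have [|h hh] := @linear_exists C V (fun c => b c (1 : Qc)).
    by move=> r c c'; apply: bl.
  exists h => c d; rewrite hj -scalerAr mulr1 linearZ /= hh.
  by rewrite [in RHS](Qc_scale d) -[_ *: 1]addr0 br (bilin0 _ br) addr0.
- by move=> y; exists [:: (y, 1)]; rewrite big_seq1 rmorph1 mulr1.
- move=> B f g; exists f; split=> // d.
  exact: (Qc_hom_uniq (gca_compose f j) g).
Qed.

(** C (x) D' arises from C (x) D by adjoining a copy of the generator that leads
    from D to D'. *)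
Section TensStep.
Variables (C D E : cdga) (i : cdga_hom C E) (j : cdga_hom D E) (T : tens i j).
Variables (D' : cdga) (i0 : cdga_hom D D') (e : nat) (t : D') (z : D).
Hypothesis H : is_adj i0 e t z.
Variables (E' : cdga) (i1 : cdga_hom E E') (t' : E').
Hypothesis H1 : is_adj i1 e t' (j z).

Lemma tens_step : exists j' : cdga_hom D' E',
  [/\ tens (cdga_compose i1 i) j', forall d, j' (i0 d) = i1 (j d) & j' t = t'].
Proof.
have [|j' [ji jt]] := adj_cdga_ext H (f := cdga_compose i1 j) (adj_homog H1).
  exact: adj_diff H1.
exists j'; split=> //.
have jm d m : j' (i0 d * t ^+ m) = i1 (j d) * t' ^+ m.
  by rewrite rmorphM rmorphXn /= ji jt.
split.
- move=> V b bl br.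
  have hm m : exists h : {linear E -> V}, forall c d, h (i c * j d) = b c (i0 d * t ^+ m).
    apply: (tens_lin T) => [d r c c'|c r d d']; first exact: bl.
    by rewrite linearP mulrDl -scalerAl br.
  have [g hg] := choice hm.
  have [h hh] := adj_lin H1 g; exists h => c d.
  elim/(adj_ind' H): d => [d d' Hd Hd'|m d].
    rewrite rmorphD mulrDr linearD /= Hd Hd'.
    by have := br c 1 d d'; rewrite !scale1r.
  rewrite jm mulrA /= -rmorphM.
  have [ok|[oe m2]] := odd_cases e m; first by rewrite hh ?hg.
  rewrite (odd_expr0 oe (adj_homog H) m2) (odd_expr0 oe (adj_homog H1) m2) !mulr0.
  by rewrite linear0 (bilin0 _ br).
- move=> y; elim/(adj_ind' H1): y => [a b [s ->] [s' ->]|m y].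
    by exists (s ++ s'); rewrite big_cat.
  have [s ->] := tens_span T y.
  exists [seq (p.1, i0 p.2 * t ^+ m) | p <- s]; rewrite big_map rmorph_sum mulr_suml.
  by apply: eq_bigr => p _; rewrite jm rmorphM /= mulrA.
- move=> B f g; have [h [hi hj]] := tens_ext T f (cdga_compose g i0).
  have [|h' [h'i h't]] := adj_cdga_ext H1 (f := h) (gca_hom_homog g (adj_homog H)).
    by rewrite -cdga_hom_diff (adj_diff H) hj.
  exists h'; split=> [c|d]; first by rewrite /= h'i hi.
  elim/(adj_ind' H): d => [d d' Hd Hd'|m d]; first by rewrite !rmorphD /= Hd Hd'.
  by rewrite jm !rmorphM !rmorphXn /= h'i hj h't.
Qed.

End TensStep.

(** Iterated extensions of the ground field by pairs x, u with du = x^2 and by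
    odd generators y; S collects the elements u and x^2, and top is the product
    of the x's and the y's. *)
Inductive tow : forall D : cdga, (D -> Prop) -> D -> Prop :=
| tow0 : @tow Qc (fun _ => False) 1
| towy D S top D' (i : cdga_hom D D') e t z : @tow D S top -> odd e -> (3 <= e)%N ->
    is_adj i e t z -> @tow D' (fun y => exists2 s, S s & y = i s) (i top * t)
| towxu D S top C' D' (i : cdga_hom D C') (i' : cdga_hom C' D') e x u :
    @tow D S top -> ~~ odd e -> (2 <= e)%N ->
    is_adj i e x 0 -> is_adj i' (2 * e).-1 u (x ^+ 2) ->
    @tow D' (fun y => (exists2 s, S s & y = i' (i s)) \/ y = u \/ y = i' x ^+ 2)
       (i' (i top * x)).

(** Tensoring with a tower means adjoining its generators to C, and each of these
    steps extends the acyclic ideal. *)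
Lemma tow_tens D S top : @tow D S top ->
  forall (C : cdga) (K : C -> Prop), sc C -> acyclic K ->
  exists (E : cdga) (i : cdga_hom C E) (j : cdga_hom D E) (K' : E -> Prop),
    [/\ tens i j, sc E, acyclic K',
        forall c, K c -> K' (i c) & forall s, S s -> K' (j s)].
Proof.
elim=> {D S top} [|D S top D' i0 e t z _ IH oe e3 H|D S top C' D' i0 i0' e x u _ IH ee e2 H H'] C K hC hK.
- have [j hj] := tens_base C; exists C, (cdga_id C), j, K; split=> //.
- have [E [i [j [K' [T hE hK' Ki Kj]]]]] := IH C K hC hK.
  have hz := adj_src_homog H.
  have dz : diff z = 0.
    by apply: (adj_inj H); rewrite cdga_hom_diff -(adj_diff H) diff_diff rmorph0.
  have [||E' [i1 [t' H1]]] := @adj_exists E e (j z).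
  + exact: gca_hom_homog.
  + by rewrite -cdga_hom_diff dz rmorph0.
  have [j' [T' ji jt]] := tens_step T H H1.
  exists E', (cdga_compose i1 i), j', (Kext H1 2 K'); split=> //.
  + by apply: (adj_sc H1) => //; apply: ltnW.
  + exact: stepy_acyclic.
  + by move=> c /Ki /(Kext_i H1 (ac_ideal hK')).
  + by move=> _ [s Ss ->]; rewrite ji; apply: (Kext_i H1 (ac_ideal hK')); apply: Kj.
- have [E [i [j [K' [T hE hK' Ki Kj]]]]] := IH C K hC hK.
  have [||E1 [i1 [x1 H1]]] := @adj_exists E e (j 0).
  + by rewrite rmorph0; apply: homog0.
  + by rewrite rmorph0 linear0.
  have [j1 [T1 ji1 jx]] := tens_step T H H1.
  have dx : diff (j1 (x ^+ 2)) = 0.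
    by rewrite -cdga_hom_diff expr2 diffM (adj_diff H) rmorph0 mul0r mulr0 addr0 rmorph0.
  have hx2 : homog (2 * e).-1.+1 (j1 (x ^+ 2)).
    have -> : (2 * e).-1.+1 = (e * 2)%N by lia.
    by apply: gca_hom_homog; apply: homogX; apply: adj_homog H.
  have [E2 [i2 [u2 H2]]] := adj_exists hx2 dx.
  have [j2 [T2 ji2 ju]] := tens_step T1 H' H2.
  rewrite rmorph0 in H1; rewrite rmorphXn /= jx in H2.
  exists E2, (cdga_compose i2 (cdga_compose i1 i)), j2, (Kxu H1 H2 K'); split=> //.
  + apply: (adj_sc H2); last by lia.
    exact: (adj_sc H1).
  + exact: stepxu_acyclic.
  + by move=> c /Ki /(Kxu_i H1 H2 hK').
  + move=> y [[s Ss ->]|[->|->]].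
    * by rewrite ji2 ji1; apply: Kxu_i => //; apply: Kj.
    * by rewrite ju; apply: Kxu_u.
    * by rewrite rmorphXn /= ji2 jx; apply: Kxu_x2.
Qed.

Lemma tow_good D S top : @tow D S top ->
  sc D /\ exists K : D -> Prop, [/\ acyclic K, detects K top & forall s, S s -> K s].
Proof.
elim=> {D S top} [|D S top D' i e t z _ [hD [K [hK dK SK]]] oe e3 H
    |D S top C' D' i i' e x u _ [hD [K [hK dK SK]]] ee e2 H H'].
- split; first exact: Qc_sc.
  by exists (fun a => a = 0); split=> //; [apply: Qc_acyclic | apply: Qc_detects].
- split; first by apply: (adj_sc H) => //; apply: ltnW.
  exists (Kext H 2 K); split; [exact: stepy_acyclic | exact: stepy_detects |].
  by move=> _ [s Ss ->]; apply: (Kext_i H (ac_ideal hK)); apply: SK.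
- split; first by apply: (adj_sc H'); [apply: (adj_sc H) | lia].
  exists (Kxu H H' K); split; [exact: stepxu_acyclic | exact: stepxu_detects |].
  move=> _ [[s Ss ->]|[->|->]]; [|exact: Kxu_u|exact: Kxu_x2].
  by apply: Kxu_i => //; apply: SK.
Qed.

(** The generators are indexed by natural numbers, so that the induction on
    their number m does not change the index type. *)
Lemma build_xu (dx : nat -> nat) : (forall k, ~~ odd (dx k)) -> (forall k, (2 <= dx k)%N) ->
  forall m, exists (D : cdga) (S : D -> Prop) (x u : nat -> D),
  [/\ tow S (\prod_(k < m) x k),
      forall k, (k < m)%N -> [/\ homog (dx k) (x k), homog (2 * dx k).-1 (u k),
        diff (x k) = 0, diff (u k) = x k ^+ 2 & S (u k) /\ S (x k ^+ 2)],
      forall (B : cdga) (vx vu : nat -> B),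
        (forall k, (k < m)%N -> [/\ homog (dx k) (vx k), homog (2 * dx k).-1 (vu k),
          diff (vx k) = 0 & diff (vu k) = vx k ^+ 2]) ->
        exists h : cdga_hom D B, forall k, (k < m)%N -> h (x k) = vx k /\ h (u k) = vu k
    & forall y, subalg_gen (fun b => exists2 k, (k < m)%N & b = x k \/ b = u k) y].
Proof.
move=> ed d2; elim=> [|m [D [S [x [u [tD gD eD uD]]]]]].
  exists Qc, (fun _ => False), (fun _ => 0), (fun _ => 0); split=> //.
  - by rewrite big_ord0; apply: tow0.
  - by move=> B vx vu _; have [h _] := Qc_hom B; exists h.
  - by move=> y; rewrite (Qc_scale y); apply: lin_spanZ; apply: subalg1.
set e := dx m.
have [||C' [i [t H]]] := @adj_exists D e 0; [exact: homog0 | exact: linear0 |].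
have hx2 : homog (2 * e).-1.+1 (t ^+ 2).
  have -> : (2 * e).-1.+1 = (e * 2)%N by have := d2 m; rewrite -/e; lia.
  by apply: homogX; apply: adj_homog H.
have dt : diff t = 0 by rewrite (adj_diff H) rmorph0.
have dx2 : diff (t ^+ 2) = 0 by rewrite expr2 diffM dt mul0r mulr0 addr0.
have [D' [i' [v H']]] := adj_exists hx2 dx2.
have T' := towxu tD (ed m) (d2 m) H H'.
exists D', (fun y => (exists2 s, S s & y = i' (i s)) \/ y = v \/ y = i' t ^+ 2).
exists (fun k => if k == m then i' t else i' (i (x k))).
exists (fun k => if k == m then v else i' (i (u k))); split.
- rewrite big_ord_recr /= eqxx; move: T'.
  congr tow; rewrite !rmorphM !rmorph_prod /=; congr (_ * _).
  by apply: eq_bigr => k _; rewrite ltn_eqF.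
- move=> k; rewrite ltnS leq_eqVlt; case: eqP => [->|_] /= km.
    split.
    + by apply: gca_hom_homog; apply: adj_homog H.
    + exact: adj_homog H'.
    + by rewrite -cdga_hom_diff dt rmorph0.
    + by rewrite (adj_diff H') rmorphXn.
    + by split; right; [left|right].
  have [h1 h2 h3 h4 [h5 h6]] := gD k km; split.
  + by do 2!apply: gca_hom_homog.
  + by do 2!apply: gca_hom_homog.
  + by rewrite -!cdga_hom_diff h3 !rmorph0.
  + by rewrite -!cdga_hom_diff h4 !rmorphXn.
  + split; left; first by exists (u k).
    by exists (x k ^+ 2) => //; rewrite !rmorphXn.
- move=> B vx vu hv; have [k km|h hh] := eD B vx vu; first by apply: hv; apply: ltnW.
  have [g1 g2 g3 g4] := hv m (ltnSn m).
  have [|h1 [h1i h1t]] := adj_cdga_ext H (f := h) g1; first by rewrite rmorph0.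
  have [|h2 [h2i h2t]] := adj_cdga_ext H' (f := h1) g2; first by rewrite rmorphXn /= h1t.
  exists h2 => k; rewrite ltnS leq_eqVlt; case: eqP => [->|_] /= km.
    by rewrite h2i h1t h2t.
  by rewrite !h2i !h1i; apply: hh.
- set G := (fun b => _).
  have Gi c : subalg_gen G (i' (i c)).
    apply: (subalg_map (f := gca_compose i' i)) (uD c) => b [k km hb].
    apply: subalg_in; exists k; first exact: ltnW.
    by rewrite ltn_eqF //; case: hb => ->; [left | right].
  move=> y; elim/(adj_ind' H'): y => [a b|j c]; first exact: lin_spanD.
  apply: subalgM; last first.
    by apply: subalgX; apply: subalg_in; exists m => //; rewrite eqxx; right.
  elim/(adj_ind' H): c => [a b|l c]; first by rewrite rmorphD; apply: lin_spanD.
  rewrite rmorphM rmorphXn /=; apply: subalgM; first exact: Gi.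
  by apply: subalgX; apply: subalg_in; exists m => //; rewrite eqxx; left.
Qed.

(** Both A and the tower are free, so they are isomorphic once the generators
    have matching degrees and differentials.  That |u_i| = 2 |x_i| - 1 needs
    x_i^2 to be nonzero, which is seen by mapping A to a polynomial algebra. *)
Lemma tower_iso (n : nat) (A : cdga) (deg : gens n -> nat) (w : gens n -> A)
    (hA : minimal_sullivan deg w)
    (hx : forall i : 'I_n, ~~ odd (deg (gx i)))
    (hu : forall i : 'I_n, odd (deg (gu i)))
    (hy : odd (deg (gy n)))
    (hdx : forall i : 'I_n, diff (w (gx i)) = 0)
    (hdu : forall i : 'I_n, diff (w (gu i)) = w (gx i) ^+ 2)
    (hdy : exists c : 'M[rat]_n,
       diff (w (gy n)) = \sum_i \sum_j c i j *: (w (gx i) * w (gx j))) :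
  exists (D : cdga) (S : D -> Prop) (top : D) (f : cdga_hom A D) (g : cdga_hom D A),
  [/\ [/\ tow S top, cancel f g & cancel g f],
      top = f ((\prod_(i < n) w (gx i)) * w (gy n)),
      forall a, subalg_gen (fun b => exists j, b = w j) a
    & forall i : 'I_n, S (f (w (gu i))) /\ S (f (w (gx i) ^+ 2))].
Proof.
case: hA => d2 [hw freeA] _ _.
have degu i : deg (gu i) = (2 * deg (gx i)).-1.
  have [||C' [j [t H]]] := @adj_exists Qc (deg (gx i)) 0; [exact: homog0 | exact: linear0 |].
  have [|[h hh] _] := freeA C' (fun g => if g == gx i then t else 0).
    by move=> g; case: eqP => [->|_]; [apply: adj_homog H | apply: homog0].
  have ht : h (w (gx i) ^+ 2) <> 0.
    rewrite rmorphXn /= hh eqxx => /(congr1 (acoef H 2)).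
    have := @acoefE _ _ _ _ _ _ H 2 2 1; rewrite rmorph1 mul1r => ->; last by rewrite (negbTE (hx i)).
    by rewrite linear0 => /eqP; rewrite oner_eq0.
  have nz : w (gx i) ^+ 2 <> 0 by move=> E; apply: ht; rewrite E rmorph0.
  have h1 := diff_homog (hw (gu i)); rewrite hdu in h1.
  have := homog_unique h1 (homogX 2 (hw (gx i))) nz; lia.
pose dx k := if insub k is Some i then deg (@gx n i) else 2%N.
have edx k : ~~ odd (dx k) by rewrite /dx; case: insubP.
have d2x k : (2 <= dx k)%N by rewrite /dx; case: insubP.
have dxE (i : 'I_n) : dx i = deg (gx i) by rewrite /dx valK.
have [D [S [x [u [tD gD eD uD]]]]] := build_xu edx d2x n.
case: hdy => c hc.
pose z : D := \sum_(i < n) \sum_(j < n) c i j *: (x i * x j).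
pose vD (y : D) (g : gens n) : D := match g with inl (inl i) => x i | inl (inr i) => u i | inr _ => y end.
have hz : homog (deg (gy n)).+1 z.
  have [|[h hh] _] := freeA D (vD 0).
    case=> [[i|i]|[]] /=; last exact: homog0.
      by have [h _ _ _ _] := gD i (ltn_ord i); rewrite -dxE.
    by have [_ h _ _ _] := gD i (ltn_ord i); rewrite degu -dxE.
  have := gca_hom_homog h (diff_homog (hw (gy n))); rewrite hc rmorph_sum /=.
  congr (homog _ _); apply: eq_bigr => i _; rewrite rmorph_sum; apply: eq_bigr => j _ /=.
  by rewrite linearZ rmorphM /= !hh.
have dxx i j : (i < n)%N -> (j < n)%N -> diff (x i * x j) = 0.
  move=> li lj; have [_ _ h _ _] := gD i li; have [_ _ h' _ _] := gD j lj.
  by rewrite diffM h h' mul0r mulr0 addr0.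
have dz : diff z = 0.
  rewrite linear_sum big1 // => i _; rewrite linear_sum big1 // => j _.
  by rewrite linearZ /= dxx // scaler0.
have [D' [i [t H]]] := adj_exists hz dz.
have y3 : (3 <= deg (gy n))%N by have := d2 (gy n); move: hy; case: (deg _) => [|[|[]]].
have T' := towy tD hy y3 H.
pose vD' (g : gens n) : D' := match g with inl (inl k) => i (x k) | inl (inr k) => i (u k) | inr _ => t end.
have [|[f ff] _] := freeA D' vD'.
  case=> [[k|k]|[]] /=; last exact: adj_homog H.
    by apply: gca_hom_homog; have [h _ _ _ _] := gD k (ltn_ord k); rewrite -dxE.
  by apply: gca_hom_homog; have [_ h _ _ _] := gD k (ltn_ord k); rewrite degu -dxE.
pose vx k : A := if insub k is Some j then w (@gx n j) else 0.
pose vu k : A := if insub k is Some j then w (@gu n j) else 0.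
have vxE (k : 'I_n) : vx k = w (gx k) by rewrite /vx valK.
have vuE (k : 'I_n) : vu k = w (gu k) by rewrite /vu valK.
have [k kn|g0 hg0] := eD A vx vu.
  rewrite -[k]/(nat_of_ord (Ordinal kn)) vxE vuE dxE hdx hdu -degu.
  by split=> //; apply: hw.
have g0E (k : 'I_n) : g0 (x k) = w (gx k) /\ g0 (u k) = w (gu k).
  by have := hg0 k (ltn_ord k); rewrite vxE vuE.
have [|g [gi gt]] := adj_cdga_ext H (f := g0) (hw (gy n)).
  rewrite hc rmorph_sum; apply: eq_bigr => k _; rewrite rmorph_sum; apply: eq_bigr => j _ /=.
  by rewrite linearZ rmorphM /= (proj1 (g0E k)) (proj1 (g0E j)).
have fg : cancel f g.
  have [_ uniq] := freeA A w hw.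
  apply: (uniq (gca_compose g f) (cdga_id A)) => [j|//].
  rewrite /= ff; case: j => [[k|k]|[]] /=; rewrite ?gt // gi; by case: (g0E k).
have gf : cancel g f.
  apply: (adj_hom_uniq H (f := gca_compose f g) (g := cdga_id D')) => [y|]; last by rewrite /= gt ff.
  move: (uD y); apply: (subalg_ind (P := fun y => f (g (i y)) = i y)) => /=.
  - by move=> a b Ha Hb; rewrite !rmorphD /= Ha Hb.
  - by move=> r a Ha; rewrite !linearZ /= Ha.
  - by move=> a b Ha Hb; rewrite !rmorphM /= Ha Hb.
  - by rewrite !rmorph1.
  move=> b [k kn hb]; have [E1 E2] := g0E (Ordinal kn).
  by case: hb => ->; rewrite gi ?E1 ?E2 ff.
have fd a : f (diff a) = diff (f a).
  by rewrite -{1}(fg a) -cdga_hom_diff gf.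
exists D', (fun y => exists2 s, S s & y = i s), (i (\prod_(k < n) x k) * t), (CdgaHom fd), g.
split=> //=.
- rewrite rmorphM rmorph_prod /= ff /= rmorph_prod; congr (_ * _).
  by apply: eq_bigr => k _; rewrite /= ff.
- move=> a; rewrite -(fg a); set G := (fun b => _).
  have Gi c0 : subalg_gen G (g (i c0)).
    apply: (subalg_map (f := gca_compose g i)) (uD c0) => b [k kn hb] /=.
    have [E1 E2] := g0E (Ordinal kn); rewrite gi.
    by apply: subalg_in; case: hb => ->; rewrite ?E1 ?E2; eexists.
  elim/(adj_ind' H): (f a) => [x1 x2|j c0]; first by rewrite rmorphD; apply: lin_spanD.
  rewrite rmorphM rmorphXn /= gt; apply: subalgM; first exact: Gi.
  by apply: subalgX; apply: subalg_in; eexists.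
- move=> k; have [_ _ _ _ [h5 h6]] := gD k (ltn_ord k).
  rewrite rmorphXn /= !ff /=; split; first by exists (u k).
  by exists (x k ^+ 2) => //; rewrite rmorphXn.
Qed.

(** The property of towers shown in [tow_tens], in a form that is invariant under
    isomorphism. *)
Definition tensorable (A : cdga) (S : A -> Prop) := forall (C : cdga) (K : C -> Prop),
  sc C -> acyclic K -> exists (E : cdga) (i : cdga_hom C E) (j : cdga_hom A E) (K' : E -> Prop),
    [/\ tens i j, sc E, acyclic K', forall c, K c -> K' (i c) & forall s, S s -> K' (j s)].

Section Power.
Variables (A : cdga) (S : A -> Prop).
Hypothesis hA : tensorable S.

Definition ffun_ext r (f : {ffun 'I_r -> A}) (a : A) : {ffun 'I_r.+1 -> A} :=
  [ffun k => if unlift ord_max k is Some k' then f k' else a].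

Lemma ffun_ext_max r (f : {ffun 'I_r -> A}) a : ffun_ext f a ord_max = a.
Proof. by rewrite ffunE unlift_none. Qed.
Lemma ffun_ext_lift r (f : {ffun 'I_r -> A}) a k : ffun_ext f a (lift ord_max k) = f k.
Proof. by rewrite ffunE liftK. Qed.
Lemma widen_lift r (k : 'I_r) : widen_ord (leqnSn r) k = lift ord_max k.
Proof. by apply/val_inj; rewrite [RHS]lift_max. Qed.

(** Induction on r: A^(r+1) is the tensor product of A^r with A, the new factor
    being the last one. *)
Lemma power_exists r : exists (T : cdga) (inj : 'I_r -> cdga_hom A T) (mu : cdga_hom T A)
   (K : T -> Prop),
  [/\ is_tensor_power inj, forall l a, mu (inj l a) = a, sc T /\ forall y, subalg_gen (fun b => exists k a, b = inj k a) y,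
      acyclic K & forall k s, S s -> K (inj k s)].
Proof.
elim: r => [|r [T [inj [mu [K [tT muT [hT gT] hK SK]]]]]].
  have [j hj] := Qc_hom A.
  have inj : 'I_0 -> cdga_hom A Qc by case.
  exists Qc, inj, j, (fun a => a = 0); split=> //; [|by case| | |by case].
  - move=> V phi _ factors; split.
      have [|h hh] := @linear_exists Qc V (fun a => (a : rat) *: phi [ffun=> 0]).
        by move=> c a b; rewrite scalerDl scalerA.
      exists h => a; rewrite big_ord0 hh scale1r; congr phi.
      by apply/ffunP; case.
    move=> h h' hh hh' y; rewrite (Qc_scale y) !linearZ /=; congr (_ *: _).
    by have := hh [ffun=> 0]; rewrite -(hh' [ffun=> 0]) big_ord0.
  - split; first exact: Qc_sc.
    by move=> y; rewrite (Qc_scale y); apply: lin_spanZ; apply: subalg1.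
  - exact: Qc_acyclic.
have [E [i [j [K' [tE hE hK' KK SK']]]]] := hA hT hK.
pose inj' (k : 'I_r.+1) := if unlift ord_max k is Some k' then cdga_compose i (inj k') else j.
have injm : inj' ord_max = j by rewrite /inj' unlift_none.
have injl k : inj' (lift ord_max k) = cdga_compose i (inj k) by rewrite /inj' liftK.
have prodE (f : {ffun 'I_r -> A}) a :
    \prod_(k < r.+1) inj' k (ffun_ext f a k) = i (\prod_(k < r) inj k (f k)) * j a.
  rewrite big_ord_recr /= injm ffun_ext_max rmorph_prod; congr (_ * _).
  by apply: eq_bigr => k _; rewrite widen_lift injl ffun_ext_lift.
have extE (f : {ffun 'I_r.+1 -> A}) : f = ffun_ext [ffun k => f (lift ord_max k)] (f ord_max).
  apply/ffunP => k; case: (unliftP ord_max k) => [k' ->|->].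
    by rewrite ffun_ext_lift ffunE.
  by rewrite ffun_ext_max.
have [mu' [mui muj]] := tens_ext tE mu (cdga_id A).
exists E, inj', mu', K'; split=> //.
- move=> V phi mphi factors.
  have mphia a : is_multilinear (fun f : {ffun 'I_r -> A} => phi (ffun_ext f a)).
    move=> k c f f' b E1 E2; apply: (mphi (lift ord_max k)).
      move=> l; case: (unliftP ord_max l) => [l' ->|-> _]; last by rewrite !ffun_ext_max.
      by rewrite (inj_eq lift_inj) !ffun_ext_lift => /E1.
    by rewrite !ffun_ext_lift.
  have lina f c a a' : phi (ffun_ext f (c *: a + a')) = c *: phi (ffun_ext f a) + phi (ffun_ext f a').
    apply: (mphi ord_max); last by rewrite !ffun_ext_max.
    by move=> l; case: (unliftP ord_max l) => [l' ->|->]; rewrite ?eqxx // !ffun_ext_lift.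
  split.
    have ha a := proj1 (tT V _ (mphia a)).
    have [h hh] := choice ha.
    have hP c a a' y : h (c *: a + a') y = c *: h a y + h a' y.
      have [|g hg] := @linear_exists T V (fun y => c *: h a y + h a' y).
        move=> s y1 y2; rewrite (linearP (h a)) (linearP (h a')) !scalerDr !scalerA. rewrite [c * s]mulrC addrACA. by [].
      rewrite -hg; apply: (proj2 (tT V _ (mphia (c *: a + a')))) => [f|f].
        exact: hh.
      by rewrite hg !hh lina.
    have [a s y y'|y s a a'|g hg] := tens_lin tE (b := fun y a => h a y).
    + by rewrite linearP.
    + by rewrite hP.
    exists g => f; rewrite (extE f) prodE hg hh.
    by [].
  move=> h h' hh hh' y; have [s ->] := tens_span tE y.
  rewrite !linear_sum; apply: eq_bigr => p _; case: p => y' a /=.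
  have gx (g : {linear E -> V}) : exists g' : {linear T -> V}, forall y, g' y = g (i y * j a).
    have [|g' hg'] := @linear_exists T V (fun y => g (i y * j a)); last by exists g'.
    by move=> c y1 y2; rewrite linearP mulrDl -scalerAl linearP.
  have [g hg] := gx h; have [g' hg'] := gx h'.
  rewrite -hg -hg'; apply: (proj2 (tT V _ (mphia a))) => f.
    by rewrite hg -prodE hh.
  by rewrite hg' -prodE hh'.
- move=> l a; case: (unliftP ord_max l) => [l' ->|->]; last by rewrite injm muj.
  by rewrite injl /= mui muT.
- split=> // y; have [s ->] := tens_span tE y.
  apply: lin_span_sum => p; apply: subalgM.
    apply: (subalg_map (f := i)) (gT p.1) => _ [k [a ->]]; apply: subalg_in.
    by exists (lift ord_max k), a; rewrite injl.
  by apply: subalg_in; exists ord_max, p.2; rewrite injm.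
- move=> k s Ss; case: (unliftP ord_max k) => [k' ->|->]; last by rewrite injm; apply: SK'.
  by rewrite injl; apply: KK; apply: SK.
Qed.

End Power.

(** * Quotients and sequential colimits of cdgas *)

(** Operations that satisfy the axioms of a cdga up to an equivalence; the
    classes then form a cdga.  Quotients by ideals and colimits are both
    obtained in this way. *)
Record precdga := PreCdga {
  pcar :> Type;
  peq : pcar -> pcar -> Prop;
  pz : pcar; po : pcar;
  popp : pcar -> pcar;
  padd : pcar -> pcar -> pcar;
  pmulp : pcar -> pcar -> pcar;
  pscl : rat -> pcar -> pcar;
  prhom : nat -> pcar -> Prop;
  prdif : pcar -> pcar;
  peq_refl : forall x, peq x x;
  peq_sym : forall x y, peq x y -> peq y x;
  peq_trans : forall x y z, peq x y -> peq y z -> peq x z;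
  popp_c : forall x x', peq x x' -> peq (popp x) (popp x');
  padd_c : forall x x' y y', peq x x' -> peq y y' -> peq (padd x y) (padd x' y');
  pmul_c : forall x x' y y', peq x x' -> peq y y' -> peq (pmulp x y) (pmulp x' y');
  pscl_c : forall r x x', peq x x' -> peq (pscl r x) (pscl r x');
  p_addA : forall x y z, peq (padd x (padd y z)) (padd (padd x y) z);
  p_addC : forall x y, peq (padd x y) (padd y x);
  p_add0 : forall x, peq (padd pz x) x;
  p_addN : forall x, peq (padd (popp x) x) pz;
  p_mulA : forall x y z, peq (pmulp x (pmulp y z)) (pmulp (pmulp x y) z);
  p_mul1l : forall x, peq (pmulp po x) x;
  p_mul1r : forall x, peq (pmulp x po) x;
  p_mulDl : forall x y z, peq (pmulp (padd x y) z) (padd (pmulp x z) (pmulp y z));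
  p_mulDr : forall x y z, peq (pmulp x (padd y z)) (padd (pmulp x y) (pmulp x z));
  p_nz : ~ peq po pz;
  p_sclA : forall a b x, peq (pscl a (pscl b x)) (pscl (a * b) x);
  p_scl1 : forall x, peq (pscl 1 x) x;
  p_sclD : forall a x y, peq (pscl a (padd x y)) (padd (pscl a x) (pscl a y));
  p_sclDl : forall a b x, peq (pscl (a + b) x) (padd (pscl a x) (pscl b x));
  p_sclMl : forall a x y, peq (pscl a (pmulp x y)) (pmulp (pscl a x) y);
  p_sclMr : forall a x y, peq (pscl a (pmulp x y)) (pmulp x (pscl a y));
  prhom0 : forall k, prhom k pz;
  prhomP : forall k r x y, prhom k x -> prhom k y -> prhom k (padd (pscl r x) y);
  prhom1 : prhom 0 po;
  prhomM : forall k l x y, prhom k x -> prhom l y -> prhom (k + l) (pmulp x y);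
  prhom_sum : forall x, exists N (f : nat -> pcar),
    (forall k, prhom k (f k)) /\ peq x (\big[padd/pz]_(k < N) f k);
  prhom_direct : forall N (f : nat -> pcar), (forall k, prhom k (f k)) ->
    peq (\big[padd/pz]_(k < N) f k) pz -> forall k, (k < N)%N -> peq (f k) pz;
  pcomm : forall k l x y, prhom k x -> prhom l y ->
    peq (pmulp x y) (pscl ((-1) ^+ (k * l)) (pmulp y x));
  prdif_c : forall x x', peq x x' -> peq (prdif x) (prdif x');
  prdifP : forall r x y, peq (prdif (padd (pscl r x) y)) (padd (pscl r (prdif x)) (prdif y));
  prdif_hom : forall k x, prhom k x -> prhom k.+1 (prdif x);
  prdif_Leibniz : forall k x y, prhom k x -> peq (prdif (pmulp x y))
    (padd (pmulp (prdif x) y) (pscl ((-1) ^+ k) (pmulp x (prdif y))));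
  prdif_dif : forall x, peq (prdif (prdif x)) pz
}.

Section Quotient.
Variable p : precdga.

(** Classes are the predicates of the form peq x; extensionality makes equality
    of classes the given equivalence. *)
Definition quo : Type := {P : p -> Prop | exists x, P = peq x}.
Definition cls (x : p) : quo := exist _ (peq x) (ex_intro _ x erefl).
Definition rep (q : quo) : p := sval (cid (svalP q)).

Lemma clsP x y : cls x = cls y <-> peq x y.
Proof.
split=> [E|E].
  have := congr1 sval E => /= Ep; have : peq y y by apply: peq_refl.
  by rewrite -[peq y y]/((peq y) y) -Ep.
apply: eq_exist => /=; apply/funext => w; apply/propext; split=> h.
  by apply: peq_trans h; apply: peq_sym.
exact: peq_trans h.
Qed.

Lemma repK q : cls (rep q) = q.
Proof.
rewrite /rep; case: cid => x /= E; case: q E => P hP /= E.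
by apply: eq_exist => /=.
Qed.

Lemma rep_cls x : peq (rep (cls x)) x.
Proof. by apply/clsP; rewrite repK. Qed.

HB.instance Definition _ := gen_eqMixin quo.
HB.instance Definition _ := gen_choiceMixin quo.

Definition qadd a b := cls (padd (rep a) (rep b)).
Definition qopp a := cls (popp (rep a)).
Definition qmul a b := cls (pmulp (rep a) (rep b)).
Definition qscl r a := cls (pscl r (rep a)).

Lemma qaddE x y : qadd (cls x) (cls y) = cls (padd x y).
Proof. by apply/clsP; apply: padd_c; apply: rep_cls. Qed.
Lemma qoppE x : qopp (cls x) = cls (popp x).
Proof. by apply/clsP; apply: popp_c; apply: rep_cls. Qed.
Lemma qmulE x y : qmul (cls x) (cls y) = cls (pmulp x y).
Proof. by apply/clsP; apply: pmul_c; apply: rep_cls. Qed.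
Lemma qsclE r x : qscl r (cls x) = cls (pscl r x).
Proof. by apply/clsP; apply: pscl_c; apply: rep_cls. Qed.

Lemma quo_ind (P : quo -> Prop) : (forall x, P (cls x)) -> forall q, P q.
Proof. by move=> h q; rewrite -(repK q). Qed.

Fact qaddA : associative qadd.
Proof.
elim/quo_ind => x; elim/quo_ind => y; elim/quo_ind => z.
by rewrite !qaddE; apply/clsP; apply: p_addA.
Qed.
Fact qaddC : commutative qadd.
Proof. by elim/quo_ind => x; elim/quo_ind => y; rewrite !qaddE; apply/clsP; apply: p_addC. Qed.
Fact qadd0 : left_id (cls (pz p)) qadd.
Proof. by elim/quo_ind => x; rewrite qaddE; apply/clsP; apply: p_add0. Qed.
Fact qaddN : left_inverse (cls (pz p)) qopp qadd.
Proof. by elim/quo_ind => x; rewrite qoppE qaddE; apply/clsP; apply: p_addN. Qed.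
HB.instance Definition _ := GRing.isZmodule.Build quo qaddA qaddC qadd0 qaddN.

Fact qmulA : associative qmul.
Proof.
elim/quo_ind => x; elim/quo_ind => y; elim/quo_ind => z.
by rewrite !qmulE; apply/clsP; apply: p_mulA.
Qed.
Fact qmul1l : left_id (cls (po p)) qmul.
Proof. by elim/quo_ind => x; rewrite qmulE; apply/clsP; apply: p_mul1l. Qed.
Fact qmul1r : right_id (cls (po p)) qmul.
Proof. by elim/quo_ind => x; rewrite qmulE; apply/clsP; apply: p_mul1r. Qed.
Fact qmulDl : left_distributive qmul +%R.
Proof.
elim/quo_ind => x; elim/quo_ind => y; elim/quo_ind => z.
rewrite -[cls x + cls y]/(qadd _ _) -[RHS]/(qadd _ _).
by rewrite !(qaddE, qmulE); apply/clsP; apply: p_mulDl.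
Qed.
Fact qmulDr : right_distributive qmul +%R.
Proof.
elim/quo_ind => x; elim/quo_ind => y; elim/quo_ind => z.
rewrite -[cls y + cls z]/(qadd _ _) -[RHS]/(qadd _ _).
by rewrite !(qaddE, qmulE); apply/clsP; apply: p_mulDr.
Qed.
Fact qnz : cls (po p) != 0 :> quo.
Proof. by apply/eqP => /clsP; apply: p_nz. Qed.
HB.instance Definition _ := GRing.Zmodule_isNzRing.Build quo qmulA qmul1l qmul1r qmulDl qmulDr qnz.

Fact qsclA a b v : qscl a (qscl b v) = qscl (a * b) v.
Proof. by elim/quo_ind: v => x; rewrite !qsclE; apply/clsP; apply: p_sclA. Qed.
Fact qscl1 : left_id 1 qscl.
Proof. by elim/quo_ind => x; rewrite qsclE; apply/clsP; apply: p_scl1. Qed.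
Fact qsclD : right_distributive qscl +%R.
Proof.
move=> a; elim/quo_ind => x; elim/quo_ind => y.
rewrite -[cls x + cls y]/(qadd _ _) -[RHS]/(qadd _ _).
by rewrite !(qaddE, qsclE); apply/clsP; apply: p_sclD.
Qed.
Fact qsclDl v : {morph qscl^~ v : a b / a + b}.
Proof.
move=> a b; elim/quo_ind: v => x; rewrite -[RHS]/(qadd _ _).
by rewrite !(qaddE, qsclE); apply/clsP; apply: p_sclDl.
Qed.
HB.instance Definition _ := GRing.Zmodule_isLmodule.Build rat quo qsclA qscl1 qsclD qsclDl.

Fact qsclMl (r : rat) (x y : quo) : r *: (x * y : quo) = (r *: x : quo) * y :> quo.
Proof.
elim/quo_ind: x => x; elim/quo_ind: y => y; have := p_sclMl r x y => /clsP.
by rewrite -qsclE -!qmulE -qsclE.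
Qed.
HB.instance Definition _ := GRing.Lmodule_isLalgebra.Build rat quo qsclMl.
Fact qsclMr (r : rat) (x y : quo) : r *: (x * y : quo) = x * (r *: y : quo) :> quo.
Proof.
elim/quo_ind: x => x; elim/quo_ind: y => y; have := p_sclMr r x y => /clsP.
by rewrite -qsclE -!qmulE -qsclE.
Qed.
HB.instance Definition _ := GRing.Lalgebra_isAlgebra.Build rat quo qsclMr.

Fact quo_sum N (f : nat -> p) :
  \sum_(k < N) cls (f k) = cls (\big[@padd p/pz p]_(k < N) f k).
Proof. by rewrite (big_morph (@cls) (id1 := 0) (op1 := +%R)) // => x y; rewrite -qaddE. Qed.

Definition quo_homog k (a : quo) := exists2 x, prhom k x & a = cls x.

Fact quo_homog0 k : quo_homog k 0. Proof. by exists (pz p) => //; apply: prhom0. Qed.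
Fact quo_homogP k (r : rat) (a b : quo) :
  quo_homog k a -> quo_homog k b -> quo_homog k (r *: a + b).
Proof.
case=> [x hx ->] [y hy ->]; exists (padd (pscl r x) y); first exact: prhomP.
by rewrite -qaddE -qsclE.
Qed.
Fact quo_homog1 : quo_homog 0 1. Proof. by exists (po p) => //; apply: prhom1. Qed.
Fact quo_homogM k l (a b : quo) : quo_homog k a -> quo_homog l b -> quo_homog (k + l) (a * b).
Proof.
by case=> [x hx ->] [y hy ->]; exists (pmulp x y); [apply: prhomM | rewrite -qmulE].
Qed.
Fact quo_homog_sum (a : quo) : exists N (f : nat -> quo),
  (forall k, quo_homog k (f k)) /\ a = \sum_(k < N) f k.
Proof.
elim/quo_ind: a => x; have [N [f [hf E]]] := prhom_sum x.
exists N, (fun k => cls (f k)); split=> [k|]; first by exists (f k).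
by rewrite quo_sum; apply/clsP.
Qed.
Fact quo_homog_direct N (f : nat -> quo) : (forall k, quo_homog k (f k)) ->
  \sum_(k < N) f k = 0 -> forall k, (k < N)%N -> f k = 0.
Proof.
move=> hf; have hg k : exists x, prhom k x /\ f k = cls x by case: (hf k) => x; exists x.
have [g {}hg] := choice hg; rewrite (eq_bigr (fun k : 'I_N => cls (g k))); last first.
  by move=> k _; case: (hg k).
rewrite quo_sum => /clsP E k kN; have [_ ->] := hg k; apply/clsP.
by apply: prhom_direct E k kN => l; case: (hg l).
Qed.
Fact quo_comm k l (a b : quo) : quo_homog k a -> quo_homog l b ->
  a * b = (-1) ^+ (k * l) * (b * a).
Proof.
case=> [x hx ->] [y hy ->]; rewrite signZ -[LHS]/(qmul _ _) -[RHS]/(qscl _ (qmul _ _)).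
by rewrite !(qmulE, qsclE); apply/clsP; apply: pcomm.
Qed.
Definition quo_gca : gca := Gca quo_homog0 quo_homogP quo_homog1 quo_homogM
  quo_homog_sum quo_homog_direct quo_comm.

Definition qdf (a : quo) : quo := cls (prdif (rep a)).
Fact qdfE x : qdf (cls x) = cls (prdif x).
Proof. by apply/clsP; apply: prdif_c; apply: rep_cls. Qed.
Fact qdf_linear (r : rat) (a b : quo_gca) : qdf (r *: a + b) = r *: (qdf a : quo) + qdf b.
Proof.
elim/quo_ind: a => x; elim/quo_ind: b => y.
rewrite -[_ + _]/(qadd (qscl r (cls x)) (cls y)) -[RHS]/(qadd (qscl r _) _).
by rewrite !(qsclE, qaddE, qdfE); apply/clsP; apply: prdifP.
Qed.
Definition quo_diff : {linear quo_gca -> quo_gca} :=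
  sval (cid (@linear_exists quo_gca quo_gca _ qdf_linear)).
Fact quo_diffE x : quo_diff (cls x) = cls (prdif x).
Proof. by rewrite /quo_diff; case: cid => d /= ->; apply: qdfE. Qed.
Fact quo_diff_homog k (a : quo_gca) : homog k a -> homog k.+1 (quo_diff a).
Proof. by case=> x hx ->; exists (prdif x); [apply: prdif_hom | rewrite quo_diffE]. Qed.
Fact quo_diff_Leibniz k (a b : quo_gca) : homog k a ->
  quo_diff (a * b) = quo_diff a * b + (-1) ^+ k * (a * quo_diff b).
Proof.
case=> x hx ->; elim/quo_ind: b => y; rewrite signZ.
rewrite -[cls x * cls y]/(qmul _ _) -[RHS]/(qadd (qmul _ _) (qscl _ (qmul _ _))).
by rewrite !(qmulE, quo_diffE, qsclE, qaddE); apply/clsP; apply: prdif_Leibniz.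
Qed.
Fact quo_diff_diff (a : quo_gca) : quo_diff (quo_diff a) = 0.
Proof. by elim/quo_ind: a => x; rewrite !quo_diffE; apply/clsP; apply: prdif_dif. Qed.
Definition quo_cdga : cdga := Cdga quo_diff_homog quo_diff_Leibniz quo_diff_diff.

End Quotient.

Lemma precdga_quotient (p : precdga) : exists (Q : cdga) (c : p -> Q),
  [/\ forall q, exists x, q = c x, forall x y, c x = c y <-> peq x y,
      (forall k q, homog k q <-> exists2 x, prhom k x & q = c x) /\
      (forall r x y, c (padd (pscl r x) y) = r *: c x + c y),
      (forall x y, c (pmulp x y) = c x * c y) /\ (forall x, diff (c x) = c (prdif x))
    & c (po p) = 1 /\ c (pz p) = 0].
Proof.
exists (quo_cdga p), (@cls p); split.
- by move=> q; exists (rep q); rewrite repK.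
- exact: clsP.
- by split=> // r x y; rewrite -qaddE -qsclE.
- by split=> [x y|x]; [rewrite -qmulE | rewrite /= quo_diffE].
- by [].
Qed.

Section CdgaQuotient.
Variables (T : cdga) (J : T -> Prop).
Hypothesis hJ : ideal J.
Hypothesis Jcomp : forall k a, J a -> J (comp k a).
Hypothesis Jd : forall a, J a -> J (diff a).
Hypothesis J1 : ~ J 1.

Let sub0 x y : x = y -> J (x - y). Proof. by move->; rewrite subrr; apply: id0. Qed.

Definition quot_pre : precdga.
Proof.
refine (@PreCdga T (fun x y => J (x - y)) 0 1 (@GRing.opp T) (@GRing.add T) (@GRing.mul T)
  (@GRing.scale _ T) (@homog T) (@diff T) _ _ _ _ _ _ _ _ _ _ _ _ _ _ _ _ _ _ _ _ _ _ _
  (@homog0 T) (@homogP T) (homog1 T) (@homogM T) _ _ _ _ _ (@diff_homog T) _ _).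
- by move=> x; apply: sub0.
- by move=> x y h; rewrite -opprB; apply: idN.
- by move=> x y z h1 h2; rewrite -(subrK y x) -addrA; apply: idD.
- by move=> x y h; rewrite opprK addrC -opprB; apply: idN.
- by move=> x x' y y' h h'; rewrite opprD addrACA; apply: idD.
- move=> x x' y y' h h'.
  have -> : x * y - x' * y' = (x - x') * y + x' * (y - y').
    by rewrite mulrBl mulrBr addrA subrK.
  by apply: idD => //; [apply: (idMr hJ) | apply: (idMl hJ)].
- by move=> r x x' h; rewrite -scalerBr; apply: idZ.
all: try by move=> *; apply: sub0;
  first [exact: addrA | exact: addrC | exact: add0r | exact: addNr | exact: mulrA | exact: mul1r
    | exact: mulr1 | exact: mulrDl | exact: mulrDr | exact: scale1r | exact: scalerA
    | exact: scalerDr | exact: scalerDl | exact: scalerAl | exact: scalerAr | exact: linearP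
    | exact: diff_diff].
- by rewrite subr0.
- move=> x; have [N [f [hf E]]] := homog_sum x.
  by exists N, f; split=> //; apply: sub0.
- move=> N f hf; rewrite subr0 => h k kN; rewrite subr0.
  by have := Jcomp k h; rewrite (@comp_uniq _ N f) ?kN.
- by move=> k l x y hx hy; apply: sub0; rewrite (gca_comm hx hy) signZ.
- by move=> x y h; rewrite -linearB; apply: Jd.
- by move=> k x y hx; apply: sub0; rewrite (diff_Leibniz _ hx) signZ.
Defined.

Lemma cdga_quotient : exists (B : cdga) (rho : cdga_hom T B), is_quotient rho J.
Proof.
have [B [c [surj ceq [ch cP] [cM cd] [c1 c0]]]] := precdga_quotient quot_pre.
have [||||rho hrho] := @gca_hom_exists T B c.
- exact: cP.
- exact: c1.
- exact: cM.
- by move=> k a ha; apply/ch; exists a.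
have rd a : rho (diff a) = diff (rho a) by rewrite !hrho cd.
exists B, (CdgaHom rd); split=> [b|a] /=.
  by have [a ->] := surj b; exists a; rewrite hrho.
by rewrite hrho -c0; split=> [/ceq|h]; [rewrite /= subr0 | apply/ceq; rewrite /= subr0].
Qed.

End CdgaQuotient.

(** Below the index m the thread may be chosen arbitrarily. *)
Lemma thread_exists m : forall (C : nat -> cdga) (f : forall k, cdga_hom (C k) (C k.+1)) (c : C m),
  exists s : forall k, C k, s m = c /\ forall k, (m <= k)%N -> s k.+1 = f k (s k).
Proof.
elim: m => [|m IH] C f c.
  by exists (nat_rect C c (fun k x => f k x)).
have [s [sm hs]] := IH (fun k => C k.+1) (fun k => f k.+1) c.
exists (fun k => match k return C k with 0 => 0 | k.+1 => s k end); split=> // -[|k] // mk.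
exact: hs.
Qed.

(** The colimit of a sequence of injections consists of the sequences that are
    eventually compatible, up to eventual equality. *)
Section Colimit.
Variables (C : nat -> cdga) (f : forall m, cdga_hom (C m) (C m.+1)).
Hypothesis finj : forall m c, f m c = 0 -> c = 0.

Definition evt (P : nat -> Prop) := exists N, forall m, (N <= m)%N -> P m.

Lemma evt_and P Q : evt P -> evt Q -> evt (fun m => P m /\ Q m).
Proof.
move=> [N hN] [M hM]; exists (maxn N M) => m.
by rewrite geq_max => /andP [/hN ? /hM ?].
Qed.
Lemma evt_imp (P Q : nat -> Prop) : (forall m, P m -> Q m) -> evt P -> evt Q.
Proof. by move=> h [N hN]; exists N => m /hN /h. Qed.
Lemma evt_all (P : nat -> Prop) : (forall m, P m) -> evt P.
Proof. by move=> h; exists 0%N. Qed.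

Definition thread := {s : forall m, C m | evt (fun m => s m.+1 = f m (s m))}.
Definition mk (s : forall m, C m) h : thread := exist _ s h.
Implicit Types s : thread.

Fact t0 : evt (fun m => (0 : C m.+1) = f m 0). Proof. by apply: evt_all => m; rewrite rmorph0. Qed.
Fact t1 : evt (fun m => (1 : C m.+1) = f m 1). Proof. by apply: evt_all => m; rewrite rmorph1. Qed.
Fact tN s : evt (fun m => - sval s m.+1 = f m (- sval s m)).
Proof. by case: s => s h /=; apply: evt_imp h => m /= ->; rewrite rmorphN. Qed.
Fact tD s s' : evt (fun m => sval s m.+1 + sval s' m.+1 = f m (sval s m + sval s' m)).
Proof.
by case: s s' => s h [s' h'] /=; apply: evt_imp (evt_and h h') => m /= [-> ->]; rewrite rmorphD.
Qed.
Fact tM s s' : evt (fun m => sval s m.+1 * sval s' m.+1 = f m (sval s m * sval s' m)).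
Proof.
by case: s s' => s h [s' h'] /=; apply: evt_imp (evt_and h h') => m /= [-> ->]; rewrite rmorphM.
Qed.
Fact tZ r s : evt (fun m => r *: sval s m.+1 = f m (r *: sval s m)).
Proof. by case: s => s h /=; apply: evt_imp h => m /= ->; rewrite linearZ. Qed.

Definition thread_eq s s' := evt (fun m => sval s m = sval s' m).

Lemma evt_forall N (P : nat -> nat -> Prop) : (forall k, evt (P k)) ->
  evt (fun m => forall k, (k < N)%N -> P k m).
Proof.
move=> h; elim: N => [|N IH]; first exact: evt_all.
apply: evt_imp (evt_and IH (h N)) => m [h1 h2] k.
by rewrite ltnS leq_eqVlt => /orP [/eqP ->|/h1].
Qed.

Fact tcomp k s : evt (fun m => comp k (sval s m.+1) = f m (comp k (sval s m))).
Proof. by case: s => s h /=; apply: evt_imp h => m /= ->; rewrite gca_hom_comp. Qed.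
Fact tdiff s : evt (fun m => diff (sval s m.+1) = f m (diff (sval s m))).
Proof. by case: s => s h /=; apply: evt_imp h => m /= ->; rewrite cdga_hom_diff. Qed.

Let tadd s s' := mk (tD s s').
Fact sval_sum m N (g : nat -> thread) :
  sval (\big[tadd/mk t0]_(k < N) g k) m = \sum_(k < N) sval (g k) m.
Proof. exact: (big_morph (fun s => sval s m)). Qed.

Definition col_pre : precdga.
Proof.
refine (@PreCdga thread thread_eq (mk t0) (mk t1) (fun s => mk (tN s))
  tadd (fun s s' => mk (tM s s')) (fun r s => mk (tZ r s))
  (fun k s => evt (fun m => homog k (sval s m))) (fun s => mk (tdiff s))
  _ _ _ _ _ _ _ _ _ _ _ _ _ _ _ _ _ _ _ _ _ _ _ _ _ _ _ _ _ _ _ _ _ _ _).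
- by move=> x; apply: evt_all.
- by move=> x y; apply: evt_imp.
- by move=> x y z h h'; apply: evt_imp (evt_and h h') => m [-> ->].
- by move=> x x'; apply: evt_imp => m /= ->.
- by move=> x x' y y' h h'; apply: evt_imp (evt_and h h') => m /= [-> ->].
- by move=> x x' y y' h h'; apply: evt_imp (evt_and h h') => m /= [-> ->].
- by move=> r x x'; apply: evt_imp => m /= ->.
all: try by move=> *; apply: evt_all => m /=;
  first [exact: addrA | exact: addrC | exact: add0r | exact: addNr | exact: mulrA | exact: mul1r
    | exact: mulr1 | exact: mulrDl | exact: mulrDr | exact: scale1r | exact: scalerA
    | exact: scalerDr | exact: scalerDl | exact: scalerAl | exact: scalerAr | exact: linearP
    | exact: diff_diff | exact: homog0 | exact: homog1].
- by move=> [N /(_ N (leqnn N)) /= /eqP]; rewrite oner_eq0.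
- by move=> k r x y h h'; apply: evt_imp (evt_and h h') => m [] /=; apply: homogP.
- by move=> k l x y h h'; apply: evt_imp (evt_and h h') => m [] /=; apply: homogM.
- (* from stage N on, the components of s are the images of those of s N *)
  move=> s; have [N hN] := svalP s; exists (hsize (sval s N)), (fun k => mk (tcomp k s)).
  split=> [k|]; first by apply: evt_all => m; apply: comp_homog.
  exists N => m /subnK <-; rewrite (sval_sum _ _ (fun k => mk (tcomp k s))) /=.
  elim: (m - N)%N => [|d IH]; first exact: comp_sum.
  rewrite addSn hN ?leq_addl // {1}IH rmorph_sum.
  by apply: eq_bigr => k _; rewrite /= gca_hom_comp.
- move=> N g hg h k kN; apply: evt_imp (evt_and h (evt_forall N hg)) => m [] /=.
  rewrite (sval_sum _ _ g) => E hm; pose g' j := if (j < N)%N then sval (g j) m else 0.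
  have -> : sval (g k) m = g' k by rewrite /g' kN.
  apply: (homog_direct (N := N) (f := g')) => // [j|].
    by rewrite /g'; case: ifP => // [/hm|_] //; apply: homog0.
  by rewrite -[RHS]E; apply: eq_bigr => j _; rewrite /g' ltn_ord.
- by move=> k l x y h h'; apply: evt_imp (evt_and h h') => m [h1 h2] /=; rewrite (gca_comm h1 h2) signZ.
- by move=> x y; apply: evt_imp => m /= ->.
- by move=> k x; apply: evt_imp => m /=; apply: diff_homog.
- by move=> k x y; apply: evt_imp => m /= hm; rewrite (diff_Leibniz _ hm) signZ.
Defined.

Lemma colimit_exists : exists (L : cdga) (io : forall m, cdga_hom (C m) L),
  [/\ forall m c, io m.+1 (f m c) = io m c,
      forall y, exists m c, y = io m c,
      forall k y, homog k y -> exists m, exists2 c, homog k c & y = io m c,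
      forall m c, io m c = 0 -> c = 0
    & forall (B : gca) (g : forall m, gca_hom (C m) B),
        (forall m c, g m.+1 (f m c) = g m c) ->
        exists h : gca_hom L B, forall m c, h (io m c) = g m c].
Proof.
have [L [c [surj ceq [ch cP] [cM cd] [c1 c0]]]] := precdga_quotient col_pre.
have thr m (a : C m) : exists s : thread, sval s m = a /\
    forall k, (m <= k)%N -> sval s k.+1 = f k (sval s k).
  have [s [sm hs]] := thread_exists f a.
  have h : evt (fun k => s k.+1 = f k (s k)) by exists m.
  by exists (mk h).
pose th m (a : C m) : thread := sval (cid (thr m a)).
have thm m (a : C m) : sval (th m a) m = a by rewrite /th; case: cid => s [].
have thS m (a : C m) k : (m <= k)%N -> sval (th m a) k.+1 = f k (sval (th m a) k).
  by rewrite /th; case: cid => s /= [_ h] /h.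
have agree m (s s' : thread) : sval s m = sval s' m ->
    (forall k, (m <= k)%N -> sval s k.+1 = f k (sval s k)) ->
    (forall k, (m <= k)%N -> sval s' k.+1 = f k (sval s' k)) -> c s = c s'.
  move=> E h h'; apply/ceq; exists m => k /subnK <-.
  elim: (k - m)%N => [//|d IH]; rewrite addSn h ?h' ?leq_addl // IH //.
have ex m : exists h : cdga_hom (C m) L, forall a, h a = c (th m a).
  have [||||h hh] := @gca_hom_exists (C m) L (fun a => c (th m a)).
  - move=> r a b; rewrite -cP; apply: (agree m) => [|k|k mk]; first by rewrite /= !thm.
      exact: thS.
    by rewrite /= !thS // linearP.
  - rewrite -c1; apply: (agree m) => [|k|k mk]; first by rewrite /= !thm.
      exact: thS.
    by rewrite /= rmorph1.
  - move=> a b; rewrite -cM; apply: (agree m) => [|k|k mk]; first by rewrite /= !thm.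
      exact: thS.
    by rewrite /= !thS // rmorphM.
  - move=> k a ha; apply/ch; exists (th m a) => //; exists m => l /subnK <-.
    elim: (l - m)%N => [|d IH]; first by rewrite thm.
    by rewrite addSn thS ?leq_addl //; apply: gca_hom_homog.
  have hd a : h (diff a) = diff (h a).
    rewrite !hh cd; apply: (agree m) => [|k|k mk]; first by rewrite /= !thm.
      exact: thS.
    by rewrite /= !thS // cdga_hom_diff.
  by exists (CdgaHom hd).
pose io m := sval (cid (ex m)).
have ioE m a : io m a = c (th m a) by rewrite /io; case: cid.
have ioc s : exists N, forall m, (N <= m)%N -> c s = io m (sval s m).
  have [N hN] := svalP s; exists N => m Nm; rewrite ioE; apply: (agree m); rewrite ?thm //.
    by move=> k mk; apply: hN; apply: leq_trans mk.
  exact: thS.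
exists L, io; split.
- move=> m a; rewrite !ioE; apply: (agree m.+1); first by rewrite thm thS // thm.
    by move=> k; apply: thS.
  by move=> k mk; apply: thS; apply: ltnW.
- by move=> y; have [s ->] := surj y; have [N hN] := ioc s; exists N, (sval s N); apply: hN.
- move=> k y /ch [s [M hM] ->]; have [N hN] := ioc s.
  exists (maxn M N), (sval s (maxn M N)); first by apply: hM; apply: leq_maxl.
  by apply: hN; apply: leq_maxr.
- move=> m a; rewrite ioE -c0 => /ceq [N hN]; have := hN (maxn N m) (leq_maxl _ _) => /=.
  have := leq_maxr N m => /subnK <-.
  elim: (_ - _)%N => [|d IH]; first by rewrite add0n thm.
  by rewrite addSn thS ?leq_addl // => /finj.
- move=> B g hg.
  have [r hr] := choice surj.
  (* the sequence g m (s m) is eventually constant *)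
  have val s : exists b, evt (fun m => g m (sval s m) = b).
    have [N hN] := svalP s; exists (g N (sval s N)), N => m /subnK <-.
    elim: (m - N)%N => [//|d IH]; by rewrite addSn hN ?leq_addl // hg.
  have [v hv] := choice val.
  have vE s s' : c s = c s' -> evt (fun m => g m (sval s' m) = v s).
    by move/ceq => E; apply: evt_imp (evt_and (hv s) E) => m [<- ->].
  have pick (P : Prop) : evt (fun=> P) -> P by case=> N; apply.
  have [||||h hh] := @gca_hom_exists L B (fun y => v (r y)).
  + move=> s a b; apply: pick; have E : c (r (s *: a + b)) = c (padd (pscl s (r a)) (r b)).
      by rewrite cP -!hr.
    apply: evt_imp (evt_and (vE _ _ E) (evt_and (hv (r a)) (hv (r b)))) => m [<- [<- <-]].
    by rewrite /= linearP.
  + apply: pick; have E : c (r 1) = c (po col_pre) by rewrite c1 -hr.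
    by apply: evt_imp (vE _ _ E) => m <- /=; rewrite rmorph1.
  + move=> a b; apply: pick; have E : c (r (a * b)) = c (pmulp (r a) (r b)) by rewrite cM -!hr.
    apply: evt_imp (evt_and (vE _ _ E) (evt_and (hv (r a)) (hv (r b)))) => m [<- [<- <-]].
    by rewrite /= rmorphM.
  + move=> k y /ch [s hs E]; apply: pick; have E' : c (r y) = c s by rewrite -hr.
    by apply: evt_imp (evt_and (vE _ _ E') hs) => m [<-]; apply: gca_hom_homog.
  exists h => m a; rewrite hh; apply: pick.
  have E : c (r (io m a)) = c (th m a) by rewrite -hr ioE.
  have [N hN] := vE _ _ E; exists 0%N => _ _; rewrite -(hN (maxn N m) (leq_maxl _ _)).
  have := leq_maxr N m => /subnK <-; elim: (_ - _)%N => [|d IH]; first by rewrite add0n thm.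
  by rewrite addSn thS ?leq_addl // hg.
Qed.

End Colimit.

(** * Homotopy retractions of quotients by ideals inside an acyclic ideal *)

Lemma span_coefs (V : lmodType rat) (s : seq V) a :
  lin_span (fun b => b \in s) a -> exists l : 'I_(size s) -> rat, a = \sum_i l i *: s`_i.
Proof.
move: a; apply: lin_span_ind.
  by exists (fun _ => 0); rewrite big1 // => i _; rewrite scale0r.
move=> c a b sa [l ->]; have ha : (index a s < size s)%N by rewrite index_mem.
exists (fun i => (if i == Ordinal ha then c else 0) + l i).
rewrite [RHS](eq_bigr (fun i => (if i == Ordinal ha then c else 0) *: s`_i + l i *: s`_i)); last first.
  by move=> i _; rewrite scalerDl.
rewrite big_split /=; congr (_ + _).
rewrite (bigD1 (Ordinal ha)) //= eqxx nth_index // big1 ?addr0 // => i /negbTE ->.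
by rewrite scale0r.
Qed.

(** A linear relation exists by counting dimensions; its last vector can be solved
    for. *)
Lemma dependent (V : lmodType rat) (s : seq V) (v : nat -> V) :
  (forall j, lin_span (fun b => b \in s) (v j)) ->
  exists j (l : nat -> rat), v j = \sum_(k < j) l k *: v k.
Proof.
move=> hv; set N := size s.
have [c hc] := choice (fun j => span_coefs (hv j)).
pose M : 'M[rat]_(N.+1, N) := \matrix_(j, k) c j k.
have [u uM [k0 uk0]] : exists2 u : 'rV[rat]_N.+1, u *m M = 0 & exists k, u 0 k != 0.
  have : kermx M != 0.
    rewrite -mxrank_eq0 mxrank_ker -lt0n subn_gt0.
    by apply: leq_ltn_trans (rank_leq_col M) _.
  move=> /rowV0Pn [u /sub_kermxP uM u0]; exists u => //.
  exact/rV0Pn.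
have ssum : \sum_(j < N.+1) u 0 j *: v j = 0.
  rewrite (eq_bigr (fun j : 'I_N.+1 => \sum_(k < N) (u 0 j * c j k) *: s`_k)); last first.
    by move=> j _; rewrite {1}(hc j) scaler_sumr; apply: eq_bigr => k _; rewrite scalerA.
  rewrite exchange_big /= big1 // => k _; rewrite -scaler_suml.
  have := congr1 (fun m : 'rV_N => m 0 k) uM; rewrite !mxE => E.
  rewrite (eq_bigr (fun j => u 0 j * M j k)); first by rewrite E scale0r.
  by move=> j _; rewrite mxE.
pose j := [arg max_(k > k0 | u 0 k != 0) (k : nat)].
have [uj jmax] : u 0 j != 0 /\ forall k, u 0 k != 0 -> (k <= j)%N.
  by rewrite /j; case: arg_maxnP.
pose U k : rat := if insub k is Some k' then u 0 k' else 0.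
have UE (k : 'I_N.+1) : U k = u 0 k by rewrite /U valK.
exists j, (fun k => - (u 0 j)^-1 * U k).
move: ssum.
rewrite (eq_bigr (fun k : 'I_N.+1 => if (k < j.+1)%N then U k *: v k else 0)); last first.
  move=> k _; rewrite UE ltnS; case: leqP => // jk.
  have [->|/jmax] := eqVneq (u 0 k) 0; first by rewrite scale0r.
  by rewrite leqNgt jk.
rewrite (sum_truncate (fun k => U k *: v k) (ltn_ord j)) big_ord_recr /= UE => /eqP.
rewrite addrC addr_eq0 => /eqP Ej.
have -> : v j = (u 0 j)^-1 *: (u 0 j *: v j) by rewrite scalerA mulVf // scale1r.
rewrite Ej -scaleN1r scalerA scaler_sumr; apply: eq_bigr => k _.
by rewrite scalerA mulrN1.
Qed.

Lemma bounded_stable (e : nat -> nat) m k :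
  (forall l, (m <= l)%N -> (e l <= e l.+1)%N) -> (forall l, (m <= l)%N -> (e l <= k)%N) ->
  exists2 m0, (m <= m0)%N & forall l, (m0 <= l)%N -> e l = e m0.
Proof.
move=> hS hk.
have [d] := ubnP (k - e m)%N; elim: d m hS hk => // d IH m hS hk hd.
have mono l : (m <= l)%N -> (e m <= e l)%N.
  move/subnK => <-; elim: (l - m)%N => [|n IHn]; first by rewrite add0n.
  by apply: leq_trans IHn _; rewrite addSn; apply: hS; rewrite leq_addl.
have [[l [ml El]]|no] := EM (exists l, (m <= l)%N /\ e l != e m).
  have elt : (e m < e l)%N by rewrite ltn_neqAle eq_sym El mono.
  have hl := hk l ml.
  have hd' : (k - e l < d)%N by lia.
  have [m0 lm0 H] := IH l (fun x lx => hS x (leq_trans ml lx))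
    (fun x lx => hk x (leq_trans ml lx)) hd'.
  by exists m0 => //; apply: leq_trans lm0.
exists m => // l ml; apply/eqP/negPn/negP => El; apply: no.
by exists l.
Qed.

Section Model.
Variables (A B0 : cdga) (rho : cdga_hom A B0) (I K : A -> Prop).
Hypotheses (hrho : is_quotient rho I) (hA : sc A) (hK : acyclic K).
Hypothesis IK : forall a, I a -> K a.
Let iK := ac_ideal hK.

(** z obstructs that ker q has vanishing cohomology in degree e. *)
Definition defect (C : cdga) (q : cdga_hom C B0) e (z : C) : Prop :=
  [/\ homog e z, diff z = 0, q z = 0 & ~ exists w, q w = 0 /\ diff w = z].

(** A partial relative model of rho, with its maps to A/I and to A.  The condition
    that [st] sends the kernel of [sq] into K is the invariant that allows
    [st] to be extended to a new generator. *)
Record stage := Stage {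
  sC : cdga; si : cdga_hom A sC; sq : cdga_hom sC B0; st : cdga_hom sC A;
  s_sc : sc sC;
  s_q : forall a, sq (si a) = rho a;
  s_t : forall a, st (si a) = a;
  s_K : forall c, sq c = 0 -> K (st c);
  s_low : forall e z, (e <= 2)%N -> ~ defect sq e z
}.

Definition stage0 : stage.
Proof.
refine (@Stage A (cdga_id A) rho (cdga_id A) hA _ _ _ _) => //=.
- by move=> c /(proj2 hrho) /IK.
- move=> e z e2 [hz _ /(proj2 hrho) /IK Kz]; case.
  by exists 0; rewrite !rmorph0 linear0 (ac_low hK Kz hz).
Defined.

(** The step from S to S' removes an obstruction of lowest degree e + 1 and leaves
    none in degrees up to e; when there is no obstruction it changes
    nothing. *)
Definition active (S S' : stage) (f : cdga_hom (sC S) (sC S')) e t z :=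
  [/\ is_adj f e t z, (2 <= e)%N, defect (sq S) e.+1 z /\ sq S' t = 0,
      forall e' z', (e' <= e)%N -> ~ defect (sq S) e' z'
    & forall e' z', (e' <= e)%N -> ~ defect (sq S') e' z'].

Definition inactive (S S' : stage) (f : cdga_hom (sC S) (sC S')) :=
  (exists r : gca_hom (sC S') (sC S), cancel f r /\ cancel r f) /\
  (forall e z, ~ defect (sq S) e z).

Definition step (S S' : stage) (f : cdga_hom (sC S) (sC S')) (b : bool) e t z :=
  [/\ forall a, f (si S a) = si S' a, forall c, sq S' (f c) = sq S c,
      forall c, st S' (f c) = st S c, forall c, f c = 0 -> c = 0
    & if b then active f e t z else inactive f].

(** The new generator t kills z and maps to 0 in A/I and to a primitive a of the
    image of z in A, chosen inside K so that the invariant persists.  No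
    obstruction appears in degree e: an element c + r t with r nonzero that is
    closed would make z exact in the kernel. *)
Lemma step_exists S : exists S' f b e t z, @step S S' f b e t z.
Proof.
have [[e0 [z0 hd0]]|no] := EM (exists e z, defect (sq S) e z); last first.
  exists S, (cdga_id _), false, 0%N, 0, 0; split=> //; split.
    by exists (cdga_id (sC S)).
  by move=> e z hd; apply: no; exists e, z.
have ex : exists e, `[< exists z, defect (sq S) e z >] by exists e0; apply/asboolP; exists z0.
case: (ex_minnP ex) => m /asboolP [z hz] hmin.
have mmin e' z' : (e' < m)%N -> ~ defect (sq S) e' z'.
  by move=> lt hd; have := hmin e' (asboolT (ex_intro _ z' hd)); rewrite leqNgt lt.
have m3 : (3 <= m)%N by rewrite ltnNge; apply/negP => m2; apply: (s_low m2 hz).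
case: m m3 hz mmin {hmin} => // e e2 hz mmin.
have [hz1 dz qz nz] := hz.
have Kz : K (st S z) by apply: s_K.
have [a [Ka ha da]] := ac_exact hK Kz (gca_hom_homog (st S) hz1) (etrans (esym (cdga_hom_diff _ _)) (etrans (congr1 (st S) dz) (rmorph0 _))).
have [C' [f [t H]]] := adj_exists hz1 dz.
have [|q' [qi qt]] := adj_cdga_ext H (f := sq S) (homog0 B0 e); first by rewrite linear0 qz.
have [|t' [ti tt]] := adj_cdga_ext H (f := st S) ha; first by rewrite da.
have qy y : q' y = sq S (acoef H 0 y).
  elim/(adj_ind' H): y => [x y Hx Hy|j c]; first by rewrite rmorphD linearD rmorphD /= Hx Hy.
  rewrite rmorphM rmorphXn /= qi qt; have [ok|[oe j2]] := odd_cases e j.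
    by rewrite acoefE //; case: j {ok} => [|j]; rewrite expr0n /= ?mulr1 // mulr0 rmorph0.
  rewrite (odd_expr0 oe (adj_homog H) j2) mulr0 linear0 rmorph0.
  by case: j j2 => // j _; rewrite expr0n mulr0.
have K' y : q' y = 0 -> K (t' y).
  rewrite qy => /s_K Kc; have [N [_ ->]] := acoef_fin H y; rewrite rmorph_sum.
  apply: (idsum iK) => j; rewrite rmorphM rmorphXn /= ti tt.
  case: (j : nat) => [|l]; first by rewrite expr0 mulr1.
  by rewrite exprS; apply: (idMl iK); apply: (idMr iK).
have nod e' z' : (e' <= e)%N -> ~ defect q' e' z'.
  move=> le_e [hz' dz' qz' nz'].
  have red c : homog e' c -> f c = z' -> False.
    move=> hc E; apply: (mmin e' c); first by rewrite ltnS.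
    split=> //.
    - by apply: (adj_inj H); rewrite cdga_hom_diff E dz' rmorph0.
    - by rewrite -qi E.
    - by case=> w [qw dw]; apply: nz'; exists (f w); rewrite qi qw -cdga_hom_diff dw.
  move: le_e; rewrite leq_eqVlt => /orP [/eqP E|lt]; last first.
    by have [c hc E] := adj_low H hz' lt; apply: (red c).
  rewrite E in hz'; have [c hc [r Er]] := adj_at H (s_sc S) e2 hz'.
  have dc : diff c + r *: z = 0.
    apply: (adj_inj H); rewrite [f (_ + _)]rmorphD /= [f (r *: z)]linearZ /= cdga_hom_diff -(adj_diff H).
    by rewrite rmorph0 -dz' Er linearD /= [diff (r *: t)]linearZ.
  have qc : sq S c = 0.
    by move: qz'; rewrite Er rmorphD /= [q' (r *: t)]linearZ /= qi qt scaler0 addr0.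
  have [r0|r0] := eqVneq r 0.
    by apply: (red c); [rewrite E | rewrite Er r0 scale0r addr0].
  apply: nz; exists (- r^-1 *: c); rewrite linearZ /= qc scaler0; split=> //.
  move/eqP: dc; rewrite addr_eq0 => /eqP dc.
  by rewrite linearZ /= dc scaleNr scalerN opprK scalerA mulVf // scale1r.
have h1 x : q' (cdga_compose f (si S) x) = rho x by rewrite /= qi s_q.
have h2 x : t' (cdga_compose f (si S) x) = x by rewrite /= ti s_t.
have h3 e' z' : (e' <= 2)%N -> ~ defect q' e' z'.
  by move=> le2; apply: nod; apply: leq_trans le2 e2.
exists (Stage (adj_sc H (s_sc S) e2) h1 h2 K' h3), f, true, e, t, z; split=> //.
  by move=> x fx; apply: (adj_inj H); rewrite fx rmorph0.
Qed.

Definition nxt S := sval (cid (step_exists S)).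
Definition nxtf S : cdga_hom (sC S) (sC (nxt S)) := sval (cid (svalP (cid (step_exists S)))).

Lemma nxtP S : exists b e t z, step (nxtf S) b e t z.
Proof. exact: (svalP (cid (svalP (cid (step_exists S))))). Qed.

Fixpoint stg n := if n is m.+1 then nxt (stg m) else stage0.
Let C n := sC (stg n).
Let f n : cdga_hom (C n) (C n.+1) := nxtf (stg n).

Lemma stgP : exists (b : nat -> bool) (e : nat -> nat) (t : forall n, C n.+1) (z : forall n, C n),
  forall n, step (f n) (b n) (e n) (t n) (z n).
Proof.
pose sb n := cid (nxtP (stg n)).
pose se n := cid (svalP (sb n)).
pose st n := cid (svalP (se n)).
pose sz n := cid (svalP (st n)).
exists (fun n => sval (sb n)), (fun n => sval (se n)), (fun n => sval (st n)), (fun n => sval (sz n)) => n.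
exact: svalP (sz n).
Qed.

(** The colimit of the stages is a relative Sullivan algebra with retraction;
    it maps to A/I by a quasi-isomorphism if no obstruction survives.  One
    that survives in degree k makes every step active with degrees at most k,
    hence eventually of constant degree E.  From then on the cocycles killed
    all come from the degree E + 1 part of one stage, which is finite
    dimensional; one of them is a combination of its predecessors, hence was
    already exact in the kernel. *)
Lemma model_retract : homotopy_retraction rho.
Proof.
have [b [e [t [z hS]]]] := stgP.
have finj m c : f m c = 0 -> c = 0 by case: (hS m) => _ _ _ h _; apply: h.
have [L [io [ioS iosurj iohom ioinj ext]]] := colimit_exists finj.
have ioinj2 m c c' : io m c = io m c' -> c = c'.
  move=> E; apply/eqP; rewrite -subr_eq0; apply/eqP; apply: (ioinj m).
  by rewrite rmorphB /= E subrr.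
have cext (B : cdga) (g : forall m, cdga_hom (C m) B) :
    (forall m c, g m.+1 (f m c) = g m c) ->
    exists h : cdga_hom L B, forall m c, h (io m c) = g m c.
  move=> hg; have [h hh] := ext B g hg.
  have hd y : h (diff y) = diff (h y).
    have [m [c ->]] := iosurj y; by rewrite -cdga_hom_diff !hh cdga_hom_diff.
  by exists (CdgaHom hd).
have [q hq] := cext B0 (fun m => sq (stg m)) (fun m c => let: And5 _ h _ _ _ := hS m in h c).
have [tau htau] := cext A (fun m => st (stg m)) (fun m c => let: And5 _ _ h _ _ := hS m in h c).
pose i : cdga_hom A L := io 0%N.
have iE m a : io m (si (stg m) a) = i a.
  elim: m => [//|m <-]; case: (hS m) => h _ _ _ _.
  by rewrite -[in LHS]h ioS.
have act m : b m -> active (f m) (e m) (t m) (z m).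
  by move=> bm; case: (hS m) => _ _ _ _; rewrite bm.
have inact m : ~~ b m -> inactive (f m).
  by move=> bm; case: (hS m) => _ _ _ _; rewrite (negbTE bm).
pose J := {m : nat | b m}.
pose deg (j : J) := e (val j).
pose gen (j : J) : L := io _ (t (val j)).
exists L, i, q, tau; split.
- exists J, deg, gen, (fun j => val j); split.
  + by case=> m bm; rewrite /deg /=; have [_ e2 _ _ _] := act m bm; apply: leq_trans e2.
  + split.
      case=> m bm; rewrite /gen /deg /=; have [H _ _ _ _] := act m bm.
      by apply: gca_hom_homog; apply: adj_homog H.
    move=> B g v hv extends; split.
      pose vv m : B := if insub m is Some j then v j else 0.
      have vvE (j : J) : vv (val j) = v j by rewrite /vv valK.
      have nx m (h : gca_hom (C m) B) : exists h' : gca_hom (C m.+1) B,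
          (forall c, h' (f m c) = h c) /\ (b m -> h' (t m) = vv m).
        have [bm|bm] := boolP (b m).
          have [H _ _ _ _] := act m bm.
          have hvm : homog (e m) (vv m) by have := hv (exist _ m bm); rewrite -vvE.
          by have [h' [h1 h2]] := adj_ext H h hvm; exists h'.
        have [[r [fr rf]] _] := inact m bm; exists (gca_compose h r); split=> // c.
        by rewrite /= fr.
      pose hm := fix hm m : gca_hom (C m) B := match m with
        | 0 => g | m.+1 => sval (cid (nx m (hm m))) end.
      have hmS m : (forall c, hm m.+1 (f m c) = hm m c) /\ (b m -> hm m.+1 (t m) = vv m).
        exact: (svalP (cid (nx m (hm m)))).
      have [h hh] := ext B hm (fun m => proj1 (hmS m)).
      exists h; split=> [a|j]; first exact: (hh 0%N a).
      by rewrite /gen hh (proj2 (hmS _)) ?vvE //; case: j.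
    move=> h h' [hi hg] [h'i h'g] y; have [m [c ->]] := iosurj y.
    elim: m c => [|m IH] c; first by have := hi c; rewrite -h'i.
    have [bm|bm] := boolP (b m).
      have [H _ _ _ _] := act m bm.
      apply: (adj_hom_uniq H (f := gca_compose h (io m.+1)) (g := gca_compose h' (io m.+1))).
        by move=> c'; rewrite /= !ioS.
      by have := hg (exist _ m bm); rewrite -(h'g (exist _ m bm)).
    by have [[r [fr rf]] _] := inact m bm; rewrite -(rf c) !ioS.
  + have gen_by m (c : C m) : subalg_gen (fun x => (exists a, x = i a) \/
          (exists2 j', (val j' < m)%N & x = gen j')) (io m c).
      elim: m c => [|m IH] c; first by apply: subalg_in; left; exists c.
      have up : forall x : L, ((exists a, x = i a) \/ (exists2 j', (val j' < m)%N & x = gen j')) ->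
          ((exists a, x = i a) \/ (exists2 j', (val j' < m.+1)%N & x = gen j')).
        by move=> x [?|[j' lt ->]]; [left | right; exists j' => //; apply: ltnW].
      have [bm|bm] := boolP (b m); last first.
        have [[r [fr rf]] _] := inact m bm; rewrite -(rf c) ioS.
        exact: subalg_sub up (IH _).
      have [H _ _ _ _] := act m bm.
      elim/(adj_ind' H): c => [x y Hx Hy|k c]; first by rewrite rmorphD; apply: lin_spanD.
      rewrite rmorphM rmorphXn /= ioS; apply: subalgM.
        exact: subalg_sub up (IH _).
      apply: subalgX; apply: subalg_in; right; exists (exist _ m bm) => //=.
    case=> m bm; rewrite /gen /=; have [H _ _ _ _] := act m bm.
    by rewrite -cdga_hom_diff (adj_diff H) ioS; apply: gen_by.
- have up m M (x : C m) : (m <= M)%N -> exists x' : C M, io M x' = io m x.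
    move/subnK => <-; elim: (M - m)%N => [|d [x' E]]; first by exists x.
    by exists (f _ x'); rewrite ioS.
  have key k (y : L) : homog k y -> diff y = 0 -> q y = 0 -> exists w, q w = 0 /\ diff w = y.
    move=> hy dy qy; apply: contrapT => nex.
    have [m [c hc Ec]] := iohom k y hy.
    have ndef m' : (m <= m')%N -> exists c', defect (sq (stg m')) k c'.
      move=> mm; have [c' [E hc']] : exists c' : C m', io m' c' = y /\ homog k c'.
        move: mm => /subnK <-; elim: (m' - m)%N => [|d [x [E hx]]]; first by exists c.
        by exists (f _ x); rewrite ioS; split=> //; apply: gca_hom_homog.
      exists c'; split=> //.
      - by apply: (ioinj m'); rewrite cdga_hom_diff E.
      - by rewrite -hq E.
      - by case=> w [qw dw]; apply: nex; exists (io m' w); rewrite hq qw -cdga_hom_diff dw.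
    have bm m' : (m <= m')%N -> b m'.
      move=> mm; apply: contraT => nb; have [_ no] := inact m' nb.
      by have [c' hc'] := ndef m' mm; case: (no k c').
    have ek m' : (m <= m')%N -> (e m' <= k)%N.
      move=> mm; have [_ _ _ no _] := act m' (bm m' mm); have [c' hc'] := ndef m' mm.
      by rewrite leqNgt; apply/negP => lt; apply: (no k c') => //; apply: ltnW.
    have eS m' : (m <= m')%N -> (e m' <= e m'.+1)%N.
      move=> mm; have [_ _ _ _ no] := act m' (bm m' mm).
      have [_ _ [hd _] _ _] := act m'.+1 (bm m'.+1 (leqW mm)).
      by rewrite leqNgt; apply/negP => lt; apply: (no _ _ _ hd).
    have [m0 mm0 est] := bounded_stable eS ek.
    set E := e m0 in est.
    have [s hs] := sc_fin (s_sc (stg m0)) E.+1.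
    have down d (x : C (d + m0)%N) : homog E.+1 x ->
        exists2 x0 : C m0, homog E.+1 x0 & io _ x = io _ x0.
      elim: d x => [|d IH] x hx; first by exists x.
      have ld : (m0 <= d + m0)%N by apply: leq_addl.
      have [H e2 _ _ _] := act (d + m0)%N (bm _ (leq_trans mm0 ld)).
      rewrite -(est _ ld) in hx.
      have [x' hx' Ex] := adj_above H (s_sc (stg (d + m0)%N)) e2 hx.
      rewrite (est _ ld) in hx'; have [x0 hx0 E0] := IH x' hx'.
      by exists x0 => //; rewrite Ex -E0; apply: ioS.
    pose v j := io _ (z (j + m0)%N).
    have vs j : lin_span (fun y => y \in [seq io m0 x | x <- s]) (v j).
      have ld : (m0 <= j + m0)%N by apply: leq_addl.
      have [_ _ [[hz _ _ _] _] _ _] := act (j + m0)%N (bm _ (leq_trans mm0 ld)).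
      rewrite est // in hz; have [x0 hx0 Ex] := down j _ hz.
      rewrite /v Ex; have := hs _ hx0; apply: lin_span_map => a sa.
      by apply: lin_span_gen; apply/mapP; exists a.
    have [j [l Ej]] := dependent vs.
    have ld x : (m <= x + m0)%N by apply: leq_trans mm0 (leq_addl _ _).
    have [_ _ [[_ _ _ nz] _] _ _] := act (j + m0)%N (bm _ (ld j)).
    apply: nz.
    have lt_t (x : 'I_j) : exists y' : C (j + m0)%N, io _ y' = io _ (t (x + m0)%N).
      by apply: up; rewrite ltn_add2r.
    have [T hT] := choice lt_t.
    exists (\sum_(x < j) l x *: T x); split.
      rewrite rmorph_sum /= big1 // => x _; rewrite linearZ /= -hq hT hq.
      by have [_ _ [_ ->] _ _] := act (x + m0)%N (bm _ (ld x)); rewrite scaler0.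
    apply: (ioinj2 (j + m0)%N); rewrite -/(v j) Ej linear_sum rmorph_sum; apply: eq_bigr => x _.
    rewrite /= [diff _]linearZ [LHS]linearZ /= cdga_hom_diff hT -cdga_hom_diff.
    by have [H _ _ _ _] := act (x + m0)%N (bm _ (ld x)); rewrite (adj_diff H) ioS.
  have key' (y : L) : diff y = 0 -> q y = 0 -> exists w, q w = 0 /\ diff w = y.
    move=> dy qy.
    have ck k : exists w, q w = 0 /\ diff w = comp k y.
      apply: (key k); first exact: comp_homog.
        by rewrite diff_comp dy comp0.
      by rewrite gca_hom_comp qy comp0.
    have [w hw] := choice ck.
    exists (\sum_(k < hsize y) w k); split.
      by rewrite rmorph_sum big1 // => k _; case: (hw k).
    rewrite linear_sum [RHS](comp_sum (leqnn _)); apply: eq_bigr => k _.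
    by case: (hw k).
  have qi a : q (i a) = rho a by exact: (hq 0%N a).
  split.
    move=> y dy [b0 Eb]; have [a0 Ea] := proj1 hrho b0.
    have [||w [qw dw]] := key' (y - diff (i a0)).
    - by rewrite linearB /= dy diff_diff subrr.
    - by rewrite rmorphB /= cdga_hom_diff qi Ea Eb subrr.
    by exists (w + i a0); rewrite linearD /= dw subrK.
  move=> b0 db; have [a0 Ea] := proj1 hrho b0.
  have [||w [qw dw]] := key' (diff (i a0)).
  - exact: diff_diff.
  - by rewrite cdga_hom_diff qi Ea.
  exists (i a0 - w); split; first by rewrite linearB /= dw subrr.
  by exists 0; rewrite linear0 addr0 rmorphB /= qw subr0 qi.
- by move=> a; exact: (hq 0%N a).
- by move=> a; exact: (htau 0%N a).
Qed.

End Model.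

(** * Transport along the isomorphism with a tower *)

Section Transport.
Variables (A D : cdga) (f : cdga_hom A D) (g : cdga_hom D A).
Hypotheses (fg : cancel f g) (gf : cancel g f).

Lemma sc_transport : sc D -> sc A.
Proof.
move=> hD; split.
- move=> a /(gca_hom_homog f) /(sc0 hD) [r E]; exists r.
  by rewrite -(fg a) E linearZ rmorph1.
- by move=> a /(gca_hom_homog f) /(sc1 hD) E; rewrite -(fg a) E rmorph0.
- move=> k; have [s hs] := sc_fin hD k; exists [seq g x | x <- s] => a.
  move=> /(gca_hom_homog f) /hs; rewrite -{2}(fg a); apply: lin_span_map => b sb.
  by apply: lin_span_gen; apply: map_f.
Qed.

Lemma acyclic_transport K : acyclic K -> acyclic (fun a => K (f a)).
Proof.
move=> hK; have iK := ac_ideal hK; split.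
- split=> [|r a b ha hb|a b ha|a b hb|a ha].
  + by rewrite rmorph0; apply: id0.
  + by rewrite linearP; apply: idP.
  + by rewrite rmorphM; apply: (idMr iK).
  + by rewrite rmorphM; apply: (idMl iK).
  + by rewrite gca_hom_sgn; apply: (idsgn iK).
- move=> k a Ka ha k2; rewrite -(fg a) (ac_low hK Ka _ k2) ?rmorph0 //.
  exact: gca_hom_homog.
- move=> k a Ka ha da.
  have [|w [Kw hw dw]] := ac_exact hK Ka (gca_hom_homog f ha).
    by rewrite -cdga_hom_diff da rmorph0.
  exists (g w); rewrite gf; split=> //; first exact: gca_hom_homog.
  by rewrite -cdga_hom_diff dw fg.
Qed.

Lemma detects_transport K top : detects K (f top) -> detects (fun a => K (f a)) top.
Proof.
case=> l [ld lK lt]; have [|l' hl'] := @linear_exists A rat^o (fun a => l (f a)).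
  by move=> r a b; rewrite !linearP.
exists l'; split=> [a|a Ka|]; rewrite hl' //; last exact: lK.
by rewrite cdga_hom_diff ld.
Qed.

Lemma tens_transport (C E : cdga) (i : cdga_hom C E) (j : cdga_hom D E) :
  tens i j -> tens i (cdga_compose j f).
Proof.
move=> T; split.
- move=> V b bl br.
  have [d r c c'|c r d d'|h hh] := tens_lin T (b := fun c d => b c (g d)).
  + by rewrite bl.
  + by rewrite linearP br.
  by exists h => c d; rewrite /= hh fg.
- move=> y; have [s ->] := tens_span T y; exists [seq (p.1, g p.2) | p <- s].
  by rewrite big_map; apply: eq_bigr => p _; rewrite /= gf.
- move=> B f1 g1; have [h [hi hj]] := tens_ext T f1 (cdga_compose g1 g).
  by exists h; split=> // a; rewrite /= hj /= fg.
Qed.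

End Transport.

(** Everything about A that the bounds below use. *)
Lemma pure_data (n : nat) (A : cdga) (deg : gens n -> nat) (w : gens n -> A)
    (hA : minimal_sullivan deg w)
    (hx : forall i : 'I_n, ~~ odd (deg (gx i)))
    (hu : forall i : 'I_n, odd (deg (gu i)))
    (hy : odd (deg (gy n)))
    (hdx : forall i : 'I_n, diff (w (gx i)) = 0)
    (hdu : forall i : 'I_n, diff (w (gu i)) = w (gx i) ^+ 2)
    (hdy : exists c : 'M[rat]_n,
       diff (w (gy n)) = \sum_i \sum_j c i j *: (w (gx i) * w (gx j))) :
  exists K S : A -> Prop,
  [/\ [/\ acyclic K, detects K ((\prod_(i < n) w (gx i)) * w (gy n)) & sc A],
      forall i : 'I_n, K (w (gu i)) /\ K (w (gx i) ^+ 2),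
      tensorable S, forall i : 'I_n, S (w (gu i)) /\ S (w (gx i) ^+ 2)
    & forall a, subalg_gen (fun b => exists j, b = w j) a].
Proof.
have [D [S [top [f [g [[tD fg gf] Et ug hS]]]]]] := tower_iso hA hx hu hy hdx hdu hdy.
have [hD [K [hK dK SK]]] := tow_good tD.
exists (fun a => K (f a)), (fun a => S (f a)); split=> //.
- split; [exact: (acyclic_transport fg gf) | by apply: detects_transport; rewrite -Et | exact: (sc_transport fg)].
- by move=> i; have [h1 h2] := hS i; split; apply: SK.
- move=> C KC hC hKC.
  have [E [i [j [K' [T hE hK' Ki Kj]]]]] := tow_tens tD hC hKC.
  exists E, i, (cdga_compose j f), K'; split=> //; first exact: (tens_transport fg gf).
  by move=> a Sa; apply: Kj.
Qed.

(** * Upper bounds *)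

Section Words.
Variables (C : gca) (K : C -> Prop) (J : eqType) (deg : J -> nat) (v : J -> C).
Hypotheses (iK : ideal K) (hv : forall j, homog (deg j) (v j)).

Lemma word_homog (s : seq J) : homog (\sum_(j <- s) deg j) (\prod_(j <- s) v j).
Proof.
elim: s => [|j s IH]; first by rewrite !big_nil; apply: homog1.
by rewrite !big_cons; apply: homogM.
Qed.

Lemma word_mem j s : K (v j) -> j \in s -> K (\prod_(j <- s) v j).
Proof.
move=> Kj; elim: s => // a s IH; rewrite inE big_cons => /orP [/eqP <-|/IH h].
  exact: (idMr iK).
exact: (idMl iK).
Qed.

(** A word longer than the alphabet repeats a letter, and equal letters can be
    brought together up to sign. *)
Lemma long_word (l : seq J) s : (forall j, K (v j * v j)) -> (forall j, j \notin l -> K (v j)) ->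
  (size l < size s)%N -> K (\prod_(j <- s) v j).
Proof.
move=> sq out ls.
have [/allP sub|] := boolP (all [in l] s); last first.
  by case/allPn => j js jl; apply: word_mem js; apply: out.
have : ~~ uniq s by apply/negP => us; have := uniq_leq_size us sub; rewrite leqNgt ls.
elim: (s) => // a t IH /=; rewrite negb_and negbK big_cons => /orP [|/IH h]; last exact: (idMl iK).
case/splitPr => p1 p2; rewrite big_cat big_cons /= (mulrA _ (v a)).
rewrite (gca_comm (word_homog p1) (hv a)) -mulrA signAC.
have -> : v a * (v a * \prod_(j <- p1) v j * \prod_(j <- p2) v j) =
   (v a * v a) * (\prod_(j <- p1) v j * \prod_(j <- p2) v j) by rewrite !mulrA.
by apply: (idMl iK); apply: (idMr iK).
Qed.

End Words.

Lemma comp_mul (C : gca) k (a b : C) :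
  comp k (a * b) = \sum_(i < k.+1) comp i a * comp (k - i) b.
Proof.
elim/homog_ind: a => [a a' Ha Ha'|p a ha].
  by rewrite mulrDl compD Ha Ha' -big_split; apply: eq_bigr => i _; rewrite compD mulrDl.
elim/homog_ind: b => [b b' Hb Hb'|q b hb].
  by rewrite mulrDr compD Hb Hb' -big_split; apply: eq_bigr => i _; rewrite compD mulrDr.
rewrite (comp_id _ (homogM ha hb)).
have E (i : 'I_k.+1) : comp i a * comp (k - i) b = if (i == p :> nat) && (k == p + q)%N then a * b else 0.
  rewrite (comp_id _ ha) (comp_id _ hb); case: eqP => [E|_] /=; last by rewrite mul0r.
  have -> : (k - i == q)%N = (k == p + q)%N by have := ltn_ord i; lia.
  by case: eqP => //; rewrite mulr0.
rewrite (eq_bigr _ (fun i _ => E i)); case: eqP => [Ek|_]; last by rewrite big1 // => i _; rewrite andbF.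
have pk : (p < k.+1)%N by lia.
rewrite (bigD1 (Ordinal pk)) //= eqxx big1 ?addr0 // => i.
by rewrite -val_eqE /= => /negbTE ->.
Qed.

Section IdealPow.
Variables (C : cdga) (I : C -> Prop).
Hypotheses (iI : ideal I) (cI : forall k a, I a -> I (comp k a)) (dI : forall a, I a -> I (diff a)).

Let In (s : seq C) := forall a, a \in s -> I a.

Lemma pow_prod s : In s -> ideal_pow I (size s) (\prod_(a <- s) a).
Proof. by move=> hs; apply: lin_span_gen; exists s. Qed.

Lemma pow_mul m k a b : ideal_pow I m a -> ideal_pow I k b -> ideal_pow I (m + k) (a * b).
Proof.
move=> ha hb; apply: (lin_span_mul _ ha hb) => _ _ [s [<- hs ->]] [s' [<- hs' ->]].
apply: lin_span_gen; exists (s ++ s'); split; [by rewrite size_cat | | by rewrite big_cat].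
by move=> c; rewrite mem_cat => /orP [/hs|/hs'].
Qed.

Lemma pow1 a : I a -> ideal_pow I 1 a.
Proof.
move=> Ia; apply: lin_span_gen; exists [:: a]; split; rewrite ?big_seq1 // => b.
by rewrite inE => /eqP ->.
Qed.

Lemma pow_ideal m : ideal (ideal_pow I m.+1).
Proof.
split=> [|r a b|a b|a b|a].
- exact: lin_span0.
- by move=> ha hb; apply: lin_spanD => //; apply: lin_spanZ.
- move=> ha; apply: (lin_span_mul (S2 := eq b) _ ha (lin_span_gen erefl)) => _ _ [s [hsz hs ->]] <-.
  case/lastP: s hsz hs => // s x; rewrite size_rcons => -[<-] hs.
  rewrite -cats1 big_cat big_seq1 -mulrA -addn1; apply: pow_mul.
    by apply: pow_prod => c cs; apply: hs; rewrite mem_rcons inE cs orbT.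
  by apply: pow1; apply: (idMr iI); apply: hs; rewrite mem_rcons mem_head.
- move=> hb; apply: (lin_span_mul (S1 := eq a) _ (lin_span_gen erefl) hb) => _ _ <- [s [hsz hs ->]].
  case: s hsz hs => // x s [<-] hs; rewrite big_cons mulrA -add1n; apply: pow_mul.
    by apply: pow1; apply: (idMl iI); apply: hs; rewrite mem_head.
  by apply: pow_prod => c cs; apply: hs; rewrite inE cs orbT.
- apply: lin_span_map => _ [s [<- hs ->]].
  rewrite rmorph_prod /=; apply: lin_span_gen; exists [seq sgn x | x <- s].
  split; [by rewrite size_map | | by rewrite big_map].
  by move=> b /mapP [c cs ->]; apply: (idsgn iI); apply: hs.
Qed.

Lemma pow_comp m k a : ideal_pow I m a -> ideal_pow I m (comp k a).
Proof.
move: a; apply: lin_span_ind; first by rewrite comp0; apply: lin_span0.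
move=> r a a' [s [<- hs ->]] h; rewrite comp_is_linear; apply: lin_spanD => //; apply: lin_spanZ.
elim: s k hs {h} => [|x s IH] k hs.
  rewrite big_nil (comp_id _ (homog1 C)); case: eqP => _; last exact: lin_span0.
  by apply: lin_span_gen; exists [::]; rewrite big_nil.
rewrite big_cons comp_mul; apply: lin_span_sum => i; rewrite /= -add1n; apply: pow_mul.
  by apply: pow1; apply: cI; apply: hs; rewrite mem_head.
by apply: IH => b bs; apply: hs; rewrite inE bs orbT.
Qed.

Lemma pow_diff m a : ideal_pow I m a -> ideal_pow I m (diff a).
Proof.
apply: lin_span_map => _ [s [<- hs ->]] /=.
elim: s hs => [|x s IH] hs; first by rewrite big_nil diff1; apply: lin_span0.
have hs' : In s by move=> b bs; apply: hs; rewrite inE bs orbT.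
have Ix : I x by apply: hs; rewrite mem_head.
rewrite big_cons diffM /= -add1n; apply: lin_spanD; apply: pow_mul.
- by apply: pow1; apply: dI.
- exact: pow_prod.
- by apply: pow1; apply: (idsgn iI).
- exact: IH.
Qed.

Lemma pow_le m k a : (m <= k)%N -> ideal_pow I k.+1 a -> ideal_pow I m.+1 a.
Proof.
move=> /subnK <-; elim: (k - m)%N a => [|d IH] a //.
rewrite addSn => h; apply: IH; move: a h; apply: lin_span_ind; first exact: lin_span0.
move=> r a a' [s [hsz hs ->]] h; apply: lin_spanD => //; apply: lin_spanZ.
case: s hsz hs => // x s [hsz] hs; rewrite big_cons; apply: (idMl (pow_ideal _)).
by rewrite -hsz; apply: pow_prod => b bs; apply: hs; rewrite inE bs orbT.
Qed.

End IdealPow.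

Lemma acyclic_not1 (C : cdga) (K : C -> Prop) : acyclic K -> ~ K 1.
Proof.
by move=> hK K1; have /eqP := ac_low hK K1 (homog1 C) isT; rewrite oner_eq0.
Qed.

Lemma retract_below (A : cdga) (K I : A -> Prop) : sc A -> acyclic K -> ideal I ->
  (forall k a, I a -> I (comp k a)) -> (forall a, I a -> I (diff a)) -> (forall a, I a -> K a) ->
  exists (B : cdga) (rho : cdga_hom A B), is_quotient rho I /\ homotopy_retraction rho.
Proof.
move=> hA hK iI cI dI IK.
have [|B [rho hrho]] := cdga_quotient iI cI dI; first by move/IK; apply: acyclic_not1.
by exists B, rho; split=> //; apply: (model_retract hrho hA hK).
Qed.

Section WordLength.
Variables (A : cdga) (J : eqType) (deg : J -> nat) (w : J -> A).
Hypotheses (hw : forall j, homog (deg j) (w j)).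
Hypothesis gen : forall a, subalg_gen (fun b => exists j, b = w j) a.
Hypothesis dw : forall j, wordlength_gt w 1 (diff (w j)).

(** Lambda^(>= m) W. *)
Definition wl m := lin_span (fun b => exists2 s : seq J, (m <= size s)%N & b = \prod_(j <- s) w j).

Lemma wl_word s : wl (size s) (\prod_(j <- s) w j).
Proof. by apply: lin_span_gen; exists s. Qed.

Lemma wl_mul m k a b : wl m a -> wl k b -> wl (m + k) (a * b).
Proof.
move=> ha hb; apply: (lin_span_mul _ ha hb) => _ _ [s hs ->] [s' hs' ->].
by apply: lin_span_gen; exists (s ++ s'); rewrite ?big_cat // size_cat leq_add.
Qed.

Lemma wl0 a : wl 0 a.
Proof.
apply: lin_span_sub (gen a) => b [s hs ->].
elim: s hs => [|x s IH] hs; first by exists [::]; rewrite ?big_nil.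
have [|s' _ E] := IH; first by move=> y ys; apply: hs; rewrite inE ys orbT.
have [j Ej] := hs x (mem_head _ _).
by exists (j :: s'); rewrite ?big_cons ?E ?Ej.
Qed.

Lemma wl_le m k a : (m <= k)%N -> wl k a -> wl m a.
Proof. by move=> mk; apply: lin_span_sub => b [s hs ->]; exists s => //; apply: leq_trans hs. Qed.

Lemma wl_ideal m : ideal (wl m).
Proof.
split=> [|r a b ha hb|a b ha|a b hb|a].
- exact: lin_span0.
- by apply: lin_spanD => //; apply: lin_spanZ.
- by rewrite -[m]addn0; apply: wl_mul => //; apply: wl0.
- by rewrite -[m]add0n; apply: wl_mul => //; apply: wl0.
- apply: lin_span_map => _ [s hs ->] /=.
  by rewrite (sgnE (word_homog hw s)) signZ; apply: lin_spanZ; apply: wl_le hs (wl_word s).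
Qed.

Lemma wl_comp m k a : wl m a -> wl m (comp k a).
Proof.
move: a; apply: lin_span_ind; first by rewrite comp0; apply: lin_span0.
move=> r a a' [s hs ->] h; rewrite comp_is_linear; apply: lin_spanD => //; apply: lin_spanZ.
rewrite (comp_id _ (word_homog hw s)); case: eqP => _; last exact: lin_span0.
exact: wl_le hs (wl_word s).
Qed.

Lemma wl_diff m a : wl m a -> wl m (diff a).
Proof.
apply: lin_span_map => _ [s hs ->] /=.
apply: wl_le hs _; elim: s => [|j s IH]; first by rewrite big_nil diff1; apply: lin_span0.
rewrite big_cons diffM /= -add1n; apply: lin_spanD; apply: wl_mul => //.
- exact: (wl_le (k := 2) _ (dw j)).
- exact: wl_word.
- apply: (idsgn (wl_ideal 1)); have := wl_word [:: j]; by rewrite big_seq1.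
Qed.

End WordLength.

(** f(ab) - g(ab) = (f a - g a) f b + g a (f b - g b), so differences of two
    morphisms lie in the ideal generated by the differences on generators. *)
Lemma hom_sub_ind (A B : cdga) (f g : cdga_hom A B) (S : A -> Prop) (P : B -> Prop) :
  P 0 -> (forall (r : rat) a b, P a -> P b -> P (r *: a + b)) ->
  (forall a b, P a -> P (a * b)) -> (forall a b, P b -> P (a * b)) ->
  (forall a, S a -> P (f a - g a)) -> forall a, subalg_gen S a -> P (f a - g a).
Proof.
move=> P0 PP Pr Pl PS.
have PD a b : P a -> P b -> P (a + b) by move=> ha hb; rewrite -[a]scale1r; apply: PP.
apply: (subalg_ind (P := fun a => P (f a - g a))) => // [a b ha hb|r a ha|a b ha hb|].
- by rewrite !rmorphD /= opprD addrACA; apply: PD.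
- by rewrite [f _]linearZ [g _]linearZ /= -scalerBr -[_ *: _]addr0; apply: PP.
- rewrite !rmorphM /=.
  have -> : f a * f b - g a * g b = (f a - g a) * f b + g a * (f b - g b).
    by rewrite mulrBl mulrBr addrA subrK.
  by apply: PD; [apply: Pr | apply: Pl].
- by rewrite !rmorph1 subrr.
Qed.

Section Upper.
Variables (n : nat) (A : cdga) (deg : gens n -> nat) (w : gens n -> A).
Hypotheses (hw : forall j, homog (deg j) (w j)) (hy : odd (deg (gy n))).
Hypothesis gen : forall a, subalg_gen (fun b => exists j, b = w j) a.
Hypothesis dw : forall j, wordlength_gt w 1 (diff (w j)).
Variables (K S : A -> Prop).
Hypotheses (hA : sc A) (hK : acyclic K) (hS : tensorable S).
Hypothesis Kux : forall i : 'I_n, K (w (gu i)) /\ K (w (gx i) ^+ 2).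
Hypothesis Sux : forall i : 'I_n, S (w (gu i)) /\ S (w (gx i) ^+ 2).

(** The alphabet y, x_1, .., x_n has n + 1 letters, and the remaining letters u_i
    lie in K. *)
Lemma cat_upper : cat_le w n.+1.
Proof.
apply: (retract_below hA hK).
- exact: (wl_ideal hw gen n.+2).
- by move=> k a; apply: (wl_comp hw (m := n.+2)).
- by move=> a; apply: (wl_diff hw gen dw (m := n.+2)).
move=> a; have iK := ac_ideal hK.
apply: lin_span_ind => [|c b b' [s hs ->] Kb]; first exact: id0.
apply: (idP iK) => //.
apply: (long_word iK hw (l := gy n :: [seq gx i | i <- enum 'I_n])) => [[[i|i]|[]]|[[i|i]|[]]|].
- by have [_] := Kux i; rewrite expr2.
- by have [h _] := Kux i; apply: (idMr iK).
- by rewrite (odd_sqr0 hy (hw _)); apply: id0.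
- by rewrite inE /= map_f // mem_enum.
- by have [h _] := Kux i.
- by rewrite inE eqxx.
by rewrite /= size_map size_enum_ord.
Qed.

(** (ker mu)^m is spanned by multiples of products of m differences dl of copies
    of generators (the predicate F).  Modulo the acyclic ideal these products are
    combinations of words (the predicate G) in the copies of the x_i and the
    r - 1 nonzero differences of copies of y, an alphabet of r n + r - 1 letters
    of square zero. *)
Lemma TC_upper (r : nat) : (0 < r)%N -> TC_le r A (r * n.+1).-1.
Proof.
move=> r0.
have [T [inj [mu [KT [tT muT [hT gT] hKT SKT]]]]] := power_exists hS r.
have iK := ac_ideal hKT.
pose I (z : T) := mu z = 0.
have iI : ideal I := ker_ideal mu.
have cI k a : I a -> I (comp k a) by rewrite /I gca_hom_comp => ->; rewrite comp0.
have dI a : I a -> I (diff a) by rewrite /I cdga_hom_diff => ->; rewrite linear0.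
have rn : (r * n.+1).-1.+1 = (r * n.+1)%N by rewrite prednK // muln_gt0 r0.
suff IK : forall a, ideal_pow I (r * n.+1).-1.+1 a -> KT a.
  have [B [rho [hq hr]]] := retract_below hT hKT (pow_ideal iI _)
    (fun k a => @pow_comp _ _ cI _ k a) (fun a => @pow_diff _ _ iI dI _ a) IK.
  by exists T, inj, mu, B, rho.
rewrite rn.
pose k0 : 'I_r := Ordinal r0.
pose dl (p : 'I_r * gens n) := inj p.1 (w p.2) - inj k0 (w p.2).
have hdl p : homog (deg p.2) (dl p) by apply: homogB; apply: gca_hom_homog.
pose F p := lin_span (fun b => exists a (s : seq ('I_r * gens n)),
  size s = p /\ b = a * \prod_(j <- s) dl j).
have Fmul p q a b : F p a -> F q b -> F (p + q)%N (a * b).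
  move=> ha hb; apply: (lin_span_mul _ ha hb) => _ _ [x [s [hs ->]]] [y [s' [hs' ->]]].
  elim/homog_ind: y => [y y' Hy Hy'|k y hy'].
    by rewrite mulrDl mulrDr; apply: lin_spanD.
  rewrite mulrA -[x * _ * y]mulrA.
  rewrite (gca_comm (word_homog hdl s) hy') signAC signZ -scalerAl; apply: lin_spanZ.
  by apply: lin_span_gen; exists (x * y), (s ++ s'); rewrite size_cat hs hs' big_cat /= !mulrA.
have F0 x : F 0%N x by apply: lin_span_gen; exists x, [::]; rewrite big_nil mulr1.
have F1 p : F 1%N (dl p) by apply: lin_span_gen; exists 1, [:: p]; rewrite mul1r big_seq1.
have F1l a b : F 1%N b -> F 1%N (a * b) by move=> hb; have := Fmul 0%N 1%N _ _ (F0 a) hb.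
have F1r a b : F 1%N a -> F 1%N (a * b) by move=> hb; have := Fmul 1%N 0%N _ _ hb (F0 b).
have FP (c : rat) x y : F 1%N x -> F 1%N y -> F 1%N (c *: x + y).
  by move=> hx' hy'; apply: lin_spanD => //; apply: lin_spanZ.
have Fz : F 1%N 0 by apply: lin_span0.
have Finj k a : F 1%N (inj k a - inj k0 a).
  by apply: (hom_sub_ind Fz FP F1r F1l _ (gen a)) => _ [j ->]; apply: (F1 (k, j)).
have Fmu z : F 1%N (z - inj k0 (mu z)).
  apply: (hom_sub_ind (f := cdga_id T) (g := cdga_compose (inj k0) mu) Fz FP F1r F1l _ (gT z)).
  by move=> _ [k [x ->]]; rewrite /= muT; apply: Finj.
have FI z : I z -> F 1%N z by move=> Iz; have := Fmu z; rewrite Iz rmorph0 subr0.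
have Fpow m z : ideal_pow I m z -> F m z.
  move: z; apply: lin_span_ind; first exact: lin_span0.
  move=> c z z' [s [<- hs ->]] h; apply: lin_spanD => //; apply: lin_spanZ.
  elim: s hs {h} => [|x s IH] hs; first by rewrite big_nil; apply: F0.
  rewrite big_cons -[size (x :: s)]/(1 + size s)%N; apply: Fmul.
    by apply: FI; apply: hs; rewrite mem_head.
  by apply: IH => y ys; apply: hs; rewrite inE ys orbT.
pose v (j : ('I_r * 'I_n) + 'I_r) : T := match j with
  | inl p => inj p.1 (w (gx p.2)) | inr k => inj k (w (gy n)) - inj k0 (w (gy n)) end.
pose vdeg (j : ('I_r * 'I_n) + 'I_r) := match j with
  | inl p => deg (gx p.2) | inr k => deg (gy n) end.
have hv j : homog (vdeg j) (v j).
  by case: j => [p|k] /=; [apply: gca_hom_homog | apply: homogB; apply: gca_hom_homog].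
pose l := [seq inl p | p <- enum {: 'I_r * 'I_n}] ++
  [seq (inr k : ('I_r * 'I_n) + 'I_r) | k <- enum (predC1 k0)].
have sl : (size l < r * n.+1)%N.
  rewrite size_cat !size_map -enumT -!cardE card_prod cardC1 !card_ord mulnS addnC.
  by rewrite -addSn prednK // ltn_add2r.
have sqK j : KT (v j * v j).
  case: j => [[k i]|k] /=.
    by rewrite -expr2 -rmorphXn /=; apply: SKT; case: (Sux i).
  by rewrite (odd_sqr0 hy (hv (inr k))); apply: id0.
have outK j : j \notin l -> KT (v j).
  case: j => [p|k] jl; move: jl; rewrite mem_cat negb_or => /andP [j1 j2].
    by move: j1; rewrite map_f // mem_enum.
  have [->|kk] := eqVneq k k0; first by rewrite /= subrr; apply: id0.
  by move: j2; rewrite map_f // mem_enum.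
pose G m := lin_span (fun b => KT b \/ exists s, size s = m /\ b = \prod_(j <- s) v j).
have Gdl p : lin_span (fun b => KT b \/ exists j, b = v j) (dl p).
  case: p => k [[i|i]|[]] /=.
  - apply: lin_spanD; [|apply: lin_spanN]; apply: lin_span_gen; right.
      by exists (inl (k, i)).
    by exists (inl (k0, i)).
  - apply: lin_span_gen; left; apply: idB => //; apply: SKT; by case: (Sux i).
  - by apply: lin_span_gen; right; exists (inr k).
have Gword s : G (size s) (\prod_(j <- s) dl j).
  elim: s => [|p s IH].
    by rewrite big_nil; apply: lin_span_gen; right; exists [::]; rewrite big_nil.
  rewrite big_cons; apply: (lin_span_mul _ (Gdl p) IH) => a b ha hb.
  case: ha => [Ka|[j ->]]; first by apply: lin_span_gen; left; apply: (idMr iK).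
  case: hb => [Kb|[s' [ss ->]]]; first by apply: lin_span_gen; left; apply: (idMl iK).
  by apply: lin_span_gen; right; exists (j :: s'); rewrite /= ss big_cons.
move=> a /Fpow; move: a; apply: lin_span_ind => [|c b b' [x [s [hs ->]]] Kb]; first exact: id0.
apply: (idP iK) => //; apply: (idMl iK).
move: (Gword s); apply: lin_span_ind => [|d y y' hy' Ky]; first exact: id0.
apply: (idP iK) => //; case: hy' => [//|[s' [ss ->]]].
by apply: (long_word iK hv (l := l)) => //; rewrite ss hs.
Qed.

End Upper.

(** * Cocycles of large word length *)

Section Kappa.
Variable C : cdga.

(** Centrality and invariance under [sgn] are what the computations below use of
    elements of even degree. *)
Definition ev (x : C) := (forall y, x * y = y * x) /\ sgn x = x.
Definition od (x : C) := sgn x = - x.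

Lemma ev_homog p x : ~~ odd p -> homog p x -> ev x.
Proof.
move=> hp hx; split; first by move=> y; apply: mul_even hx.
by rewrite (sgnE hx) -signr_odd (negbTE hp) mul1r.
Qed.
Lemma od_homog p x : odd p -> homog p x -> od x.
Proof. by move=> hp hx; rewrite /od (sgnE hx) -signr_odd hp mulN1r. Qed.

Lemma ev1 : ev 1. Proof. by split; [move=> y; rewrite mul1r mulr1 | rewrite rmorph1]. Qed.
Lemma evM x y : ev x -> ev y -> ev (x * y).
Proof.
move=> [cx sx] [cy sy]; split; last by rewrite rmorphM /= sx sy.
by move=> v; rewrite -mulrA cy mulrA cx mulrA.
Qed.
Lemma evD x y : ev x -> ev y -> ev (x + y).
Proof.
move=> [cx sx] [cy sy]; split; last by rewrite rmorphD /= sx sy.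
by move=> v; rewrite mulrDl mulrDr cx cy.
Qed.
Lemma evZ (r : rat) x : ev x -> ev (r *: x).
Proof.
move=> [cx sx]; split; last by rewrite linearZ /= sx.
by move=> v; rewrite -scalerAl -scalerAr cx.
Qed.
Lemma evN x : ev x -> ev (- x).
Proof. by rewrite -scaleN1r; apply: evZ. Qed.
Lemma evCA x y v : ev x -> y * (x * v) = x * (y * v).
Proof. by move=> [cx _]; rewrite mulrA -cx mulrA. Qed.
Lemma ev_sum (I : Type) (r : seq I) (F : I -> C) : (forall i, ev (F i)) -> ev (\sum_(i <- r) F i).
Proof.
move=> h; elim/big_rec: _ => [|i x _]; last exact: evD.
by split; [move=> y; rewrite mul0r mulr0 | rewrite rmorph0].
Qed.
Lemma ev_prod m (F : nat -> C) : (forall i, (i < m)%N -> ev (F i)) -> ev (\prod_(i < m) F i).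
Proof.
elim: m => [|m IH] h; first by rewrite big_ord0; apply: ev1.
by rewrite big_ord_recr /=; apply: evM; [apply: IH => i im; apply: h; apply: ltnW | apply: h].
Qed.
Lemma od_evM x y : ev x -> od y -> od (x * y).
Proof. by move=> [_ sx] oy; rewrite /od rmorphM /= sx oy mulrN. Qed.
Lemma odD x y : od x -> od y -> od (x + y).
Proof. by move=> ox oy; rewrite /od rmorphD /= ox oy opprD. Qed.
Lemma odN x : od x -> od (- x).
Proof. by move=> ox; rewrite /od rmorphN /= ox. Qed.

Lemma diff_ev x y : ev x -> diff x = 0 -> diff (x * y) = x * diff y.
Proof. by move=> [_ sx] dx; rewrite diffM dx mul0r add0r sx. Qed.
Lemma diff_od x y : od x -> diff (x * y) = diff x * y - x * diff y.
Proof. by move=> ox; rewrite diffM ox mulNr. Qed.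
Lemma diff_prod0 m (F : nat -> C) : (forall i, (i < m)%N -> diff (F i) = 0) ->
  diff (\prod_(i < m) F i) = 0.
Proof.
elim: m => [|m IH] h; first by rewrite big_ord0 diff1.
rewrite big_ord_recr /= diffM h // mulr0 addr0 IH ?mul0r // => i im.
by apply: h; apply: ltnW.
Qed.

(** W p is instantiated by the word length filtration or by the powers of ker mu,
    and N by an ideal containing the u_i. *)
Variables (W : nat -> C -> Prop) (N : C -> Prop).
Hypotheses (W0 : forall x, W 0 x)
  (WP : forall p (r : rat) x y, W p x -> W p y -> W p (r *: x + y))
  (WM : forall p q x y, W p x -> W q y -> W (p + q) (x * y)) (Wz : forall p, W p 0).
Hypotheses (N0 : N 0) (NP : forall (r : rat) x y, N x -> N y -> N (r *: x + y))
  (NMl : forall x y, N y -> N (x * y)) (NMr : forall x y, N x -> N (x * y)).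

Lemma WD p x y : W p x -> W p y -> W p (x + y).
Proof. by move=> hx hy; rewrite -[x]scale1r; apply: WP. Qed.
Lemma WZ p r x : W p x -> W p (r *: x).
Proof. by move=> hx; rewrite -[_ *: _]addr0; apply: WP. Qed.
Lemma WN p x : W p x -> W p (- x).
Proof. by rewrite -scaleN1r; apply: WZ. Qed.
Lemma Wsum p (I : Type) (r : seq I) (F : I -> C) : (forall i, W p (F i)) -> W p (\sum_(i <- r) F i).
Proof. by move=> h; elim/big_rec: _ => [|i x _] //; apply: WD. Qed.
Lemma ND x y : N x -> N y -> N (x + y).
Proof. by move=> hx hy; rewrite -[x]scale1r; apply: NP. Qed.
Lemma NZ r x : N x -> N (r *: x).
Proof. by move=> hx; rewrite -[_ *: _]addr0; apply: NP. Qed.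
Lemma NN x : N x -> N (- x).
Proof. by rewrite -scaleN1r; apply: NZ. Qed.
Lemma Nsum (I : Type) (r : seq I) (F : I -> C) : (forall i, N (F i)) -> N (\sum_(i <- r) F i).
Proof. by move=> h; elim/big_rec: _ => [|i x _] //; apply: ND. Qed.
Variables (n : nat) (s t a B : nat -> C) (eta : C).
Hypotheses (hs : forall i, (i < n)%N -> ev (s i) /\ diff (s i) = 0)
  (ht : forall i, (i < n)%N -> [/\ ev (t i), diff (t i) = 0 & W 1 (t i)])
  (ha : forall i, (i < n)%N -> [/\ od (a i), diff (a i) = s i * t i, W 1 (a i) & N (a i)])
  (hB : forall i, (i < n)%N -> [/\ ev (B i), diff (B i) = 0 & W 1 (B i)])
  (he : od eta /\ W 1 eta).

(** [Dm n] vanishes when d eta = sum B_j s_j; the partial sums are kept because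
    the induction adjoins one index at a time. *)
Definition Dm m := diff eta - \sum_(j < m) B j * s j.
Definition Pm m := \prod_(j < m) t j.

(** [kappa] is prod t eta corrected by terms containing some a_j.  The element
    [om j] makes s_j kappa exact once D vanishes; it is needed for
    [zeta_exists].  [R j] stands for the product of the t_i with i <> j.
    Passing from m to m + 1,
      kappa' = t_m kappa - B_m P a_m,  om'_m = a_m kappa,
      om'_j = t_m om_j - B_m R_j a_j a_m. *)
Lemma kappa_step m : (m <= n)%N -> exists (kappa : C) (R om : nat -> C),
  [/\ [/\ od kappa, diff kappa = Pm m * Dm m, W m.+1 kappa & N (kappa - Pm m * eta)],
      W m (Pm m)
    & forall j, (j < m)%N -> [/\ ev (R j) /\ t j * R j = Pm m, diff (R j) = 0,
        diff (om j) = s j * kappa - R j * a j * Dm m,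
        W m.-1 (R j) & W m.+1 (om j) /\ N (om j)]].
Proof.
elim: m => [|m IH] mn.
  exists eta, (fun _ => 0), (fun _ => 0).
  rewrite /Dm /Pm !big_ord0 !mul1r subrr subr0; case: he => oe We.
  by split.
have [kappa [R [om [[ok dk Wk Nk] WPm hj]]]] := IH (ltnW mn).
have [[cs ss] ds] := hs mn; have [[ct st] dt Wt] := ht mn; have [oa da Wa Na] := ha mn.
have [[cB sB] dB WB] := hB mn.
have evP : ev (Pm m) by apply: ev_prod => i im; case: (ht (ltn_trans im mn)).
have dP : diff (Pm m) = 0 by apply: diff_prod0 => i im; case: (ht (ltn_trans im mn)).
have PS : Pm m.+1 = t m * Pm m by rewrite /Pm big_ord_recr /= ct.
have DS : Dm m.+1 = Dm m - B m * s m by rewrite /Dm big_ord_recr /= opprD addrA.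
have evt : ev (t m) by []. have evB : ev (B m) by []. have evs : ev (s m) by [].
move: (Dm m) (Dm m.+1) DS dk hj => D D' DS dk hj.
pose kappa' := t m * kappa - B m * (Pm m * a m).
pose R' j := if j == m then Pm m else t m * R j.
pose om' j := if j == m then a m * kappa else t m * om j - B m * (R j * (a j * a m)).
have dk' : diff kappa' = Pm m.+1 * D'.
  rewrite /kappa' linearB /= (diff_ev _ evt dt) (diff_ev _ evB dB) (diff_ev _ evP dP) dk da.
  rewrite PS DS mulrBr !mulrA; congr (_ - _); rewrite -!mulrA.
  by rewrite [RHS]ct -!mulrA (evCA _ _ evB).
exists kappa', R', om'; split; first split.
- by apply: odD; [apply: od_evM | apply: odN; apply: od_evM => //; apply: od_evM].
- exact: dk'.
- apply: WD; first by rewrite -add1n; apply: WM.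
  have -> : m.+2 = (1 + (m + 1))%N by lia.
  by apply: WN; do 2!apply: WM => //.
- rewrite /kappa' PS addrAC -mulrA -mulrBr; apply: ND; first exact: NMl.
  by apply: NN; apply: NMl; apply: NMl.
- by rewrite PS -add1n; apply: WM.
move=> j; rewrite ltnS leq_eqVlt /R' /om'; case: eqP => [-> _|_ /= jm].
  split=> //.
  - rewrite (diff_od _ oa) da dk DS /kappa' !mulrBr.
    have -> : a m * (Pm m * D) = Pm m * a m * D by rewrite (evCA _ _ evP) mulrA.
    have -> : Pm m * a m * (B m * s m) = s m * (B m * (Pm m * a m)).
      by rewrite (evCA _ _ evB) -[RHS](evCA _ _ evs) cs.
    by rewrite opprB addrA subrK mulrA.
  - split; last exact: NMr.
    by rewrite -[m.+2]add1n; apply: WM.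
have [[eR tR] dR dom WR [Wom Nom]] := hj j jm.
have [[csj _] dsj] := hs (ltn_trans jm mn); have [[ctj _] dtj _] := ht (ltn_trans jm mn).
have [oaj daj Waj Naj] := ha (ltn_trans jm mn).
split.
- split; first exact: evM.
  by rewrite PS mulrA -ct -mulrA tR.
- by rewrite (diff_ev _ evt dt) dR mulr0.
- rewrite linearB /= (diff_ev _ evt dt) (diff_ev _ evB dB) (diff_ev _ eR dR) dom.
  rewrite (diff_od _ oaj) daj da DS /kappa' !mulrBr.
  have evj : ev (s j) by case: (hs (ltn_trans jm mn)).
  have evtj : ev (t j) by case: (ht (ltn_trans jm mn)).
  rewrite (evCA _ _ evj).
  have -> : B m * (R j * (s j * t j * a m)) = s j * (B m * (Pm m * a m)).
    by rewrite -tR -!mulrA !(evCA _ _ evj) (evCA _ _ evtj).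
  have -> : B m * (R j * (a j * (s m * t m))) = t m * R j * a j * (B m * s m).
    by rewrite -!mulrA (evCA _ _ evB) (evCA _ _ evB) (evCA _ _ evB) [s m * t m]cs !(evCA _ _ evt).
  by rewrite !mulrA !opprB addrACA [RHS]addrACA; congr (_ + _); rewrite addrC.
- have E : m = (1 + m.-1)%N by rewrite add1n prednK // (leq_ltn_trans _ jm).
  by rewrite [X in W X]E; apply: WM.
- have m0 : (0 < m)%N by apply: leq_ltn_trans jm.
  split; last by apply: ND; [apply: NMl | apply: NN; do 2!apply: NMl; apply: NMr].
  apply: WD; first by rewrite -add1n; apply: WM.
  apply: WN; have -> : m.+2 = (1 + (m.-1 + (1 + 1)))%N by lia.
  by do 3!apply: WM => //.
Qed.

Lemma kappa_exists : diff eta = \sum_(j < n) B j * s j ->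
  exists kappa, [/\ diff kappa = 0, W n.+1 kappa & N (kappa - Pm n * eta)].
Proof.
move=> de; have [kappa [R [om [[ok dk Wk Nk] _ _]]]] := kappa_step (leqnn n).
by exists kappa; split=> //; rewrite dk /Dm de subrr mulr0.
Qed.

Variables (b : nat -> C) (eps : C) (c : nat -> nat -> rat).
Hypotheses (hb : forall i, (i < n)%N -> diff (b i) = s i ^+ 2 + t i ^+ 2 /\ N (b i))
  (deta : diff eta = \sum_(j < n) B j * s j)
  (deps : diff eps = \sum_(i < n) \sum_(j < n) c i j *: (s i * s j + t i * t j)).

(** With E = P eps - sum c_ij t_j R_i b_i, where P is the product of all t_i, one
    finds dE = sum c_ij (P s_j - t_j R_i s_i) s_i: the terms c_ij P t_i t_j
    cancel because t_i R_i = P.  Since s_i kappa = d om_i, adding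
    sum c_ij (P s_j - t_j R_i s_i) om_i to kappa E makes it a cocycle. *)
Lemma zeta_exists : exists z, [/\ diff z = 0, W (n.+1 + n) z &
  N (z - (Pm n * eta) * (Pm n * eps))].
Proof.
have [kappa [R [om [[ok dk Wk Nk] WPn hj]]]] := kappa_step (leqnn n).
rewrite /Dm deta subrr mulr0 in dk.
have evP : ev (Pm n) by apply: ev_prod => i im; case: (ht im).
have dP : diff (Pm n) = 0 by apply: diff_prod0 => i im; case: (ht im).
pose E := Pm n * eps - \sum_(i < n) \sum_(j < n) c i j *: (t j * R i * b i).
pose f (i j : nat) := Pm n * s j - t j * R i * s i.
pose z := kappa * E + \sum_(i < n) \sum_(j < n) c i j *: (f i j * om i).
have evR (i : 'I_n) : ev (R i) by case: (hj i (ltn_ord i)) => [[]].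
have evs (i : 'I_n) : ev (s i) by case: (hs (ltn_ord i)).
have evt (i : 'I_n) : ev (t i) by case: (ht (ltn_ord i)).
have ds (i : 'I_n) : diff (s i) = 0 by case: (hs (ltn_ord i)).
have dt (i : 'I_n) : diff (t i) = 0 by case: (ht (ltn_ord i)).
have dR (i : 'I_n) : diff (R i) = 0 by case: (hj i (ltn_ord i)).
have evtR (i j : 'I_n) : ev (t j * R i) by apply: evM.
have dtR (i j : 'I_n) : diff (t j * R i) = 0 by rewrite (diff_ev _ (evt j) (dt j)) dR mulr0.
have evf (i j : 'I_n) : ev (f i j).
  by apply: evD; [apply: evM | apply: evN; apply: evM].
have df (i j : 'I_n) : diff (f i j) = 0.
  by rewrite linearB /= (diff_ev _ evP dP) (diff_ev _ (evtR i j) (dtR i j)) !ds !mulr0 subrr.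
have dE : diff E = \sum_(i < n) \sum_(j < n) c i j *: (f i j * s i).
  rewrite linearB /= (diff_ev _ evP dP) deps mulr_sumr linear_sum /= -sumrB.
  apply: eq_bigr => i _; rewrite mulr_sumr linear_sum /= -sumrB; apply: eq_bigr => j _.
  rewrite linearZ /= (diff_ev _ (evtR i j) (dtR i j)) -scalerAr -scalerBr; congr (_ *: _).
  have [-> _] := hb (ltn_ord i).
  rewrite /f !mulrDr mulrBl opprD addrACA.
  have -> : Pm n * (t i * t j) = t j * R i * t i ^+ 2.
    have [[_ <-] _ _ _ _] := hj i (ltn_ord i).
    by rewrite expr2 -!mulrA [RHS](proj1 (evt j)) -!mulrA [RHS](evCA _ _ (evt i)).
  rewrite subrr addr0 expr2 !mulrA; congr (_ - _).
  by rewrite -!mulrA (proj1 (evs i)).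
exists z; split.
- rewrite linearD /= (diff_od _ ok) dk mul0r sub0r dE linear_sum /=.
  apply/eqP; rewrite addrC subr_eq0; apply/eqP; rewrite mulr_sumr; apply: eq_bigr => i _.
  rewrite linear_sum mulr_sumr /=; apply: eq_bigr => j _.
  rewrite linearZ /= (diff_ev _ (evf i j) (df i j)) -scalerAr; congr (_ *: _).
  have [_ _ -> _ _] := hj i (ltn_ord i).
  rewrite /Dm deta subrr mulr0 subr0 mulrA.
  exact: (proj1 (evM (evf i j) (evs i)) kappa).
- apply: WD.
    apply: WM => //; apply: WD; first by rewrite -[X in W X]addn0; apply: WM.
    apply: WN; apply: Wsum => i; apply: Wsum => j; apply: WZ.
    have n0 : (0 < n)%N by apply: leq_ltn_trans (ltn_ord i).
    have En : n = (1 + n.-1 + 0)%N by lia.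
    have [_ _ _ WR _] := hj i (ltn_ord i); have [_ _ Wt] := ht (ltn_ord j).
    by rewrite [X in W X]En; apply: WM => //; apply: WM.
  apply: Wsum => i; apply: Wsum => j; apply: WZ; rewrite addnC.
  have [_ _ _ WR [Wo _]] := hj i (ltn_ord i); have [_ _ Wt] := ht (ltn_ord j).
  have n0 : (0 < n)%N by apply: leq_ltn_trans (ltn_ord i).
  apply: WM => //; apply: WD; first by rewrite -[X in W X]addn0; apply: WM.
  apply: WN; have En : n = (1 + n.-1 + 0)%N by lia.
  by rewrite [X in W X]En; apply: WM => //; apply: WM.
- rewrite /z addrAC; apply: ND; last first.
    apply: Nsum => i; apply: Nsum => j; apply: NZ; apply: NMl.
    by have [_ _ _ _ []] := hj i (ltn_ord i).
  have -> : kappa * E - Pm n * eta * (Pm n * eps) =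
     (kappa - Pm n * eta) * E + Pm n * eta * (E - Pm n * eps).
    by rewrite mulrBl [Pm n * eta * (E - _)]mulrBr addrA subrK.
  apply: ND; first exact: NMr.
  apply: NMl; rewrite /E addrAC subrr add0r; apply: NN.
  apply: Nsum => i; apply: Nsum => j; apply: NZ; apply: NMl.
  by case: (hb (ltn_ord i)).
Qed.

End Kappa.

(** * Lower bounds *)

(** In the relative model C the image of z is exact because C -> B is injective in
    cohomology; the retraction carries a primitive back to A. *)
Lemma retraction_exact (A B : cdga) (rho : cdga_hom A B) z : homotopy_retraction rho ->
  diff z = 0 -> rho z = 0 -> exists y, z = diff y.
Proof.
case=> C [i [q [tau [_ [qinj _] qi ti]]]] dz rz.
have [||c Ec] := qinj (i z); first by rewrite -cdga_hom_diff dz rmorph0.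
  by exists 0; rewrite qi rz linear0.
by exists (tau c); rewrite -cdga_hom_diff -Ec ti.
Qed.

Section TensorFunctional.
Variables (r : nat) (A T : cdga) (inj : 'I_r -> cdga_hom A T).
Hypothesis tT : is_tensor_power inj.

Lemma tp_ext (V : lmodType rat) (h : {linear T -> V}) :
  (forall a : 'I_r -> A, h (\prod_(k < r) inj k (a k)) = 0) -> forall z, h z = 0.
Proof.
move=> h0 z.
have m0 : @is_multilinear r A V (fun _ => 0).
  by move=> k c a a' b _ _; rewrite scaler0 addr0.
have [_ uniq] := tT m0.
by apply: (uniq h \0) => a //; apply: h0.
Qed.

Variables (lam : {linear A -> rat^o}) (K : A -> Prop).
Hypotheses (ld : forall a, lam (diff a) = 0) (lK : forall a, K a -> lam a = 0) (iK : ideal K).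

Lemma functional_exists : exists L : {linear T -> rat^o},
  forall a : 'I_r -> A, L (\prod_(k < r) inj k (a k)) = \prod_(k < r) (lam (a k) : rat).
Proof.
have m : @is_multilinear r A rat^o (fun a => \prod_(k < r) (lam (a k) : rat)).
  move=> k c a a' b E Ek.
  have D (f : 'I_r -> A) : \prod_(l < r) (lam (f l) : rat) =
    lam (f k) * \prod_(l < r | l != k) (lam (f l) : rat) by rewrite (bigD1 k).
  rewrite !D Ek linearP /=.
  rewrite [X in _ = c *: X + _](_ : _ = lam (a k) * \prod_(l < r | l != k) (lam (b l) : rat)); last first.
    by congr (_ * _); apply: eq_bigr => l lk; rewrite (proj1 (E l lk)).
  rewrite [X in _ = _ + X](_ : _ = lam (a' k) * \prod_(l < r | l != k) (lam (b l) : rat)); last first.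
    by congr (_ * _); apply: eq_bigr => l lk; rewrite (proj2 (E l lk)).
  by rewrite mulrDl scalerAl.
have [[L hL] _] := tT m; exists L => a.
have := hL [ffun k => a k]; rewrite (eq_bigr (fun k => lam (a k) : rat)); last by move=> k _; rewrite ffunE.
by move=> <-; congr (L _); apply: eq_bigr => k _; rewrite ffunE.
Qed.

Definition Lam : {linear T -> rat^o} := sval (cid functional_exists).
Lemma LamE (a : 'I_r -> A) : Lam (\prod_(k < r) inj k (a k)) = \prod_(k < r) (lam (a k) : rat).
Proof. exact: (svalP (cid functional_exists)). Qed.

Lemma Lam_zero (F : 'I_r -> A) l : lam (F l) = 0 -> Lam (\prod_(k < r) inj k (F k)) = 0.
Proof. by move=> h; rewrite LamE (bigD1 l) //= h mul0r. Qed.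

Definition upd (F : 'I_r -> A) k v : 'I_r -> A := fun j => if j == k then v else F j.

Lemma upd_prod (F : 'I_r -> A) k v s : k \notin s ->
  \prod_(j <- s) inj j (upd F k v j) = \prod_(j <- s) inj j (F j).
Proof.
move=> ks; apply: eq_big_seq => j js; rewrite /upd; case: eqP => // E.
by rewrite -E js in ks.
Qed.

(** The Leibniz rule for a product of elements in distinct positions, with the
    signs absorbed in the factors: each summand has a coboundary in one
    position. *)
Lemma diff_inj_prod (s : seq 'I_r) (F : 'I_r -> A) : uniq s ->
  exists fs : seq ('I_r -> A),
    (forall i, (i < size fs)%N -> exists2 l, l \in s & exists y, nth F fs i l = diff y) /\
    diff (\prod_(k <- s) inj k (F k)) = \sum_(G <- fs) \prod_(k <- s) inj k (G k).
Proof.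
elim: s => [|k s IH] /=.
  by move=> _; exists [::]; rewrite !big_nil diff1.
case/andP => ks /IH [fs [hfs E]].
exists (upd F k (diff (F k)) :: [seq upd G k (sgn (F k)) | G <- fs]); split.
  case=> [_|i] /=; first by exists k; [apply: mem_head | exists (F k); rewrite /upd eqxx].
  rewrite size_map ltnS => ifs; have [l ls [y Ey]] := hfs i ifs.
  exists l; first by rewrite inE ls orbT.
  exists y; rewrite (nth_map F) // /upd ifN // ; by apply: contraNneq ks => <-.
rewrite big_cons diffM E big_cons big_map big_cons upd_prod // {1}/upd eqxx cdga_hom_diff.
congr (_ + _); rewrite mulr_sumr; apply: eq_bigr => G _.
by rewrite big_cons upd_prod // {1}/upd eqxx gca_hom_sgn.
Qed.

Lemma Lam_diff z : Lam (diff z) = 0.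
Proof.
have [|h hh] := @linear_exists T rat^o (fun z => Lam (diff z)).
  by move=> c a b; rewrite !linearP.
rewrite -hh; apply: tp_ext => a; rewrite hh.
have [fs [hfs ->]] := diff_inj_prod a (index_enum_uniq 'I_r).
rewrite linear_sum /= big_seq big1 // => G /(nthP a) [i ifs <-].
have [l _ [y Ey]] := hfs i ifs.
by apply: (Lam_zero (l := l)); rewrite Ey.
Qed.

(** A factor can be moved to its position at the price of signs, which are again
    absorbed in the other factors. *)
Lemma inj_prod_mul (F : 'I_r -> A) l p (b : A) : homog p b ->
  exists F' : 'I_r -> A, [/\ (\prod_(k < r) inj k (F k)) * inj l b = \prod_(k < r) inj k (F' k),
    F' l = F l * b & forall k, k != l -> F' k = F k \/ F' k = sgn (F k)].
Proof.
move=> hb.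
have [s1 [s2 Es]] : exists s1 s2, index_enum 'I_r = s1 ++ l :: s2.
  by case/splitPr: (mem_index_enum l) => s1 s2; exists s1, s2.
have := index_enum_uniq 'I_r; rewrite Es cat_uniq /= => /and3P [_ h1 /andP [l2 _]].
have hib : homog p (inj l b) by apply: gca_hom_homog.
pose sg (a : A) := if odd p then sgn a else a.
have move1 (s : seq 'I_r) : (\prod_(k <- s) inj k (F k)) * inj l b = inj l b * \prod_(k <- s) inj k (sg (F k)).
  elim: s => [|k s IH]; first by rewrite !big_nil mul1r mulr1.
  rewrite !big_cons -mulrA IH !mulrA; congr (_ * _); rewrite /sg.
  case: (boolP (odd p)) => op; last by rewrite (mul_even _ op hib).
  by rewrite (mul_odd _ op hib) -gca_hom_sgn sgnK.
exists (fun k => if k == l then F l * b else if k \in s2 then sg (F k) else F k); split.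
- rewrite [LHS](_ : _ = (\prod_(k <- s1 ++ l :: s2) inj k (F k)) * inj l b); last by rewrite -Es.
  rewrite [RHS](_ : _ = \prod_(k <- s1 ++ l :: s2) inj k (if k == l then F l * b else if k \in s2 then sg (F k) else F k)); last by rewrite -Es.
  rewrite !big_cat !big_cons /= eqxx rmorphM -!mulrA move1; congr (_ * _).
    apply: eq_big_seq => k k1; case: eqP => [E|_].
      by move: h1; rewrite -E k1.
    case: ifP => // k2; move: h1; rewrite negb_or => /andP [_ /hasPn h].
    by have := h k k2; rewrite /= k1.
  congr (_ * (_ * _)); apply: eq_big_seq => k k2; rewrite k2 ifN //.
  by apply: contraNneq l2 => <-.
- by rewrite eqxx.
- by move=> k kl; rewrite (negbTE kl) /sg; case: ifP => _; [case: ifP => _; [right|left] | left].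
Qed.

Lemma Lam_kill (F : 'I_r -> A) l (b : 'I_r -> A) s : K (F l) ->
  Lam ((\prod_(k < r) inj k (F k)) * \prod_(k <- s) inj k (b k)) = 0.
Proof.
elim: s F => [|k s IH] F KF.
  by rewrite big_nil mulr1; apply: (Lam_zero (l := l)); apply: lK.
rewrite big_cons mulrA; elim/homog_ind: (b k) => [y y' Hy Hy'|p y hy].
  by rewrite rmorphD mulrDr mulrDl linearD /= Hy Hy' addr0.
have [F' [-> F'k hF']] := inj_prod_mul F k hy.
apply: IH; have [E|nE] := eqVneq l k; first by rewrite E F'k -E; apply: (idMr iK).
by case: (hF' l nE) => ->; [|apply: (idsgn iK)].
Qed.

(** The largest two-sided ideal on which the functional vanishes: computations
    may be made modulo it before the functional is applied. *)
Definition Nul (v : T) := forall a b, Lam (a * v * b) = 0.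

Lemma Nul_inj l p y : homog p y -> K y -> Nul (inj l y).
Proof.
move=> hy Ky a b.
have [|h hh] := @linear_exists T rat^o (fun a => Lam (a * inj l y * b)).
  by move=> c u v; rewrite !mulrDl -!scalerAl linearP.
rewrite -hh; apply: tp_ext => F; rewrite hh {h hh a}.
have [|h hh] := @linear_exists T rat^o (fun b => Lam ((\prod_(k < r) inj k (F k)) * inj l y * b)).
  by move=> c u v; rewrite mulrDr -scalerAr linearP.
rewrite -hh; apply: tp_ext => G; rewrite hh.
have [F' [-> F'l _]] := inj_prod_mul F l hy.
by apply: (Lam_kill (l := l)); rewrite F'l; apply: (idMl iK).
Qed.

Lemma Nul0 : Nul 0. Proof. by move=> a b; rewrite mulr0 mul0r linear0. Qed.
Lemma NulP (c : rat) x y : Nul x -> Nul y -> Nul (c *: x + y).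
Proof.
move=> hx hy a b; rewrite mulrDr mulrDl -scalerAr -scalerAl linearP /= hx hy.
by rewrite scaler0 addr0.
Qed.
Lemma NulMl x y : Nul y -> Nul (x * y).
Proof. by move=> hy a b; rewrite mulrA. Qed.
Lemma NulMr x y : Nul x -> Nul (x * y).
Proof. by move=> hx a b; rewrite mulrA -mulrA. Qed.
Lemma Nul_Lam v : Nul v -> Lam v = 0.
Proof. by move=> /(_ 1 1); rewrite mul1r mulr1. Qed.

End TensorFunctional.

Definition ext0 n (V : zmodType) (f : 'I_n -> V) (k : nat) : V :=
  if insub k is Some i then f i else 0.

Lemma ext0E n (V : zmodType) (f : 'I_n -> V) (i : 'I_n) : ext0 f i = f i.
Proof. by rewrite /ext0 valK. Qed.

Lemma ext0P n (P : nat -> Prop) : (forall i : 'I_n, P i) -> forall k, (k < n)%N -> P k.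
Proof. by move=> h k kn; apply: (h (Ordinal kn)). Qed.

Lemma sum_sym n (V : zmodType) (F1 F2 F3 : 'I_n -> 'I_n -> V) :
  \sum_i \sum_j (F1 i j - F2 i j + (F3 i j - F3 j i)) =
  \sum_i \sum_j F1 i j - \sum_i \sum_j F2 i j.
Proof.
have E : \sum_i \sum_j (F3 i j - F3 j i) = 0.
  rewrite (eq_bigr (fun i => \sum_j F3 i j - \sum_j F3 j i)); last by move=> i _; rewrite -sumrB.
  by rewrite sumrB [X in _ - X]exchange_big subrr.
rewrite (eq_bigr (fun i => \sum_j (F1 i j - F2 i j) + \sum_j (F3 i j - F3 j i))); last first.
  by move=> i _; rewrite big_split.
rewrite big_split /= E addr0 -sumrB; apply: eq_bigr => i _.
by rewrite sumrB.
Qed.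
Lemma sum_prod (C : algType rat) (a b a' b' : C) :
  2%:R *: (a * a' + b * b') = (a + b) * (a' + b') + (b - a) * (b' - a').
Proof.
rewrite scaler_nat mulr2n !mulrDl !mulrDr !mulNr !mulrN opprK.
set p := a * a'; set q := b * b'; set u := a * b'; set v := b * a'.
have -> : p + u + (v + q) = p + q + (u + v) by rewrite (AC (2*2) ((1*4)*(2*3))).
have -> : q - v + (- u + p) = p + q - (u + v) by rewrite opprD (AC (2*2) ((4*1)*(3*2))).
by rewrite [RHS]addrACA subrr addr0.
Qed.

Section Lower.
Variables (n : nat) (A : cdga) (deg : gens n -> nat) (w : gens n -> A).
Hypotheses (hw : forall j, homog (deg j) (w j)).
Hypotheses (hx : forall i : 'I_n, ~~ odd (deg (gx i))) (hu : forall i : 'I_n, odd (deg (gu i)))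
  (hy : odd (deg (gy n))).
Hypotheses (hdx : forall i : 'I_n, diff (w (gx i)) = 0)
  (hdu : forall i : 'I_n, diff (w (gu i)) = w (gx i) ^+ 2).
Variable c : 'M[rat]_n.
Hypothesis hdy : diff (w (gy n)) = \sum_i \sum_j c i j *: (w (gx i) * w (gx j)).
Hypothesis gen : forall a, subalg_gen (fun b => exists j, b = w j) a.
Variable K : A -> Prop.
Hypotheses (iK : ideal K) (Kux : forall i : 'I_n, K (w (gu i)) /\ K (w (gx i) ^+ 2)).
Variable lam : {linear A -> rat^o}.
Let X := \prod_(i < n) w (gx i).
Let y := w (gy n).
Hypotheses (ld : forall a, lam (diff a) = 0) (lK : forall a, K a -> lam a = 0) (lt : lam (X * y) <> 0).

Let cn (i j : nat) : rat := ext0 (fun i' => ext0 (fun j' => c i' j' : rat^o) j : rat^o) i.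
Let cnE (i j : 'I_n) : cn i j = c i j. Proof. by rewrite /cn !ext0E. Qed.

(** [kappa_exists] in A itself, with s = t = x, a = u and eta = y. *)
Lemma cat_lower k : cat_le w k -> (n.+1 <= k)%N.
Proof.
case=> B [rho [[_ hq] hr]]; rewrite leqNgt; apply/negP => kn.
pose x := ext0 (fun i : 'I_n => w (gx i)).
pose u := ext0 (fun i : 'I_n => w (gu i)).
pose BB (j : nat) := \sum_(i < n) cn i j *: x i.
have xE (i : 'I_n) : x i = w (gx i) by apply: ext0E.
have uE (i : 'I_n) : u i = w (gu i) by apply: ext0E.
have evx (i : 'I_n) : ev (x i) by rewrite xE; apply: ev_homog (hx i) (hw _).
have w1 j : wl w 1 (w j) by have := wl_word w [:: j]; rewrite big_seq1.
have [||||||||||||||kap [dk Wk Nk]] := @kappa_exists A (wl w) K _ _ _ _ _ _ _ _ n x x u BB y.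
- exact: wl0.
- by move=> p r a b ha hb; apply: (idP (wl_ideal hw gen p)).
- by move=> p q a b; apply: wl_mul.
- by move=> p; apply: lin_span0.
- exact: id0.
- by move=> r a b; apply: idP.
- by move=> a b; apply: idMl.
- by move=> a b; apply: idMr.
- by apply: ext0P => i; split=> //; rewrite xE hdx.
- by apply: ext0P => i; rewrite xE; split=> //; rewrite -xE ?xE ?hdx // -xE.
- apply: ext0P => i; rewrite xE uE; split=> //; first exact: od_homog (hu i) (hw _).
  by case: (Kux i).
- apply: ext0P => j; split.
  + by apply: ev_sum => i; apply: evZ.
  + by rewrite linear_sum big1 // => i _; rewrite linearZ /= xE hdx scaler0.
  + by apply: lin_span_sum => i; apply: lin_spanZ; rewrite xE; apply: w1.
- by split; [exact: (od_homog hy (hw _)) | exact: w1].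
- rewrite hdy exchange_big /=; apply: eq_bigr => j _; rewrite mulr_suml.
  by apply: eq_bigr => i _; rewrite cnE !xE scalerAl.
have [|a Ea] := retraction_exact hr dk.
  by apply/hq; apply: wl_le Wk.
have PE : Pm x n = X by apply: eq_bigr => i _.
have := lK Nk; rewrite linearB /= Ea ld sub0r PE => /eqP.
by rewrite oppr_eq0 => /eqP.
Qed.

Hypothesis csym : forall i j, c i j = c j i.

(** The position 0 is compared with every other position.  The coefficients have to
    be symmetric for d eta to be sum B_j s_j: the terms x_i x'_j - x_j x'_i that
    arise cancel only in the symmetric sum. *)
Lemma TC_lower r' k : TC_le r'.+2 A k -> ((r'.+2 * n.+1).-1 <= k)%N.
Proof.
case=> T [inj [mu [B [rho [tT muT [_ hq] hr]]]]]; rewrite leqNgt; apply/negP => kn.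
pose I (z : T) := mu z = 0.
have iI : ideal I := ker_ideal mu.
pose W p (z : T) := p = 0%N \/ ideal_pow I p z.
have W0 z : W 0%N z by left.
have WP p (r : rat) a b : W p a -> W p b -> W p (r *: a + b).
  by case=> [->|ha]; [left | case=> [->|hb]; [left | right; apply: lin_spanD => //; apply: lin_spanZ]].
have WM p q a b : W p a -> W q b -> W (p + q)%N (a * b).
  case=> [->|ha]; case=> [->|hb]; first by left.
  - by case: q hb => [|q] hb; [left | right; apply: (idMl (pow_ideal iI q))].
  - by rewrite addn0; case: p ha => [|p] ha; [left | right; apply: (idMr (pow_ideal iI p))].
  - by right; apply: pow_mul.
have Wz p : W p 0 by right; apply: lin_span0.
have W1 k1 k2 a : W 1%N (inj k1 a - inj k2 a).
  by right; apply: pow1; rewrite /I rmorphB /= !muT subrr.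
pose L := Lam tT lam; pose N := Nul tT lam.
have N0 : N 0 by apply: Nul0.
have NP (r : rat) a b : N a -> N b -> N (r *: a + b) by apply: NulP.
have NMl a b : N b -> N (a * b) by apply: NulMl.
have NMr a b : N a -> N (a * b) by apply: NulMr.
have Ninj l p s : homog p s -> K s -> N (inj l s) by apply: Nul_inj.
have ND a b : N a -> N b -> N (a + b) by move=> ha hb; rewrite -[a]scale1r; apply: NP.
have NZ (r : rat) a : N a -> N (r *: a) by move=> ha; rewrite -[_ *: _]addr0; apply: NP.
pose x k := ext0 (fun i : 'I_n => inj k (w (gx i))).
pose u k := ext0 (fun i : 'I_n => inj k (w (gu i))).
pose Y k := inj k y.
have xE k1 (i : 'I_n) : x k1 i = inj k1 (w (gx i)) by apply: ext0E.
have uE k1 (i : 'I_n) : u k1 i = inj k1 (w (gu i)) by apply: ext0E.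
have evx k1 (i : 'I_n) : ev (x k1 i).
  by rewrite xE; apply: ev_homog (hx i) (gca_hom_homog _ (hw _)).
have dx k1 (i : 'I_n) : diff (x k1 i) = 0 by rewrite xE -cdga_hom_diff hdx rmorph0.
have du k1 (i : 'I_n) : diff (u k1 i) = x k1 i * x k1 i.
  by rewrite uE -cdga_hom_diff hdu rmorphXn /= xE expr2.
have odu k1 (i : 'I_n) : od (u k1 i) by rewrite uE; apply: od_homog (hu i) (gca_hom_homog _ (hw _)).
have odY k1 : od (Y k1) by apply: od_homog hy (gca_hom_homog _ (hw _)).
have Nu k1 (i : 'I_n) : N (u k1 i) by rewrite uE; apply: Ninj (hw _) _; case: (Kux i).
have Nx2 k1 (i : 'I_n) : N (x k1 i * x k1 i).
  rewrite xE -rmorphM -expr2; apply: Ninj (homogX 2 (hw _)) _; by case: (Kux i).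
have dY k1 : diff (Y k1) = \sum_(i < n) \sum_(j < n) cn i j *: (x k1 i * x k1 j).
  rewrite -cdga_hom_diff hdy rmorph_sum; apply: eq_bigr => i _; rewrite rmorph_sum.
  by apply: eq_bigr => j _ /=; rewrite linearZ rmorphM /= cnE !xE.
pose k0 : 'I_r'.+2 := ord0.
pose s k i := x k0 i + x k i.
pose t k i := x k i - x k0 i.
pose a k i := u k i - u k0 i.
pose BB k (j : nat) := \sum_(i < n) cn i j *: t k i.
pose eta k := Y k - Y k0.
have hs k1 : forall i, (i < n)%N -> ev (s k1 i) /\ diff (s k1 i) = 0.
  by apply: ext0P => i; split; [apply: evD | rewrite linearD /= !dx addr0].
have ht k1 : forall i, (i < n)%N -> [/\ ev (t k1 i), diff (t k1 i) = 0 & W 1%N (t k1 i)].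
  apply: ext0P => i; split; [by apply: evD => //; apply: evN | by rewrite linearB /= !dx subr0 |].
  by rewrite /t !xE.
have ha k1 : forall i, (i < n)%N ->
    [/\ od (a k1 i), diff (a k1 i) = s k1 i * t k1 i, W 1%N (a k1 i) & N (a k1 i)].
  apply: ext0P => i; split.
  - by apply: odD => //; apply: odN.
  - rewrite linearB /= !du /s /t mulrDl !mulrBr (proj1 (evx k1 i) (x k0 i)).
    by rewrite [RHS]addrC addrA subrK.
  - by rewrite /a !uE.
  - by apply: ND => //; rewrite -scaleN1r; apply: NZ.
have hB k1 : forall i, (i < n)%N -> [/\ ev (BB k1 i), diff (BB k1 i) = 0 & W 1%N (BB k1 i)].
  apply: ext0P => j; split.
  - by apply: ev_sum => i; apply: evZ; case: (ht k1 i (ltn_ord i)).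
  - by rewrite linear_sum big1 // => i _; rewrite linearZ /=; case: (ht k1 i (ltn_ord i)) => _ -> _; rewrite scaler0.
  - right; apply: lin_span_sum => i; apply: lin_spanZ.
    by case: (ht k1 i (ltn_ord i)) => _ _ [].
have he k1 : od (eta k1) /\ W 1%N (eta k1).
  by split; [apply: odD => //; apply: odN | apply: W1].
have deta k1 : diff (eta k1) = \sum_(j < n) BB k1 j * s k1 j.
  rewrite linearB /= !dY.
  have -> : \sum_(j < n) BB k1 j * s k1 j =
      \sum_(i < n) \sum_(j < n) cn i j *: (t k1 i * s k1 j).
    rewrite exchange_big /=; apply: eq_bigr => j _; rewrite mulr_suml.
    by apply: eq_bigr => i _; rewrite scalerAl.
  have E (i j : 'I_n) : cn i j *: (t k1 i * s k1 j) =
      cn i j *: (x k1 i * x k1 j) - cn i j *: (x k0 i * x k0 j) +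
      (cn i j *: (x k0 j * x k1 i) - cn j i *: (x k0 i * x k1 j)).
    rewrite [cn j i]cnE -csym -cnE -!scalerBr -scalerDr; congr (_ *: _).
    rewrite /t /s mulrBl !mulrDr (proj1 (evx k0 j)) opprD addrACA [RHS]addrACA.
    by rewrite addrC addrACA; congr (_ + _); rewrite addrC.
  rewrite [RHS](eq_bigr _ (fun i _ => eq_bigr _ (fun j _ => E i j))).
  by rewrite (sum_sym (fun i j : 'I_n => cn i j *: (x k1 i * x k1 j))
    (fun i j : 'I_n => cn i j *: (x k0 i * x k0 j))
    (fun i j : 'I_n => cn i j *: (x k0 j * x k1 i))).
have kapE k1 : exists kap, [/\ diff kap = 0, W n.+1 kap & N (kap - Pm (t k1) n * eta k1)].
  exact: (kappa_exists W0 WP WM Wz N0 NP NMl NMr (hs k1) (ht k1) (ha k1) (hB k1) (he k1) (deta k1)).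
have [kap hkap] := choice kapE.
pose k1 : 'I_r'.+2 := lift ord0 ord0.
pose b i := 2%:R *: (u k0 i + u k1 i).
pose eps := 2%:R *: (Y k0 + Y k1).
have hb : forall i, (i < n)%N -> diff (b i) = s k1 i ^+ 2 + t k1 i ^+ 2 /\ N (b i).
  apply: ext0P => i; split; last by apply: NZ; apply: ND.
  by rewrite linearZ linearD /= !du !expr2 sum_prod.
have deps : diff eps = \sum_(i < n) \sum_(j < n) cn i j *: (s k1 i * s k1 j + t k1 i * t k1 j).
  rewrite linearZ linearD /= !dY -big_split scaler_sumr; apply: eq_bigr => i _.
  rewrite -big_split scaler_sumr; apply: eq_bigr => j _ /=.
  rewrite -scalerDr scalerA mulrC -scalerA; congr (_ *: _).
  exact: sum_prod.
have [z2 [dz2 Wz2 Nz2]] := zeta_exists W0 WP WM Wz N0 NP NMl NMr (hs k1) (ht k1) (ha k1) (hB k1) (he k1)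
  hb (deta k1) deps.
pose Z k := inj k (X * y).
have dprod (q : seq 'I_r'.+2) : diff (\prod_(k <- q) kap k) = 0.
  elim: q => [|k' q IH]; first by rewrite big_nil diff1.
  by rewrite big_cons diffM IH mulr0 addr0; case: (hkap k') => ->; rewrite mul0r.
have Wprod (q : seq 'I_r'.+2) : W (size q * n.+1)%N (\prod_(k <- q) kap k).
  elim: q => [|k' q IH]; first by rewrite big_nil.
  by rewrite big_cons mulSn; apply: WM => //; case: (hkap k').
pose sq := [seq lift ord0 (lift ord0 i) | i <- index_enum 'I_r'] : seq 'I_r'.+2.
pose z := z2 * \prod_(k <- sq) kap k.
have dz : diff z = 0.
  rewrite diffM dz2 mul0r add0r.
  by rewrite dprod mulr0.
have Wz' : W (r'.+2 * n.+1).-1 z.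
  have -> : (r'.+2 * n.+1).-1 = (n.+1 + n + size sq * n.+1)%N.
    rewrite size_map (_ : size _ = r'); first by rewrite !mulSn; lia.
    by rewrite -[RHS]card_ord cardE enumT.
  exact: WM.
have Iz : ideal_pow I (r'.+2 * n.+1).-1 z by case: Wz' kn => // ->.
have [|y0 Ey0] := retraction_exact hr dz.
  apply/hq; apply: (pow_le iI (m := k) (k := (r'.+2 * n.+1).-1.-1)); first by move: kn; lia.
  by rewrite prednK //; apply: leq_ltn_trans kn.
have cong_mul (e e' f f' : T) : N (e - e') -> N (f - f') -> N (e * f - e' * f').
  move=> he' hf'; have -> : e * f - e' * f' = (e - e') * f + e' * (f - f').
    by rewrite mulrBl mulrBr addrA subrK.
  by apply: ND; [apply: NMr | apply: NMl].
have cong_trans (e f g : T) : N (e - f) -> N (f - g) -> N (e - g).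
  by move=> h1 h2; rewrite -(subrK f e) -addrA; apply: ND.
pose XX k := \prod_(i < n) x k i.
have XXE l : inj l X = XX l by rewrite rmorph_prod; apply: eq_bigr => i _ /=; rewrite xE.
have ZE l : Z l = XX l * Y l by rewrite /Z rmorphM /= XXE.
have evXX l : ev (XX l) by apply: ev_prod; apply: ext0P.
have evP l : ev (Pm (t l) n) by apply: ev_prod => i im; case: (ht l i im).
have YY l : Y l * Y l = 0 by apply: odd_sqr0 hy (gca_hom_homog _ (hw _)).
(* t^2 = (x' - x)^2 is congruent to - 2 x x', since x^2 and x'^2 lie in N. *)
have sqP m : (m <= n)%N -> N (Pm (t k1) m * Pm (t k1) m -
    (-2%:R) ^+ m *: (Pm (x k0) m * Pm (x k1) m)).
  elim: m => [|m IH] mn; first by rewrite /Pm !big_ord0 expr0 scale1r subrr.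
  have {}IH := IH (ltnW mn); move: mn => im; rewrite /Pm !big_ord_recr /= -!/(Pm _ m).
  pose i := Ordinal im; have [[ct _] _ _] := ht k1 i (ltn_ord i).
  have [c0 _] := evx k0 i; rewrite -[m]/(i : nat).
  set p := Pm (t k1) i in IH *; set p0 := Pm (x k0) i in IH *; set p1 := Pm (x k1) i in IH *.
  have -> : p * t k1 i * (p * t k1 i) = p * p * (t k1 i * t k1 i).
    by rewrite -!mulrA (mulrA (t k1 i)) ct -!mulrA.
  have -> : (- 2%:R) ^+ i.+1 *: (p0 * x k0 i * (p1 * x k1 i)) =
      (- 2%:R) ^+ i *: (p0 * p1) * (- 2%:R *: (x k0 i * x k1 i)).
    rewrite -scalerAl -scalerAr scalerA -exprSr; congr (_ *: _).
    by rewrite -!mulrA (mulrA (x k0 i)) c0 -!mulrA.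
  apply: cong_mul => //.
  have -> : t k1 i * t k1 i - - 2%:R *: (x k0 i * x k1 i) = x k1 i * x k1 i + x k0 i * x k0 i.
    rewrite /t mulrBl !mulrBr -c0 scaleNr opprK scaler_nat mulr2n.
    by rewrite opprB (AC ((2*2)*2) ((1*3)*((2*5)*(4*6)))) /= !addNr !addr0.
  exact: ND.
(* 2 (Y1 - Y0) (Y0 + Y1) = - 4 Y0 Y1, as Y0 and Y1 anticommute. *)
have etaeps : eta k1 * eps = (-4%:R) *: (Y k0 * Y k1).
  have Y10 : Y k1 * Y k0 = - (Y k0 * Y k1).
    by rewrite (mul_odd _ hy (gca_hom_homog _ (hw _))) (odY k0) mulNr.
  rewrite /eta /eps -scalerAr mulrDr !mulrBl !YY Y10 subr0 sub0r -scaleN1r -scalerDl scalerA.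
  by congr (_ *: _).
pose cst : rat := (-2%:R) ^+ n * (-4%:R).
have z2E : N (z2 - cst *: (Z k0 * Z k1)).
  apply: cong_trans Nz2 _.
  have -> : Pm (t k1) n * eta k1 * (Pm (t k1) n * eps) = Pm (t k1) n * Pm (t k1) n * (eta k1 * eps).
    by rewrite -!mulrA (evCA _ _ (evP k1)).
  have -> : cst *: (Z k0 * Z k1) = (-2%:R) ^+ n *: (Pm (x k0) n * Pm (x k1) n) * (-4%:R *: (Y k0 * Y k1)).
    rewrite -scalerAl -scalerAr scalerA; congr (_ *: _); rewrite !ZE -!/(XX _).
    by rewrite -!mulrA (evCA (Y k0) _ (evXX k1)).
  by apply: cong_mul; [apply: sqP | rewrite etaeps subrr].
(* Modulo N, Z k0 annihilates x k0 i and Y k0, so that kap k, which is congruent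
   to a product of differences with position k0, acts on multiples of Z k0 as
   Z k does. *)
have Zx v (i : 'I_n) : N (Z k0 * v * x k0 i).
  rewrite -(proj1 (evx k0 i)) mulrA; apply: (NMr); rewrite ZE mulrA; apply: (NMr).
  rewrite -XXE xE -rmorphM; have hX : homog (\sum_(j < n) deg (gx j)) X.
    by apply: (word_homog (v := fun i : 'I_n => w (gx i))).
  have -> : w (gx i) * X = \prod_(j <- i :: index_enum 'I_n) w (gx j) by rewrite big_cons.
  apply: (Ninj k0 (deg (gx i) + \sum_(j < n) deg (gx j))%N).
    by rewrite big_cons; apply: homogM.
  apply: (long_word iK (fun j : 'I_n => hw (gx j)) (l := index_enum 'I_n)) => [j|j|//].
    by rewrite -expr2; case: (Kux j).
  by rewrite mem_index_enum.
have ZY v : Z k0 * v * Y k0 = 0.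
  have E : v * Y k0 = Y k0 * sgn v.
    by rewrite (mul_odd _ hy (gca_hom_homog _ (hw _))) sgnK.
  by rewrite -mulrA E ZE !mulrA -(mulrA (XX k0)) YY mulr0 mul0r.
have Zt v l m : (m <= n)%N -> N (Z k0 * v * (Pm (t l) m - Pm (x l) m)).
  elim: m => [|m IH] mn; first by rewrite /Pm !big_ord0 subrr mulr0.
  have {}IH := IH (ltnW mn); pose i := Ordinal mn.
  have -> : Pm (t l) m.+1 - Pm (x l) m.+1 =
      (Pm (t l) m - Pm (x l) m) * x l m - Pm (t l) m * x k0 m.
    by rewrite /Pm !big_ord_recr /= {2}/t mulrBr mulrBl addrAC.
  rewrite mulrBr mulrA; apply: (ND); first exact: (NMr).
  rewrite -scaleN1r; apply: (NZ); rewrite mulrA -(mulrA (Z k0)); exact: (Zx _ i).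
have ZP v l : N (Z k0 * v * (Pm (t l) n * eta l) - Z k0 * v * Z l).
  have -> : Z k0 * v * (Pm (t l) n * eta l) - Z k0 * v * Z l =
      Z k0 * v * (Pm (t l) n - Pm (x l) n) * Y l - Z k0 * (v * Pm (t l) n) * Y k0.
    by rewrite [Z l]ZE -[eta l]/(Y l - Y k0) 2!mulrBr [in RHS]mulrBr mulrBl !mulrA addrAC.
  by rewrite ZY subr0; apply: (NMr); apply: (Zt).
have chain q v : N (Z k0 * v * \prod_(l <- q) kap l - Z k0 * v * \prod_(l <- q) Z l).
  elim: q v => [|l q IH] v; first by rewrite !big_nil subrr.
  rewrite !big_cons; have [_ _ Nl] := hkap l.
  apply: (cong_trans _ (Z k0 * v * Z l * \prod_(l <- q) kap l)).
    rewrite mulrA; apply: (cong_mul); last by rewrite subrr.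
    apply: (cong_trans _ (Z k0 * v * (Pm (t l) n * eta l))); last exact: (ZP).
    by rewrite -mulrBr; apply: (NMl).
  by have := IH (v * Z l); rewrite !mulrA.
have zE : N (z - cst *: (Z k0 * Z k1 * \prod_(l <- sq) Z l)).
  apply: (cong_trans _ (cst *: (Z k0 * Z k1) * \prod_(l <- sq) kap l)).
    by apply: (cong_mul) => //; rewrite subrr.
  by rewrite -scalerAl -scalerBr; apply: (NZ); apply: (chain).
have := Nul_Lam zE; rewrite linearB /= Ey0 (Lam_diff tT ld) sub0r linearZ /=.
have -> : Z k0 * Z k1 * \prod_(l <- sq) Z l = \prod_(l < r'.+2) inj l (X * y).
  by rewrite big_ord_recl big_ord_recl big_map mulrA.
have cst0 : cst != 0 by rewrite mulf_neq0 ?expf_neq0 // oppr_eq0 pnatr_eq0.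
rewrite (LamE tT lam (fun _ => X * y)) prodr_const card_ord => /eqP.
rewrite oppr_eq0 scaler_eq0 (negbTE cst0) /= expf_eq0 /= => /eqP.
exact: lt.
Qed.

End Lower.

(** * Homotopy characteristic and conclusion *)

Lemma chi_pi_gens (n : nat) (deg : gens n -> nat) :
  (forall i : 'I_n, ~~ odd (deg (gx i))) -> (forall i : 'I_n, odd (deg (gu i))) ->
  odd (deg (gy n)) -> chi_pi deg = -1.
Proof.
move=> hx hu hy; rewrite /chi_pi.
have count (P : pred (gens n)) : #|[set j | P j]| =
    (\sum_(i < n) P (gx i) + \sum_(i < n) P (gu i) + P (gy n))%N.
  rewrite -sum1_card big_mkcond big_sumType big_sumType /=.
  congr (_ + _ + _)%N; try by apply: eq_bigr => i _; rewrite inE.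
  by rewrite (big_pred1 tt) ?inE // => -[].
rewrite !count hy (eq_bigr (fun=> 1%N)); last by move=> i _; rewrite hx.
rewrite [X in (_ + X + _)%N]big1; last by move=> i _; rewrite hu.
rewrite [X in _ - (X + _ + _)%N%:Z]big1; last by move=> i _; rewrite (negbTE (hx i)).
rewrite [X in _ - (_ + X + _)%N%:Z](eq_bigr (fun=> 1%N)); last by move=> i _; rewrite hu.
rewrite sum1_card card_ord; lia.
Qed.

Theorem proposition19 (r n : nat) (hr : (2 <= r)%N)
    (A : cdga) (deg : gens n -> nat) (w : gens n -> A)
    (hA : minimal_sullivan deg w)
    (hx : forall i : 'I_n, ~~ odd (deg (gx i)))
    (hu : forall i : 'I_n, odd (deg (gu i)))
    (hy : odd (deg (gy n)))
    (hdx : forall i : 'I_n, diff (w (gx i)) = 0)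
    (hdu : forall i : 'I_n, diff (w (gu i)) = w (gx i) ^+ 2)
    (hdy : exists c : 'M[rat]_n,
       diff (w (gy n)) = \sum_i \sum_j c i j *: (w (gx i) * w (gx j))) :
  exists c t : nat,
    [/\ is_cat w c,
        is_TC r A t,
        t%:Z = r%:Z * c%:Z + chi_pi deg
      & r%:Z * c%:Z + chi_pi deg = r%:Z * (n%:Z + 1) - 1].
Proof.
have [K [S [[hK [lam [ld lK lt]] hA'] Kux hS Sux gen]]] := pure_data hA hx hu hy hdx hdu hdy.
have [_ [hw _] _ dw] := hA.
have iK := ac_ideal hK.
exists n.+1, (r * n.+1).-1; split.
- split; first exact: (cat_upper hw hy gen dw hA' hK Kux).
  case: hdy => c hc k.
  exact: (cat_lower hw hx hu hy hdx hdu hc gen iK Kux ld lK lt).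
- split; first exact: (TC_upper hw hy gen hS Sux (ltnW hr)).
  move=> k; case: r hr => [|[|r']] // _.
  (* The x_i commute, so the coefficient matrix may be symmetrized. *)
  case: hdy => c hc; pose c' : 'M[rat]_n := 2%:R^-1 *: (c + c^T).
  have hc' : diff (w (gy n)) = \sum_i \sum_j c' i j *: (w (gx i) * w (gx j)).
    have sw : diff (w (gy n)) = \sum_i \sum_j c j i *: (w (gx i) * w (gx j)).
      rewrite hc exchange_big; apply: eq_bigr => i _; apply: eq_bigr => j _ /=.
      by rewrite (mul_even _ (hx j) (hw _)).
    have -> : diff (w (gy n)) = 2%:R^-1 *: (diff (w (gy n)) + diff (w (gy n))).
      by rewrite -mulr2n -scaler_nat scalerA mulVf ?scale1r //.
    rewrite {1}hc sw -big_split scaler_sumr; apply: eq_bigr => i _ /=.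
    rewrite -big_split scaler_sumr; apply: eq_bigr => j _ /=.
    by rewrite -scalerDl scalerA !mxE.
  have sym i j : c' i j = c' j i by rewrite !mxE addrC.
  exact: (TC_lower hw hx hu hy hdx hdu hc' iK Kux ld lK lt sym).
- by rewrite (chi_pi_gens hx hu hy); lia.
- by rewrite (chi_pi_gens hx hu hy); lia.
Qed.
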